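(* Let $H\in(\tfrac12,1)$, $T>0$, and let $X=(X(t))_{t\in[0,T]}$ be the real-valued solution of the McKean--Vlasov equation driven by fractional Brownian motion $$dX(t)=\alpha(t,X(t),\mu_t)\,dt+\beta(t,\mu_t)\,dB^{(H)}(t),\qquad X(0)=Z,$$ where $\mu_t=\mathcal{L}(X(t))$. Assume that: (i) $\alpha:[0,T]\times\mathbb{R}\times\mathbb{M}_0\to\mathbb{R}$ and $\beta:[0,T]\times\mathbb{M}_0\to\mathbb{R}$ are bounded and continuous in $t$ (and in $x$ for $\alpha$) for each fixed measure; (ii) $\sup_{t\in[0,T]}\big|M^2(\beta\chi_{[0,t]})(t)\big|<\infty$; (iii) for each $t\in[0,T]$ the law $\mu_t$ belongs to $\mathbb{M}_0$. Then the map $t\mapsto\mu_t\in\mathbb{M}_0$ is absolutely continuous on $[0,T]$. In particular, $$\frac{d}{dt}\mu_t:=\lim_{h\to0}\frac{\mu_{t+h}-\mu_t}{h}$$ exists in $\mathbb{M}_0$ for all $t\in[0,T]$, and there is a constant $C>0$ independent of $t$ and $h$ such that $$\|\mu_{t+h}-\mu_t\|_{\mathbb{M}_0}\le C|h|\qquad\text{for all }t,\,t+h\in[0,T].$$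
   Context: $\mathbb{M}_0$: the Hilbert space obtained by completing the space of deterministic finite measures on $\mathbb{R}$ in the norm $\|\mu\|_{\mathbb{M}_0}^2=\int_{\mathbb{R}}|\widehat\mu(y)|^2e^{-y^2}\,dy$, where $\widehat\mu(y)=\int_{\mathbb{R}}e^{-ixy}\mu(dx)$. Limits at the endpoints of $[0,T]$ are one-sided. Operator $M$ (for $H\in(\frac12,1)$): $Mf(x)=C_H\int_{\mathbb{R}}\frac{f(x+y)}{|y|^{3/2-H}}\,dy$ with $C_H=[2\Gamma(H-\frac12)\cos(\frac{\pi}{2}(H-\frac12))]^{-1}$. Then $M^2f(x)=C_H^2\int_{\mathbb{R}}\int_{\mathbb{R}}|yz|^{H-3/2}f(y+z+x)\,dy\,dz$. $\chi_{[0,t]}$ is the indicator function of $[0,t]$, and $M^2(\beta\chi_{[0,t]})(t)$ denotes $M^2$ applied to the function $s\mapsto\beta(s,\mu_s)\chi_{[0,t]}(s)$, evaluated at the point $t$. Fractional Brownian motion: $B^{(H)}(t)=\int_{\mathbb{R}}M(\chi_{[0,t]})(s)\,dB(s)$ (continuous version), where $B$ is the Brownian motion on $\mathbb{R}$ on the white noise probability space. The integral with respect to $B^{(H)}$ is the Wick--It\^o--Skorohod integral. For a deterministic integrand $f$ on $[0,t]$ (as is $s\mapsto\beta(s,\mu_s)$) it is $\int_0^t f(s)\,dB^{(H)}(s)=\int_{\mathbb{R}}M(f\chi_{[0,t]})(s)\,dB(s)$. The stochastic differential equation is understood in the corresponding integrated form. Standing assumptions: $Z\in L^2(\mathbb{P})$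 is independent of $B^{(H)}$. There is a nondecreasing $K:[0,T]\to\mathbb{R}_+$ such that for all $t\in[0,T]$, $x,y\in\mathbb{R}$, $\mu,\nu\in\mathbb{M}_0$: $|\alpha(t,x,\mu)-\alpha(t,y,\nu)|\le K(t)(|x-y|+\|\mu-\nu\|_{\mathbb{M}_0})$, $|\beta(t,\mu)-\beta(t,\nu)|\le K(t)\|\mu-\nu\|_{\mathbb{M}_0}$, and $|\alpha(t,0,\delta_0)|+|\beta(t,\delta_0)|\le K(t)$. (Under these assumptions the equation has a unique solution and $t\mapsto\mu_t$ is continuous in $\mathbb{M}_0$.) *)

(* Defs.v *)
From HB Require Import structures.
From mathcomp Require Import all_boot all_order all_algebra.
From mathcomp Require Import all_classical all_reals all_analysis.
From mathcomp Require complex.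

Set Implicit Arguments.
Unset Strict Implicit.
Unset Printing Implicit Defensive.
Import Order.TTheory GRing.Theory Num.Theory.
Import numFieldNormedType.Exports.

Local Open Scope classical_set_scope.
Local Open Scope ring_scope.

Section signed_measures.
Context {R : realType}.
Implicit Types (nu : {charge set R -> \bar R}) (f : R -> R) (y : R).

(* The integral against a finite signed measure is the difference of the
   integrals against its Jordan parts; the Hahn decomposition that is picked
   does not matter, since the Jordan parts do not depend on it *)
Definition charge_integral nu f : R :=
  let hahnP := cid (Hahn_decomposition nu) in
  let nuPN := projT2 (cid (projT2 hahnP)) in
  \int[jordan_pos nuPN]_x f x - \int[jordan_neg nuPN]_x f x.

(* \int e^{-ixy} nu(dx), with e^{-ixy} = cos (x y) - i sin (x y) *)
Definition charge_fourier nu y : complex.complex R :=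
  complex.Complex (charge_integral nu (fun x => cos (x * y)))
                  (- charge_integral nu (fun x => sin (x * y))).

Definition M0_sqnorm nu : \bar R :=
  (\int[lebesgue_measure]_y
     (complex.ComplexField.Normc.normc (charge_fourier nu y) ^+ 2 * expR (- y ^+ 2))%R%:E)%E.

(* V, with the map emb, is a completion of the space of finite signed measures
   in the M0 norm. This determines (V, emb) up to a unique linear isometry.
   The parallelogram law passes from the measures to V, so that V is a (real)
   Hilbert space. *)
Record is_M0 (V : completeNormedModType R)
    (emb : {charge set R -> \bar R} -> V) : Prop := {
  M0_embD : forall m n, emb (cadd m n) = emb m + emb n ;
  M0_embZ : forall a m, emb (cscale a m) = a *: emb m ;
  M0_emb_norm : forall m, ((`|emb m| ^+ 2)%:E = M0_sqnorm m)%E ;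
  M0_emb_dense : dense (range emb) }.

Definition law d (T : measurableType d) (P : probability T R)
    (X : {RV P >-> R}) : {charge set R -> \bar R} :=
  charge_of_finite_measure (distribution P X).

Definition delta0 : {charge set R -> \bar R} :=
  charge_of_finite_measure (dirac (0 : R)).

End signed_measures.

Section fractional_operator.
Context {R : realType}.
Implicit Types (H x : R) (f : R -> R).

Definition Gamma (a : R) : R :=
  \int[lebesgue_measure]_(s in `]0, +oo[) (s `^ (a - 1) * expR (- s)).

Definition C_ H : R :=
  (2 * Gamma (H - 2^-1) * cos (pi / 2 * (H - 2^-1)))^-1.

Definition Mop H f x : R :=
  C_ H * \int[lebesgue_measure]_y (f (x + y) / `|y| `^ (3 / 2 - H)).

Definition M2op H f : R -> R := Mop H (Mop H f).

End fractional_operator.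

Section brownian.
Context {R : realType} d (Omega : measurableType d) (P : probability Omega R).
Implicit Types (B BH : R -> {RV P >-> R}) (I Z : {RV P >-> R}).

(* Two-sided Brownian motion, with time set R. In bm_normal the case s = t is
   excluded because normal_prob m 0 is not the Dirac measure. *)
Record is_brownian_motion B : Prop := {
  bm_0 : {ae P, forall w, B 0 w = 0} ;
  bm_continuous : {ae P, forall w, continuous (fun t => B t w)} ;
  bm_normal : forall s t, s < t -> forall A : set R, measurable A ->
    P [set w | A (B t w - B s w)] = normal_prob 0 (Num.sqrt (t - s)) A ;
  bm_indep : forall (n : nat) (t : nat -> R) (A : nat -> set R),
    (forall i, (i < n)%N -> t i <= t i.+1) -> (forall i, measurable (A i)) ->
    (P (\bigcap_(i in `I_n) [set w | A i (B (t i.+1) w - B (t i) w)%R]) =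
     \prod_(i < n) P [set w | A i (B (t i.+1) w - B (t i) w)%R])%E }.

(* The triple (c, a, b) stands for c 1_{]a, b]}, whose stochastic integral is
   c (B b - B a) when a <= b *)
Definition step_fun (s : seq (R * R * R)) (x : R) : R :=
  \sum_(p <- s) p.1.1 * \1_(`]p.1.2, p.2]) x.

Definition step_integral B (s : seq (R * R * R)) (w : Omega) : R :=
  \sum_(p <- s) p.1.1 * (B p.2 w - B p.1.2 w).

(* I is a version of \int_R g(s) dB(s), for g in L^2(R): the L^2(P)-limit of
   the integrals of step functions that converge to g in L^2(R) *)
Definition is_wiener_integral B (g : R -> R) I : Prop :=
  g \in Lfun (@lebesgue_measure R) 2%:E /\
  exists s : nat -> seq (R * R * R),
    [/\ forall n, all (fun p => p.1.2 <= p.2) (s n),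
        (\int[lebesgue_measure]_x ((step_fun (s n) x - g x) ^+ 2)%R%:E)%E
          @[n --> \oo] --> 0%E
      & (\int[P]_w ((step_integral B (s n) w - I w) ^+ 2)%R%:E)%E
          @[n --> \oo] --> 0%E].

(* I is a version of \int_0^t f(s) dB^(H)(s), for a deterministic f *)
Definition is_fbm_integral H B (f : R -> R) (t : R) I : Prop :=
  is_wiener_integral B (Mop H (fun s => f s * \1_(`[0, t]) s)) I.

Record is_fbm H B BH : Prop := {
  fbm_def : forall t, 0 <= t ->
    is_wiener_integral B (Mop H \1_(`[0, t])) (BH t) ;
  fbm_continuous :
    {ae P, forall w, {within `[0, +oo[, continuous (fun t => BH t w)}} }.

Definition process_algebra (D : set R) (Y : R -> {RV P >-> R}) :
    set (set Omega) :=
  <<s [set E | exists2 t, D t &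
       exists2 A : set R, measurable A & E = Y t @^-1` A] >>.

Definition independent_RV_process Z (D : set R) (Y : R -> {RV P >-> R}) :
    Prop :=
  forall (A : set R) (E : set Omega), measurable A -> process_algebra D Y E ->
    (P (Z @^-1` A `&` E) = P (Z @^-1` A) * P E)%E.

End brownian.

Section mckean_vlasov.
Context {R : realType} d (Omega : measurableType d) (P : probability Omega R).

(* mu t is the law of X t, seen in the completion V; the equation is required
   almost surely for each t, I being the stochastic integral *)
Record is_mv_solution (V : completeNormedModType R)
    (emb : {charge set R -> \bar R} -> V)
    (T H : R) (alpha : R -> R -> V -> R) (beta : R -> V -> R)
    (B : R -> {RV P >-> R}) (Z : {RV P >-> R})
    (X : R -> {RV P >-> R}) (mu : R -> V) : Prop := {
  mv_law : forall t, t \in `[0, T] -> mu t = emb (law (X t)) ;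
  mv_continuous :
    {ae P, forall w, {within `[0, T], continuous (fun t => X t w)}} ;
  mv_init : {ae P, forall w, X 0 w = Z w} ;
  mv_eq : forall t, t \in `[0, T] -> exists I : {RV P >-> R},
    is_fbm_integral H B (fun s => beta s (mu s)) t I /\
    {ae P, forall w,
      X t w = Z w
        + \int[lebesgue_measure]_(s in `[0, t]) alpha s (X s w) (mu s)
        + I w} }.

End mckean_vlasov.

Definition absolutely_continuous_on {R : realType} (V : normedModType R)
    (a b : R) (f : R -> V) : Prop :=
  forall e : R, 0 < e -> exists2 delta : R, 0 < delta &
    forall (n : nat) (u v : 'I_n -> R),
      (forall i, a <= u i /\ u i <= v i /\ v i <= b) ->
      trivIset setT (fun i => `]u i, v i[%classic) ->
      \sum_(i < n) (v i - u i) < delta ->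
      \sum_(i < n) `|f (v i) - f (u i)| < e.

(* Main.v *)
Require Import Defs.
From HB Require Import structures.
From mathcomp Require Import all_boot all_order all_algebra.
From mathcomp Require Import all_classical all_reals all_analysis.
From mathcomp Require Import measurable_realfun.
From mathcomp Require Import ring lra.

Set Implicit Arguments.
Unset Strict Implicit.
Unset Printing Implicit Defensive.
Import Order.TTheory GRing.Theory Num.Theory.
Import numFieldNormedType.Exports.

Local Open Scope classical_set_scope.
Local Open Scope ring_scope.

(** The norm of a finite measure is controlled by its integrals against cosines
    and sines, with a loss 1 + y^2 in the frequency y (M0_norm_le). So the whole
    statement is about E phi(X_t) for smooth bounded functions phi, uniformly in
    a bound M of phi and of its first two derivatives.

    Write a(s) = alpha(s, X_s, mu_s), b(s) = beta(s, mu_s) and G_t for the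
    integral of b 1_[0,t], so that X_t = Z + int_0^t a(s) ds + G_t. The law is
    continuous in t (continuous_law), hence so are b and the paths of a. With
    psi = phi', Taylor's formula gives, for a step h,

      E phi(X_{t+h}) - E phi(X_t)
        = E psi(X_t) (int_t^{t+h} a) + E psi(X_t) (G_{t+h} - G_t)
          + O(E (X_{t+h} - X_t)^2).

    The first term is differentiable in h since a is bounded with continuous
    paths. For the others, the operator M turns covariances of Wiener integrals
    into integrals against the kernel |u - r|^(2H - 2), which is locally
    integrable (Mop_inner). Two consequences (noise_increments): the variance of
    G_{t+h} - G_t is O(h^(1 + th)) for some th > 0, so that the last term is
    o(h); and h^-1 E G_s (G_{t+h} - G_t) converges as h tends to 0, uniformly in
    s, although (G_{t+h} - G_t) / h is in general unbounded in L^2.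

    It remains to go from correlations of xi = (G_{t+h} - G_t) / h with the
    noise to its correlation with psi(X_t). The solution is a Lipschitz
    functional of Z and of the path of G, and xi and G are jointly Gaussian and
    independent of Z. For a bounded Lipschitz function F of jointly Gaussian
    variables S_i, Gaussian integration by parts

      E xi F(S) = sum_i E (xi S_i) E (d_i F(S))

    yields |E xi F(S)| <= Lip(F) max_i |E xi S_i| (step_gauss for Brownian
    increments, then gauss_closure for L^2 limits). Applied to Euler's scheme,
    whose Lipschitz constant is at most exp (K T) for every step size, and passing to
    the limit, it gives |E xi psi(X_t)| <= M exp (K T) sup_s |E xi G_s|
    (solution_gauss). This replaces the derivatives of Malliavin calculus. The
    independence of Z is known for BH only, not for the Brownian motion B, so the
    Gaussian variables are approximated by combinations of values of BH
    (fbm_integral_limit, gauss_independent).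

    Taking xi = (G_{t+h} - G_t) gives the Lipschitz bound of t |-> mu_t, hence
    absolute continuity (law_lipschitz); taking for xi the difference of two
    difference quotients shows that the difference quotients of mu are Cauchy
    (law_quotient_cauchy), and the space is complete. *)

(** * Square-integrable functions *)
Notation intg mu f := (mu.-integrable setT (EFin \o f)).

Section real_integrals.
Context d (T : measurableType d) (R : realType)
  (mu : {measure set T -> \bar R}).
Implicit Types (f g : T -> R).

Lemma intg_measurable f : intg mu f -> measurable_fun setT f.
Proof. by move=> /(measurable_int mu) /measurable_EFinP. Qed.

Lemma intgD f g : intg mu f -> intg mu g -> intg mu (fun x => f x + g x).
Proof. by move=> hf hg; exact: (integrableD measurableT hf hg). Qed.

Lemma intgB f g : intg mu f -> intg mu g -> intg mu (fun x => f x - g x).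
Proof. by move=> hf hg; exact: (integrableB measurableT hf hg). Qed.

Lemma intgZ (a : R) f : intg mu f -> intg mu (fun x => a * f x).
Proof. by move=> hf; exact: (integrableZl measurableT a hf). Qed.

Lemma intg_le f g : measurable_fun setT f -> (forall x, `|f x| <= g x) ->
  intg mu g -> intg mu f.
Proof.
move=> mf fg; apply: le_integrable => //; first exact/measurable_EFinP.
by move=> x _ /=; rewrite lee_fin (le_trans (fg x)) ?ler_norm.
Qed.

Lemma intg_abs f : intg mu f -> intg mu (fun x => `|f x|).
Proof.
move=> hf; have := intg_measurable hf => mf.
apply: le_integrable hf => //; first exact/measurable_EFinP/measurableT_comp.
by move=> x _ /=; rewrite lee_fin normr_id.
Qed.

Lemma intg_sum (I : Type) (s : seq I) (F : I -> T -> R) :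
  (forall i, intg mu (F i)) -> intg mu (fun x => \sum_(i <- s) F i x).
Proof.
move=> hF; elim: s => [|i s ih].
  under eq_fun do rewrite big_nil; exact: integrable0.
by under eq_fun do rewrite big_cons; exact: intgD.
Qed.

Lemma Rint_sum (I : Type) (s : seq I) (F : I -> T -> R) :
  (forall i, intg mu (F i)) ->
  \int[mu]_x (\sum_(i <- s) F i x) = \sum_(i <- s) \int[mu]_x F i x.
Proof.
move=> hF; elim: s => [|i s ih].
  under eq_Rintegral do rewrite big_nil.
  by rewrite big_nil Rintegral_cst// mul0r.
under eq_Rintegral do rewrite big_cons.
by rewrite RintegralD ?big_cons ?ih//; exact: intg_sum.
Qed.

Lemma le_Rint_abs f g : intg mu f -> intg mu g -> (forall x, `|f x| <= g x) ->
  `|\int[mu]_x f x| <= \int[mu]_x g x.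
Proof.
move=> hf hg fg; apply: (le_trans (le_normr_Rintegral _ hf)) => //.
by apply: le_Rintegral => //; exact: intg_abs.
Qed.

Lemma ae_eq_Rint f g : measurable_fun setT f -> measurable_fun setT g ->
  {ae mu, forall x, f x = g x} -> \int[mu]_x f x = \int[mu]_x g x.
Proof.
move=> mf mg fg; rewrite /Rintegral; congr fine.
apply: ae_eq_integral => //; try exact/measurable_EFinP.
by apply: filterS fg => x /= -> _.
Qed.

Lemma ae_intg f g : measurable_fun setT f -> {ae mu, forall x, `|f x| <= g x} ->
  intg mu g -> intg mu f.
Proof.
move=> mf fg hg; have mg := intg_measurable hg.
apply/integrableP; split; first exact/measurable_EFinP.
have := integrableP _ _ _ hg => -[_]; apply: le_lt_trans.
apply: ae_ge0_le_integral => //.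
- by apply: measurableT_comp => //; exact/measurable_EFinP.
- by apply: measurableT_comp => //; exact/measurable_EFinP.
by apply: filterS fg => x /= h _; rewrite lee_fin (le_trans h)// ler_norm.
Qed.

Lemma ae_le_Rint_abs f g : measurable_fun setT f -> intg mu g ->
  {ae mu, forall x, `|f x| <= g x} -> `|\int[mu]_x f x| <= \int[mu]_x g x.
Proof.
move=> mf hg fg; have hf := ae_intg mf fg hg; have mg := intg_measurable hg.
have hm : intg mu (fun x => Num.max `|f x| (g x)).
  apply: (ae_intg (g := g)) => //.
    by apply: measurable_maxr => //; exact: measurableT_comp.
  apply: filterS fg => x h; rewrite (max_idPr h) ger0_norm//.
  by apply: le_trans h.
rewrite -(@ae_eq_Rint (fun x => Num.max `|f x| (g x)) g) //; last 2 first.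
  exact: intg_measurable.
  by apply: filterS fg => x h; rewrite (max_idPr h).
by apply: le_Rint_abs => // x; rewrite le_max lexx.
Qed.

(** Square-integrable functions, as functions rather than classes *)
Definition sqint f := measurable_fun setT f /\ intg mu (fun x => f x ^+ 2).

Lemma sqintM f g : sqint f -> sqint g -> intg mu (fun x => f x * g x).
Proof.
move=> [mf hf] [mg hg].
apply: (@intg_le _ (fun x => f x ^+ 2 + g x ^+ 2)).
- exact: measurable_funM.
- move=> x; rewrite normrM -(real_normK (num_real (f x))).
  rewrite -(real_normK (num_real (g x))).
  have := sqr_ge0 (`|f x| - `|g x|); have := normr_ge0 (f x).
  by have := normr_ge0 (g x); nra.
- exact: intgD.
Qed.

Lemma sqintZ (a : R) f : sqint f -> sqint (fun x => a * f x).
Proof.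
move=> [mf hf]; split; first exact: measurable_funM.
by under eq_fun do rewrite exprMn; exact: intgZ.
Qed.

Lemma sqintD f g : sqint f -> sqint g -> sqint (fun x => f x + g x).
Proof.
move=> hf hg; split; first by apply: measurable_funD; [case: hf|case: hg].
have -> : (fun x => (f x + g x) ^+ 2) =
  (fun x => f x ^+ 2 + g x ^+ 2 + 2 * (f x * g x)) by apply/funext => x; ring.
apply: intgD; last exact/intgZ/sqintM.
by apply: intgD; [case: hf|case: hg].
Qed.

Lemma sqintB f g : sqint f -> sqint g -> sqint (fun x => f x - g x).
Proof.
move=> hf hg; have := sqintD hf (sqintZ (-1) hg).
by under eq_fun do rewrite mulN1r.
Qed.

Lemma sqint_sum (I : Type) (s : seq I) (F : I -> T -> R) :
  (forall i, sqint (F i)) -> sqint (fun x => \sum_(i <- s) F i x).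
Proof.
move=> hF; elim: s => [|i s ih].
  under eq_fun do rewrite big_nil; split => //.
  under eq_fun do rewrite expr0n; exact: integrable0.
by under eq_fun do rewrite big_cons; exact: sqintD.
Qed.

Lemma sqint_abs f : sqint f -> sqint (fun x => `|f x|).
Proof.
move=> [mf hf]; split; first exact: measurableT_comp.
by under eq_fun do rewrite real_normK ?num_real//.
Qed.

Definition nrm2 f : R := Num.sqrt (\int[mu]_x (f x ^+ 2)).

Lemma nrm2_ge0 f : 0 <= nrm2 f. Proof. exact: sqrtr_ge0. Qed.

Lemma Rint_sqr_ge0 f : 0 <= \int[mu]_x (f x ^+ 2).
Proof. by apply: Rintegral_ge0 => x _; exact: sqr_ge0. Qed.

Lemma nrm2K f : nrm2 f ^+ 2 = \int[mu]_x (f x ^+ 2).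
Proof. by rewrite sqr_sqrtr// Rint_sqr_ge0. Qed.

Lemma Rint_sqrD f g : sqint f -> sqint g ->
  \int[mu]_x ((f x + g x) ^+ 2) =
  \int[mu]_x (f x ^+ 2) + 2 * \int[mu]_x (f x * g x) + \int[mu]_x (g x ^+ 2).
Proof.
move=> hf hg; have hfg := sqintM hf hg; case: hf hg => mf hf [mg hg].
have h2 : intg mu (fun x => 2 * (f x * g x)) by exact: intgZ.
have h3 := intgD hf h2.
rewrite -RintegralZl// -!RintegralD//.
by apply: eq_Rintegral => x _; ring.
Qed.

(** The discriminant of the nonnegative polynomial t |-> ||f + t g||^2 *)
Lemma cauchy_schwarz f g : sqint f -> sqint g ->
  `|\int[mu]_x (f x * g x)| <= nrm2 f * nrm2 g.
Proof.
move=> hf hg; rewrite -ler_sqr ?nnegrE ?mulr_ge0 ?nrm2_ge0//.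
rewrite exprMn !nrm2K real_normK ?num_real//.
set a := \int[mu]_x (f x ^+ 2); set b := \int[mu]_x (g x ^+ 2).
set c := \int[mu]_x (f x * g x).
have pol (s t : R) : 0 <= s ^+ 2 * a + 2 * (s * t) * c + t ^+ 2 * b.
  have := Rint_sqr_ge0 (fun x => s * f x + t * g x).
  rewrite Rint_sqrD; [|exact: sqintZ..].
  have -> : \int[mu]_x ((s * f x) ^+ 2) = s ^+ 2 * a.
    rewrite -RintegralZl//; last by case: hf.
    by apply: eq_Rintegral => x _; rewrite exprMn.
  have -> : \int[mu]_x ((t * g x) ^+ 2) = t ^+ 2 * b.
    rewrite -RintegralZl//; last by case: hg.
    by apply: eq_Rintegral => x _; rewrite exprMn.
  have -> : \int[mu]_x (s * f x * (t * g x)) = s * t * c.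
    rewrite -RintegralZl//; last exact: sqintM.
    by apply: eq_Rintegral => x _; rewrite mulrACA.
  by move=> h; rewrite -(mulrA 2).
have a0 : 0 <= a by exact: Rint_sqr_ge0.
have b0 : 0 <= b by exact: Rint_sqr_ge0.
have [a_eq0|a_neq0] := eqVneq a 0.
  have := pol (- (b + 1)) c; rewrite a_eq0 mul0r.
  have -> : (- (b + 1)) ^+ 2 * 0 + 2 * (- (b + 1) * c) * c + c ^+ 2 * b =
    - ((b + 2) * c ^+ 2) by ring.
  by rewrite oppr_ge0 pmulr_rle0// ltr_wpDl.
have ap : 0 < a by rewrite lt_neqAle eq_sym a_neq0.
have := pol (- c) a; have -> : (- c) ^+ 2 * a + 2 * (- c * a) * c + a ^+ 2 * b =
  a * (a * b - c ^+ 2) by ring.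
by rewrite pmulr_rge0// subr_ge0.
Qed.

Lemma cauchy_schwarz_abs f g : sqint f -> sqint g ->
  \int[mu]_x (`|f x| * `|g x|) <= nrm2 f * nrm2 g.
Proof.
move=> hf hg; have := cauchy_schwarz (sqint_abs hf) (sqint_abs hg).
move=> /(le_trans (ler_norm _)); congr (_ <= _ * _); congr Num.sqrt;
  by apply: eq_Rintegral => x _; rewrite real_normK ?num_real.
Qed.

Lemma nrm2D f g : sqint f -> sqint g ->
  nrm2 (fun x => f x + g x) <= nrm2 f + nrm2 g.
Proof.
move=> hf hg; rewrite -ler_sqr ?nnegrE ?addr_ge0 ?nrm2_ge0// nrm2K Rint_sqrD//.
rewrite sqrrD !nrm2K lerD2r lerD2l -[leRHS]mulr_natl ler_pM2l//.
exact: le_trans (ler_norm _) (cauchy_schwarz hf hg).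
Qed.

Lemma nrm2Z (a : R) f : sqint f -> nrm2 (fun x => a * f x) = `|a| * nrm2 f.
Proof.
move=> [mf hf]; rewrite /nrm2; under eq_Rintegral do rewrite exprMn.
by rewrite RintegralZl// sqrtrM ?sqr_ge0// sqrtr_sqr.
Qed.

Lemma nrm2BC f g : nrm2 (fun x => f x - g x) = nrm2 (fun x => g x - f x).
Proof.
by rewrite /nrm2; congr Num.sqrt; apply: eq_Rintegral => x _; rewrite -sqrrN opprB.
Qed.

Lemma nrm2_le f g : sqint f -> sqint g ->
  nrm2 f <= nrm2 g + nrm2 (fun x => f x - g x).
Proof.
move=> hf hg; have := nrm2D hg (sqintB hf hg).
by under [X in nrm2 X <= _ -> _]eq_fun do rewrite addrC subrK.
Qed.

(** Continuity of the inner product *)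
Lemma inner_close f f' g g' : sqint f -> sqint f' -> sqint g -> sqint g' ->
  `|\int[mu]_x (f x * g x) - \int[mu]_x (f' x * g' x)| <=
  nrm2 (fun x => f x - f' x) * nrm2 g + nrm2 f' * nrm2 (fun x => g x - g' x).
Proof.
move=> hf hf' hg hg'.
have -> : \int[mu]_x (f x * g x) - \int[mu]_x (f' x * g' x) =
   \int[mu]_x ((f x - f' x) * g x) + \int[mu]_x (f' x * (g x - g' x)).
  rewrite -RintegralB ?sqintM// -RintegralD ?sqintM//; try exact: sqintB.
  by apply: eq_Rintegral => x _; ring.
by apply: (le_trans (ler_normD _ _)); apply: lerD; apply: cauchy_schwarz => //;
  exact: sqintB.
Qed.

End real_integrals.

Section finite_integrals.
Context d (T : measurableType d) (R : realType) (P : probability T R).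
Implicit Types (f g : T -> R).

Lemma intg_cst (c : R) : intg P (fun _ : T => c).
Proof. exact: finite_measure_integrable_cst. Qed.

Lemma intg_bounded f (C : R) : measurable_fun setT f -> (forall x, `|f x| <= C) ->
  intg P f.
Proof. by move=> mf fC; apply: (intg_le mf fC); exact: intg_cst. Qed.

Lemma sqint_bounded f (C : R) : measurable_fun setT f -> (forall x, `|f x| <= C) ->
  sqint P f.
Proof.
move=> mf fC; split => //; apply: (@intg_bounded _ (C ^+ 2)).
  exact: measurable_funX.
by move=> x; rewrite normrX lerXn2r ?nnegrE// (le_trans _ (fC x)).
Qed.

Lemma Rint_cst (c : R) : \int[P]_x c = c.
Proof. by rewrite Rintegral_cst//= probability_setT mulr1. Qed.

Lemma sqint_intg f : sqint P f -> intg P f.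
Proof.
move=> hf; have h1 : sqint P (fun _ : T => 1).
  by apply: (@sqint_bounded _ 1) => // x; rewrite normr1.
by have := sqintM hf h1; under eq_fun do rewrite mulr1.
Qed.

End finite_integrals.

(** * Freezing a variable that is independent of the others *)

Section freezing.
Context d (Omega : measurableType d) (R : realType) (P : probability Omega R).
Context d' (T : measurableType d').
Variables (Y : Omega -> T) (nu : probability T R) (G : set (set Omega)).
Hypothesis mY : measurable_fun setT Y.
Hypothesis mG : forall E, <<s G >> E -> measurable E.
Hypothesis law_Y : forall A, measurable A -> P (Y @^-1` A) = nu A.
Hypothesis indep : forall A E, measurable A -> <<s G >> E ->
  (P (Y @^-1` A `&` E) = P (Y @^-1` A) * P E)%E.

Local Notation OG := (g_sigma_algebraType G).

Let idG (w : Omega) : OG := w.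
Let midG : measurable_fun setT idG.
Proof. by move=> _ E mE; rewrite setTI; exact: mG. Qed.
Let idGf : {mfun Omega >-> OG} :=
  HB.pack idG (isMeasurableFun.Build _ _ _ _ idG midG).

Let J (w : Omega) : T * OG := (Y w, w).
Let mJ : measurable_fun setT J.
Proof. exact: (measurable_fun_pair mY midG). Qed.
Let Jf : {mfun Omega >-> (T * OG)%type} :=
  HB.pack J (isMeasurableFun.Build _ _ _ _ J mJ).

Let lawJ X : measurable X ->
  (nu \x (distribution P idGf))%E X = distribution P Jf X.
Proof.
apply: product_measure_unique => A E mA mE.
rewrite /distribution /pushforward/= -law_Y// -indep//; congr (P _).
Qed.

Variable f : T * OG -> R.
Hypothesis mf : measurable_fun setT f.
Hypothesis hf : intg P (fun w => f (Y w, w)).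

Let hfJ : (distribution P Jf).-integrable setT (EFin \o f).
Proof.
apply: integrable_pushforward => //.
- exact/measurable_EFinP.
Qed.

Let hfprod : (nu \x (distribution P idGf))%E.-integrable setT
  (EFin \o f).
Proof.
apply/integrableP; split; first exact/measurable_EFinP.
rewrite (eq_measure_integral (distribution P Jf)).
  by have /integrableP[] := hfJ.
by move=> A mA _; exact: lawJ.
Qed.

Let intE : (\int[P]_w (f (Y w, w))%:E)%E =
  (\int[nu \x (distribution P idGf)]_z (f z)%:E)%E.
Proof.
rewrite (eq_measure_integral (distribution P Jf)); last first.
  by move=> A mA _; exact: lawJ.
rewrite (integral_pushforward (phi := Jf)) ?preimage_setT//.
exact/measurable_EFinP.
Qed.

(** By independence the law of (Y, w), on the product of T and of Omega with
    the sigma-algebra generated by G, is a product measure; Fubini's theorem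
    then integrates over Y first *)
Lemma freeze_le (K : R) :
  (forall w : Omega, `|(\int[nu]_y (f (y, w))%:E)%E| <= K%:E)%E ->
  `|\int[P]_w f (Y w, w)| <= K.
Proof.
move=> hK; rewrite -lee_fin (EFin_normr_Rintegral measurableT hf) intE.
rewrite -integral21_prod_meas1//.
apply: (le_trans (le_abse_integral _ measurableT _)).
  by have := measurable_fubini_G hfprod.
apply: (@le_trans _ _ (\int[distribution P idGf]_w K%:E)%E).
  apply: ge0_le_integral => //.
  - by apply: measurableT_comp => //; have := measurable_fubini_G hfprod.
  - by move=> w _; exact: hK.
by rewrite integral_cst//= probability_setT mule1.
Qed.

(** Fubini's theorem in the other order: Y is frozen *)
Lemma freeze_le_fst (K : R) :
  (forall y, `|\int[P]_w f (y, w)| <= K) -> (forall y, intg P (fun w => f (y, w))) ->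
  `|\int[P]_w f (Y w, w)| <= K.
Proof.
move=> hK hfy; rewrite -lee_fin (EFin_normr_Rintegral measurableT hf) intE.
rewrite -integral12_prod_meas1//.
apply: (le_trans (le_abse_integral _ measurableT _)).
  by have := measurable_fubini_F hfprod.
apply: (@le_trans _ _ (\int[nu]_w K%:E)%E).
  apply: ge0_le_integral => //.
  - by apply: measurableT_comp => //; have := measurable_fubini_F hfprod.
  - move=> y _; rewrite /fubini_F (integral_pushforward (phi := idGf))//.
    + by rewrite preimage_setT -EFin_normr_Rintegral// lee_fin.
    + by apply: measurableT_comp => //; exact: measurableT_comp.
    + by rewrite preimage_setT; exact: hfy.
by rewrite integral_cst//= probability_setT mule1.
Qed.

End freezing.

(** * Affine changes of variable in Lebesgue integrals *)

Section lebesgue_affine.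
Context {R : realType}.
Local Notation mu := (@lebesgue_measure R).

Lemma lebesgue_measure_shift (b : R) (A : set R) : measurable A ->
  pushforward mu ((fun x => x + b) : _ -> measurableTypeR R) A = mu A.
Proof.
have mb : measurable_fun setT ((fun x => x + b) : measurableTypeR R -> measurableTypeR R).
  exact: measurable_funD.
move=> mA; apply/esym/lebesgue_measure_unique => //= _ [[p q]] _ <-.
rewrite /pushforward (_ : _ @^-1` _ = `](p - b), (q - b)]%classic); last first.
  by apply/seteqP; split => x /=; rewrite !in_itv/= ltrBlDr lerBrDr.
rewrite !lebesgue_measure_itv/= !lte_fin ltrD2r.
by case: ifPn => // _; rewrite -!EFinD; congr EFin; ring.
Qed.

Lemma lebesgue_measure_scale (a : R) (A : set R) : 0 < a -> measurable A ->
  (a%:E * pushforward mu ((fun x => a * x)%R : _ -> measurableTypeR R) A = mu A)%E.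
Proof.
move=> a0 mA.
have ma : measurable_fun setT ((fun x => a * x) : measurableTypeR R -> measurableTypeR R).
  exact: measurable_funM.
pose f := (fun x => a * x) : measurableTypeR R -> measurableTypeR R.
have := @lebesgue_measure_unique R (mscale (NngNum (ltW a0)) (pushforward mu f)).
move=> /(_ ma _ A mA) => ->; first by [].
move=> _ [[p q]] _ <-.
rewrite [RHS](_ : _ =
  (a%:E * mu `](p / a)%R, (q / a)%R]%classic)%E); last first.
  rewrite /mscale /pushforward/=; congr (_ * mu _)%E.
  by apply/seteqP; split => x /=; rewrite !in_itv/= ltr_pdivrMr// ler_pdivlMr// mulrC.
rewrite !lebesgue_measure_itv/= !lte_fin ltr_pM2r ?invr_gt0//.
case: ifPn => // _; last by rewrite mule0.
by rewrite -!EFinD -EFinM; congr EFin; field; rewrite gt_eqF.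
Qed.

Lemma ge0_integral_shift (b : R) (f : R -> \bar R) : measurable_fun setT f ->
  (forall x, 0 <= f x)%E -> (\int[mu]_x f (x + b)%R = \int[mu]_x f x)%E.
Proof.
move=> mf f0.
have mb : measurable_fun setT ((fun x => x + b) : measurableTypeR R -> measurableTypeR R).
  exact: measurable_funD.
have := ge0_integral_pushforward mb (D := setT) (f := f) mu measurableT.
rewrite preimage_setT => /(_ mf (fun x _ => f0 x)) <-.
by apply: eq_measure_integral => //= A mA _; exact: lebesgue_measure_shift.
Qed.

Lemma ge0_integral_opp (f : R -> \bar R) : measurable_fun setT f ->
  (forall x, 0 <= f x)%E -> (\int[mu]_x f (- x)%R = \int[mu]_x f x)%E.
Proof.
move=> mf f0.
have mb : measurable_fun setT ((fun x => - x) : measurableTypeR R -> measurableTypeR R).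
  exact: measurableT_comp.
have := ge0_integral_pushforward mb (D := setT) (f := f) mu measurableT.
rewrite preimage_setT => /(_ mf (fun x _ => f0 x)) <-.
by apply: eq_measure_integral => //= A mA _; exact: lebesgue_measureN.
Qed.

Lemma ge0_integral_scale (a : R) (f : R -> \bar R) : 0 < a ->
  measurable_fun setT f -> (forall x, 0 <= f x)%E ->
  (a%:E * \int[mu]_x f (a * x)%R = \int[mu]_x f x)%E.
Proof.
move=> a0 mf f0.
have ma : measurable_fun setT ((fun x => a * x) : measurableTypeR R -> measurableTypeR R).
  exact: measurable_funM.
have := ge0_integral_pushforward ma (D := setT) (f := f) mu measurableT.
rewrite preimage_setT => /(_ mf (fun x _ => f0 x)) <-.
pose g := (fun x => a * x) : measurableTypeR R -> measurableTypeR R.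
have := @ge0_integral_mscale _ _ _ (pushforward mu g) setT measurableT
  (NngNum (ltW a0)) f mf (fun x _ => f0 x).
rewrite /= => <-.
by apply: eq_measure_integral => //= A mA _; exact: lebesgue_measure_scale.
Qed.

Lemma intg_shift (b : R) (f : R -> R) : intg mu f -> intg mu (fun x => f (x + b)).
Proof.
move=> hf; have mf := intg_measurable hf; apply/integrableP; split.
  by apply/measurable_EFinP; apply: measurableT_comp => //; exact: measurable_funD.
rewrite (ge0_integral_shift b (f := fun x => `|(f x)%:E|%E))//.
  by have /integrableP[] := hf.
by apply: measurableT_comp => //; exact/measurable_EFinP.
Qed.

Lemma Rintegral_shift (b : R) (f : R -> R) : intg mu f ->
  \int[mu]_x f (x + b) = \int[mu]_x f x.
Proof.
move=> hf; have hfb := intg_shift b hf; have mf := intg_measurable hf.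
have mb : measurable_fun setT ((fun x => x + b) : measurableTypeR R -> measurableTypeR R).
  exact: measurable_funD.
have := integral_pushforward mb (D := setT) (f := EFin \o f) (mu := mu).
rewrite preimage_setT => h; rewrite /Rintegral; congr fine.
rewrite -[LHS]h//.
  by apply: eq_measure_integral => //= A mA _; exact: lebesgue_measure_shift.
exact/measurable_EFinP.
Qed.

End lebesgue_affine.

(** * Normal laws *)

Section normal_law.
Context {R : realType}.
Variables (m s : R).
Local Notation mu := (@lebesgue_measure R).
Local Notation nu := (normal_prob m s).
Local Notation pdf := (normal_pdf m s).

Lemma integral_normal (f : R -> \bar R) : nu.-integrable setT f ->
  (\int[nu]_x f x = \int[mu]_x (f x * (pdf x)%:E))%E.
Proof.
move=> hf; have dom := normal_prob_dominates m s.
have mpdf : measurable_fun setT (EFin \o pdf).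
  by apply/measurable_EFinP; exact: measurable_normal_pdf.
rewrite -(Radon_Nikodym_change_of_variables dom measurableT hf).
apply: ae_eq_integral => //.
- apply: emeasurable_funM; first exact: measurable_int hf.
  by apply: (@measurable_int _ _ _ mu); apply: Radon_Nikodym_integrable; exact: dom.
- by apply: emeasurable_funM => //; exact: measurable_int hf.
apply: ae_eqe_mul2l; rewrite Radon_NikodymE/=.
case: cid => h /= [h0 hint hE].
by apply: integral_ae_eq => //= E _ mE; rewrite -hE.
Qed.

(** Bounded functions first, then monotone convergence of truncations *)
Lemma intg_normal (f : R -> R) : measurable_fun setT f ->
  intg mu (fun x => f x * pdf x) -> intg nu f.
Proof.
move=> mf hf; have mpdf := measurable_normal_pdf m s.
apply/integrableP; split; first exact/measurable_EFinP.
pose g n x : R := Num.min `|f x| n%:R.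
have mg n : measurable_fun setT (g n).
  by apply: measurable_minr => //; exact: measurableT_comp.
have g0 n x : 0 <= g n x by rewrite le_min normr_ge0 ler0n.
have gint n : nu.-integrable setT (EFin \o g n).
  apply: (@intg_bounded _ _ _ nu _ n%:R) => [|x]; first exact: mg.
  by rewrite ger0_norm// ge_min lexx orbT.
have gE n : (\int[nu]_x (g n x)%:E <= \int[mu]_x `|(f x * pdf x)%:E|)%E.
  rewrite (integral_normal (gint n)); apply: ge0_le_integral => //.
  - by move=> x _; rewrite /= mule_ge0 ?lee_fin ?normal_pdf_ge0.
  - by apply: emeasurable_funM; apply/measurable_EFinP; [exact: mg|exact: mpdf].
  - by apply: measurableT_comp => //; apply/measurable_EFinP; exact: measurable_funM.
  - move=> x _ /=; rewrite normrM (ger0_norm (normal_pdf_ge0 _ _ _)).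
    by rewrite lee_fin ler_wpM2r ?normal_pdf_ge0// ge_min lexx.
have /integrableP[_ hlt] := hf; apply: le_lt_trans hlt.
have <- : (\int[nu]_x limn (fun n => (g n x)%:E) = \int[nu]_x `|(f x)%:E|)%E.
  apply: eq_integral => x _; apply/cvg_lim => //.
  apply: (@cvg_near_cst); near=> n; rewrite /g/=; congr EFin.
  apply/min_idPl; near: n; exact: nbhs_infty_ger.
rewrite monotone_convergence//.
- apply: lime_le; last by apply: nearW => n; exact: gE.
  apply: ereal_nondecreasing_is_cvgn => a b ab; apply: ge0_le_integral => //.
  + by move=> x _; rewrite lee_fin.
  + by apply/measurable_EFinP; exact: mg.
  + by apply/measurable_EFinP; exact: mg.
  + move=> x _; rewrite lee_fin le_min ge_min lexx/= ge_min.
    by rewrite ler_nat ab orbT.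
- by move=> n; apply/measurable_EFinP; exact: mg.
- by move=> n x _; rewrite lee_fin.
- move=> x _ a b ab; rewrite lee_fin le_min ge_min lexx/= ge_min.
  by rewrite ler_nat ab orbT.
Unshelve. all: by end_near. Qed.

Lemma Rint_normal (f : R -> R) : intg nu f ->
  \int[nu]_x f x = \int[mu]_x (f x * pdf x).
Proof. by move=> hf; rewrite /Rintegral (integral_normal hf). Qed.

Lemma intg_normal_density (f : R -> R) : intg nu f ->
  intg mu (fun x => f x * pdf x).
Proof.
move=> hf; have mf := intg_measurable hf.
have mfp : measurable_fun setT (fun x => f x * pdf x).
  by apply: measurable_funM => //; exact: measurable_normal_pdf.
apply/integrableP; split; first exact/measurable_EFinP.
rewrite (_ : (\int[mu]_x _)%E = (\int[nu]_x (`|f x|)%:E)%E).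
  have /integrableP[_] := intg_abs hf; apply: le_lt_trans.
  by rewrite le_eqVlt; apply/orP; left; apply/eqP; apply: eq_integral => x _ /=;
    rewrite normr_id.
rewrite (integral_normal (intg_abs hf)); apply: eq_integral => x _ /=.
by rewrite normrM (ger0_norm (normal_pdf_ge0 _ _ _)).
Qed.

End normal_law.

Section centered_normal.
Context {R : realType}.
Variable v : R.
Hypothesis v0 : 0 < v.
Local Notation mu := (@lebesgue_measure R).
Local Notation s := (Num.sqrt v).
Local Notation nu := (normal_prob 0 s).
Local Notation p := (normal_pdf 0 s).

Let s_neq0 : s != 0. Proof. by rewrite gt_eqF// sqrtr_gt0. Qed.
Let ssq : s ^+ 2 = v. Proof. by rewrite sqr_sqrtr// ltW. Qed.

Let pE x : p x = normal_peak s * expR (- x ^+ 2 / (2 * v)).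
Proof. by rewrite normal_pdfE// /normal_fun subr0 ssq -mulr_natl. Qed.

Let p_shift (e x : R) : p (x - e * v) = p x * expR (e * x - e ^+ 2 * v / 2).
Proof.
rewrite !pE -[RHS]mulrA -expRD; congr (_ * expR _).
by field; rewrite gt_eqF.
Qed.

Lemma expR_abs_le (u : R) : `|expR u - 1 - u| <= u ^+ 2 * expR `|u|.
Proof.
have h1 := expR_ge1Dx u; have h2 := expR_ge1Dx (- u).
have h3 := expR_gt0 u; have h4 : expR u * expR (- u) = 1.
  by rewrite -expRD subrr expR0.
rewrite ger0_norm; last by lra.
have h5 : expR u - 1 <= u * expR u.
  by have := ler_wpM2l (ltW h3) h2; rewrite h4 mulrDr mulr1 mulrN; lra.
have [u0|u0] := leP 0 u.
  rewrite (ger0_norm u0); have := ler_wpM2l u0 h5; rewrite mulrA -expr2.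
  by rewrite mulrBr mulr1; lra.
rewrite (ltr0_norm u0); have h6 : 1 <= expR (- u) by lra.
apply: (@le_trans _ _ (u ^+ 2)); last by rewrite ler_peMr ?sqr_ge0.
have u0' : 0 <= - u by lra.
have : (- u) * (1 - expR u) <= (- u) * (- u) by rewrite ler_wpM2l//; lra.
by rewrite mulrNN -expr2 mulNr mulrBr mulr1; lra.
Qed.

(** Up to a factor, exp (k |x|) times the density is at most the density of
    variance 2 v *)
Lemma normal_exp_moment (k : R) : intg nu (fun x => expR (k * `|x|)).
Proof.
have mexp : measurable_fun setT (fun x : R => expR (k * `|x|)).
  by apply: measurableT_comp => //; apply: measurable_funM => //; exact: measurableT_comp.
apply: intg_normal => //.
have v2 : Num.sqrt (2 * v) != 0 by rewrite gt_eqF// sqrtr_gt0 mulr_gt0.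
pose c := normal_peak s * expR (k ^+ 2 * v) / normal_peak (Num.sqrt (2 * v)).
have hc : intg mu (fun x => c * normal_pdf 0 (Num.sqrt (2 * v)) x).
  by apply: intgZ; exact: integrable_normal_pdf.
apply: (intg_le _ _ hc).
- by apply: measurable_funM => //; exact: measurable_normal_pdf.
- move=> x; rewrite normrM (ger0_norm (expR_ge0 _)) (ger0_norm (normal_pdf_ge0 _ _ _)) pE.
  rewrite normal_pdfE// /normal_fun subr0 sqr_sqrtr ?mulr_ge0 ?(ltW v0)// /c.
  rewrite [X in _ <= X]mulrA divfK ?gt_eqF ?normal_peak_gt0//.
  rewrite mulrCA -[X in _ <= X]mulrA ler_pM2l ?normal_peak_gt0// -!expRD ler_expR.
  rewrite -subr_ge0 -(real_normK (num_real x)).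
  have -> : k ^+ 2 * v + - `|x| ^+ 2 / (2 * v *+ 2) -
     (k * `|x| + - `|x| ^+ 2 / (2 * v)) = (`|x| - 2 * v * k) ^+ 2 / (4 * v).
    by rewrite -mulr_natl; field; rewrite gt_eqF.
  by rewrite divr_ge0 ?sqr_ge0 ?mulr_ge0 ?(ltW v0).
Qed.

Lemma intg_normal_exp (k C : R) (g : R -> R) : measurable_fun setT g ->
  (forall x, `|g x| <= C * expR (k * `|x|)) -> intg nu g.
Proof.
move=> mg gC; have h : intg nu (fun x => C * expR (k * `|x|)).
  by apply: intgZ; exact: normal_exp_moment.
by apply: (intg_le _ _ h) => [|x]; [exact: mg|exact: gC].
Qed.

(** A constant for the second-order error of a shift; the exponent 4 leaves
    room for a function that grows like exp |x| *)
Definition normal_cst : R := 2 * expR (3 * v) * \int[nu]_x expR (4 * `|x|).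

Lemma normal_cst_ge0 : 0 <= normal_cst.
Proof.
by rewrite !mulr_ge0 ?expR_ge0//; apply: Rintegral_ge0 => x _; exact: expR_ge0.
Qed.

Let p_taylor (e x : R) : `|e| <= 1 ->
  `|p (x - e * v) - p x - e * x * p x| <=
  2 * e ^+ 2 * expR (3 * (`|x| + v)) * p x.
Proof.
move=> e1; rewrite p_shift.
set u := e * x - e ^+ 2 * v / 2; have p0 : 0 <= p x by exact: normal_pdf_ge0.
have -> : p x * expR u - p x - e * x * p x = (expR u - 1 - u - e ^+ 2 * v / 2) * p x.
  by rewrite /u; ring.
rewrite normrM (ger0_norm p0) ler_wpM2r//.
set w := `|x| + v; have w0 : 0 <= w by rewrite addr_ge0// ltW.
have uw : `|u| <= `|e| * w.
  rewrite /u (le_trans (ler_normB _ _))// normrM /w mulrDr lerD2l.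
  rewrite normrM normrM normrX (gtr0_norm v0) (@gtr0_norm _ 2^-1)//.
  rewrite expr2 -!mulrA ler_wpM2l// mulrA.
  have h : `|e| * v <= v by rewrite ler_piMl// ltW.
  by have := v0; lra.
have uw1 : `|u| <= w by rewrite (le_trans uw)// ler_piMl.
have ew : w <= expR w by have := expR_ge1Dx w; lra.
have e0 : 0 <= e ^+ 2 by exact: sqr_ge0.
have vw : v <= w by rewrite lerDr.
have ew1 : 1 <= expR w by rewrite -expR0 ler_expR.
have e3 : expR (3 * w) = expR w * expR w * expR w.
  by rewrite -!expRD; congr expR; ring.
have h1 : u ^+ 2 * expR `|u| <= e ^+ 2 * expR (3 * w).
  rewrite e3 -(real_normK (num_real u)) mulrA; apply: ler_pM => //; last by rewrite ler_expR.
  have : `|u| ^+ 2 <= (`|e| * w) ^+ 2 by rewrite lerXn2r ?nnegrE ?mulr_ge0.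
  move/le_trans; apply; rewrite exprMn real_normK ?num_real// ler_wpM2l// expr2.
  exact: ler_pM.
have h2 : v / 2 <= expR (3 * w).
  rewrite e3; have : expR w <= expR w * expR w * expR w.
    by rewrite -mulrA ler_peMr ?expR_ge0// -[leLHS]mul1r ler_pM.
  by have := v0; lra.
apply: (le_trans (ler_normB _ _)); apply: (le_trans (lerD (expR_abs_le u) (lexx _))).
rewrite (@ger0_norm _ (e ^+ 2 * v / 2)); last by rewrite divr_ge0// mulr_ge0// ltW.
have h3 : e ^+ 2 * v / 2 <= e ^+ 2 * expR (3 * w) by rewrite -mulrA ler_wpM2l.
by lra.
Qed.

(** Shifting a normal variable by e * v changes its density by the factor
    exp (e x - e^2 v / 2) = 1 + e x + O(e^2) *)
Lemma normal_shift (e C : R) (g : R -> R) : `|e| <= 1 -> measurable_fun setT g ->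
  (forall x, `|g x| <= C * expR `|x|) ->
  `|\int[nu]_x (g (x + e * v) - g x - e * (x * g x))| <= C * normal_cst * e ^+ 2 /\
  intg nu (fun x => g (x + e * v) - g x - e * (x * g x)).
Proof.
move=> e1 mg gC.
have C0 : 0 <= C.
  by have := gC 0; rewrite normr0 expR0 mulr1; apply: le_trans.
have mgs : measurable_fun setT (fun x : R => g (x + e * v)).
  by apply: measurableT_comp => //; exact: measurable_funD.
have i1 : intg nu (fun x => g (x + e * v)).
  apply: (@intg_normal_exp 1 (C * expR v)) => // x; rewrite mul1r.
  rewrite (le_trans (gC _))// -mulrA ler_wpM2l// -expRD ler_expR.
  rewrite (le_trans (ler_normD _ _))// addrC lerD2r normrM (gtr0_norm v0).
  by rewrite ler_piMl// ltW.
have i2 : intg nu g by apply: (@intg_normal_exp 1 C) => // x; rewrite mul1r.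
have i3 : intg nu (fun x => x * g x).
  apply: (@intg_normal_exp 2 C); first exact: measurable_funM.
  move=> x; rewrite normrM mulrC.
  have -> : expR (2 * `|x|) = expR `|x| * expR `|x| by rewrite -expRD; congr expR; ring.
  rewrite mulrA; apply: ler_pM => //.
  by have := expR_ge1Dx `|x|; lra.
have i4 := intgB (intgB i1 i2) (intgZ e i3).
split; last exact: i4.
have j1 := intg_normal_density i1.
have j2 := intg_normal_density i2.
have j3 := intg_normal_density (intgZ e i3).
have j1' : intg mu (fun x => g x * p (x - e * v)).
  have := intg_shift (- (e * v)) j1.
  by under eq_fun do rewrite subrK.
have E1 : \int[mu]_x (g (x + e * v) * p x) = \int[mu]_x (g x * p (x - e * v)).
  rewrite -(Rintegral_shift (e * v) j1').
  by apply: eq_Rintegral => x _; rewrite addrK.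
rewrite RintegralB//; [|exact: intgB|exact: intgZ].
rewrite RintegralB// !Rint_normal//; last exact: intgZ.
rewrite E1 -RintegralB// -RintegralB//; last exact: intgB.
pose q (x : R) := C * (2 * expR (3 * v) * e ^+ 2 * expR (4 * `|x|)).
have hq : intg nu q by do 2 apply: intgZ; exact: normal_exp_moment.
have -> : C * normal_cst * e ^+ 2 = \int[mu]_x (q x * p x).
  rewrite -Rint_normal// /q RintegralZl//; last by apply: intgZ; exact: normal_exp_moment.
  rewrite RintegralZl//; last exact: normal_exp_moment.
  by rewrite /normal_cst; ring.
apply: le_Rint_abs.
- by apply: intgB => //; exact: intgB.
- exact: intg_normal_density.
move=> x.
have -> : g x * p (x - e * v) - g x * p x - e * (x * g x) * p x =
  g x * (p (x - e * v) - p x - e * x * p x) by ring.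
rewrite normrM; apply: le_trans (ler_pM _ _ (gC x) (p_taylor x e1)) _ => //.
rewrite /q le_eqVlt; apply/orP; left; apply/eqP.
have -> : expR (4 * `|x|) = expR `|x| * expR (3 * `|x|).
  by rewrite -expRD; congr expR; ring.
have -> : expR (3 * (`|x| + v)) = expR (3 * `|x|) * expR (3 * v).
  by rewrite -expRD; congr expR; ring.
by ring.
Qed.

Lemma normal_mean_var :
  [/\ intg nu (fun x => x ^+ 2), \int[nu]_x x = 0 & \int[nu]_x (x ^+ 2) = v].
Proof.
have lin_le (x : R) : `|x| <= 1 * expR `|x|.
  by rewrite mul1r; have := expR_ge1Dx `|x|; lra.
have i1 : intg nu (fun x => x).
  by apply: (@intg_normal_exp 1 1) => // x; rewrite !mul1r; have := lin_le x; lra.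
have i2 : intg nu (fun x => x ^+ 2).
  apply: (@intg_normal_exp 2 1) => [|x]; first exact: measurable_funX.
  have -> : 1 * expR (2 * `|x|) = (1 * expR `|x|) * (1 * expR `|x|).
    by rewrite !mul1r -expRD; congr expR; ring.
  by rewrite expr2 normrM; apply: ler_pM.
have small (a b : R) : 0 <= b ->
    (forall e, `|e| <= 1 -> `|e * a| <= b * e ^+ 2) -> a = 0.
  move=> b0 hab; apply/eqP; apply: contraT => a0.
  have na : 0 < `|a| by rewrite normr_gt0.
  have hp : 0 < `|a| + b + 1 by lra.
  pose e := `|a| / (`|a| + b + 1) / 2.
  have e0 : 0 < e by rewrite !divr_gt0.
  have e1 : `|e| <= 1.
    rewrite gtr0_norm// /e ler_pdivrMr// mul1r ler_pdivrMr//; nra.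
  have := hab e e1; rewrite normrM (gtr0_norm e0) expr2 mulrCA ler_pM2l//.
  rewrite /e mulrA mulrA => h.
  have : b * `|a| / (`|a| + b + 1) < `|a| * 2.
    by rewrite ltr_pdivrMr//; nra.
  by have : 0 < 2^-1 :> R; rewrite ?invr_gt0//; nra.
split => //.
- apply: (@small _ normal_cst); first exact: normal_cst_ge0.
  move=> e e1.
  have [|x|] := @normal_shift e 1 (fun=> 1) e1.
  + by [].
  + by rewrite normr1 mul1r -expR0 ler_expR.
  rewrite mul1r => + _; congr (_ <= _).
  under eq_Rintegral do rewrite subrr sub0r mulr1 -mulNr.
  by rewrite RintegralZl// mulNr normrN.
- suff : v - \int[nu]_x (x ^+ 2) = 0 by move/eqP; rewrite subr_eq0 => /eqP.
  apply: (@small _ normal_cst); first exact: normal_cst_ge0.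
  move=> e e1.
  have [||] := @normal_shift e 1 id e1; [by []|exact: lin_le|].
  rewrite mul1r => + _; congr (_ <= _).
  have -> : \int[nu]_x (id (x + e * v) - id x - e * (x * id x)) =
      \int[nu]_x (e * v - e * x ^+ 2) by apply: eq_Rintegral => x _ /=; ring.
  rewrite RintegralB//; [|exact: intg_cst|exact: intgZ].
  by rewrite Rint_cst RintegralZl// -mulrBr.
Qed.

End centered_normal.

(** * Gaussian integration by parts *)

Section generated_independence.
Context d (Omega : measurableType d) (R : realType) (P : probability Omega R).

(** Dynkin's pi-lambda theorem *)
Lemma indep_generated (G : set (set Omega)) (D : set Omega) :
  measurable D -> G `<=` measurable -> setI_closed G -> G setT ->
  (forall E, G E -> P (D `&` E) = P D * P E)%E ->
  forall E, <<s G >> E -> (P (D `&` E) = P D * P E)%E.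
Proof.
move=> mD mG GI GT DG E sE.
have PD : P D \is a fin_num by rewrite fin_num_measure.
have PD0 : 0 <= fine (P D) by rewrite fine_ge0.
have := @g_sigma_algebra_measure_unique _ _ _ G mG (fun=> setT) (fun=> GT)
  (bigcup_const _ _) (mrestr P mD) (mscale (NngNum PD0) P) GI.
move=> h; have : mrestr P mD E = mscale (NngNum PD0) P E.
  apply: h => //.
  - move=> A GA; change (P (A `&` D) = (fine (P D))%:E * P A)%E.
    by rewrite setIC DG// fineK.
  - move=> _; change (P (setT `&` D) < +oo)%E.
    by rewrite setTI (le_lt_trans (probability_le1 P mD))// ltry.
change (P (E `&` D) = (fine (P D))%:E * P E -> P (D `&` E) = P D * P E)%E.
by rewrite fineK// setIC.
Qed.

End generated_independence.

(** Measurability of a function of a sequence of reals, tested on all sequences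
    of measurable functions instead of through a sigma-algebra on sequences *)
Definition measurable_functional (R : realType) (F : (nat -> R) -> R) : Prop :=
  forall d (T : measurableType d) (f : nat -> T -> R),
    (forall i, measurable_fun setT (f i)) ->
    measurable_fun setT (fun t => F (fun i => f i t)).

Section independent_normals.
Context d (Omega : measurableType d) (R : realType) (P : probability Omega R).
Variables (n : nat) (N : nat -> Omega -> R) (v : nat -> R).
Hypothesis mN : forall j, measurable_fun setT (N j).
Hypothesis N0 : forall j, (n <= j)%N -> N j = fun=> 0.
Hypothesis v0 : forall j, (j < n)%N -> 0 < v j.
Hypothesis lawN : forall j, (j < n)%N -> forall A, measurable A ->
  P (N j @^-1` A) = normal_prob 0 (Num.sqrt (v j)) A.
Hypothesis indN : forall A : nat -> set R, (forall i, measurable (A i)) ->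
  (P (\bigcap_(i in `I_n) (N i @^-1` A i)) = \prod_(i < n) P (N i @^-1` A i))%E.

Let mpre j (A : set R) : measurable A -> measurable (N j @^-1` A).
Proof. by move=> mA; rewrite -[_ @^-1` _]setTI; exact: mN. Qed.

(** The events that do not depend on the k-th variable *)
Let others (k : nat) : set (set Omega) :=
  [set E | exists2 A : nat -> set R, forall i, measurable (A i) &
     E = \bigcap_(i in `I_n `\ k) (N i @^-1` A i)].

Let others_measurable k : others k `<=` measurable.
Proof.
by move=> _ [A mA ->]; apply: bigcap_measurableType => i _; exact: mpre.
Qed.

Let sigma_others_measurable k E : <<s others k >> E -> measurable E.
Proof.
by apply: smallest_sub; [exact: sigma_algebra_measurable|exact: others_measurable].
Qed.

Let othersI k : setI_closed (others k).
Proof.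
move=> _ _ [A mA ->] [B mB ->]; exists (fun i => A i `&` B i).
  by move=> i; exact: measurableI.
by rewrite -bigcapI.
Qed.

Let othersT k : others k setT.
Proof.
by exists (fun=> setT) => //; apply/seteqP; split.
Qed.

Let others_coord k j A : measurable A -> j != k -> (j < n)%N ->
  others k (N j @^-1` A).
Proof.
move=> mA jk jn; exists (fun i => if i == j then A else setT).
  by move=> i; case: ifP.
apply/seteqP; split => x /=.
  by move=> Ax i _; case: eqP => // ->.
by move/(_ j); rewrite /= eqxx; apply; split => //; exact/eqP.
Qed.

Let others_indep k : (k < n)%N -> forall A E, measurable A ->
  <<s others k >> E -> (P (N k @^-1` A `&` E) = P (N k @^-1` A) * P E)%E.
Proof.
move=> kn A E mA.
apply: (indep_generated (mpre k mA) (@others_measurable k) (@othersI k) (othersT k)).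
move=> _ [B mB ->].
have capE (C : set R) :
    N k @^-1` C `&` \bigcap_(i in `I_n `\ k) (N i @^-1` B i) =
    \bigcap_(i in `I_n) (N i @^-1` (if i == k then C else B i)).
  apply/seteqP; split => x.
    by move=> [Cx Bx] i /= ii; case: eqP => [->//|/eqP ik]; apply: Bx; split => //; exact/eqP.
  move=> h; split; first by have := h k kn; rewrite /= eqxx.
  by move=> i [ii /eqP ik]; have := h i ii; rewrite /= (negbTE ik).
have mif (C : set R) : measurable C ->
  forall i, measurable (if i == k then C else B i) by move=> mC i; case: ifP.
rewrite capE indN; last exact: mif.
rewrite -[X in (_ = _ * P X)%E]setTI -{1}(preimage_setT (N k)) capE indN; last exact: mif.
pose ko := Ordinal kn; rewrite (bigD1 ko)//= eqxx [in RHS](bigD1 ko)//= eqxx.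
rewrite preimage_setT probability_setT mul1e; congr (_ * _)%E.
by apply: eq_bigr => i; rewrite -val_eqE/= => /negbTE ->.
Qed.

Let update (x : nat -> R) k y : nat -> R := fun j => if j == k then y else x j.

Let measurable_coord k j :
  measurable_fun setT
    (fun z : R * g_sigma_algebraType (others k) => update (N ^~ z.2) k z.1 j).
Proof.
rewrite /update; case: (eqVneq j k) => [_|jk]; first exact: measurable_fst.
have [jn|nj] := ltnP j n; last by rewrite /= (N0 nj).
suff h : measurable_fun setT (fun w : g_sigma_algebraType (others k) => N j w).
  by apply: (measurableT_comp h); exact: measurable_snd.
move=> _ A mA; rewrite setTI; apply: sub_gen_smallest; exact: others_coord.
Qed.

(** Integrating first over the k-th variable, which is independent of the
    others *)
Lemma normals_freeze (k : nat) (h : R -> (nat -> R) -> R) (K : R) : (k < n)%N ->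
  (forall d (T : measurableType d) (u : T -> R) (f : nat -> T -> R),
    measurable_fun setT u -> (forall i, measurable_fun setT (f i)) ->
    measurable_fun setT (fun t => h (u t) (fun i => f i t))) ->
  intg P (fun w => h (N k w) (N ^~ w)) ->
  (forall x, `|\int[normal_prob 0 (Num.sqrt (v k))]_y (h y (update x k y))%:E| <= K%:E)%E ->
  `|\int[P]_w h (N k w) (N ^~ w)| <= K.
Proof.
move=> kn mh hint hK.
pose f (z : R * g_sigma_algebraType (others k)) := h z.1 (update (N ^~ z.2) k z.1).
have fE w : f (N k w, w) = h (N k w) (N ^~ w).
  by rewrite /f/=; congr (h _ _); apply/funext => j; rewrite /update; case: eqP => // ->.
have mf : measurable_fun setT f.
  by apply: mh; [exact: measurable_fst|exact: measurable_coord].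
have -> : \int[P]_w h (N k w) (N ^~ w) = \int[P]_w f (N k w, w).
  by apply: eq_Rintegral => w _; rewrite fE.
apply: (@freeze_le _ _ _ P _ (measurableTypeR R) (N k) (normal_prob 0 (Num.sqrt (v k)))
  (others k) (mN k) (@sigma_others_measurable k) (lawN kn) (others_indep kn) f mf).
  by under eq_fun do rewrite fE.
by move=> w; exact: (hK (N ^~ w)).
Qed.

Lemma normals_transfer k (g : R -> R) : (k < n)%N ->
  intg (normal_prob 0 (Num.sqrt (v k))) g ->
  intg P (fun w => g (N k w)) /\
  \int[P]_w g (N k w) = \int[normal_prob 0 (Num.sqrt (v k))]_x g x.
Proof.
move=> kn hg; have mg := intg_measurable hg.
have mNk : measurable_fun setT (N k : Omega -> measurableTypeR R) by exact: mN.
have lawE (f : measurableTypeR R -> \bar R) :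
    (\int[pushforward P (N k : Omega -> measurableTypeR R)]_y f y =
     \int[normal_prob 0 (Num.sqrt (v k))]_y f y)%E.
  by apply: eq_measure_integral => A mA _; exact: lawN.
have hi : intg P (fun w => g (N k w)).
  apply/integrableP; split.
    by apply/measurable_EFinP; apply: (measurableT_comp mg).
  have := ge0_integral_pushforward mNk P measurableT (f := fun x => `|(g x)%:E|%E).
  rewrite preimage_setT => <- //.
    by rewrite lawE; have /integrableP[] := hg.
  by apply: measurableT_comp => //; exact/measurable_EFinP.
split => //; rewrite /Rintegral -lawE; congr fine.
have := integral_pushforward mNk (mu := P) (D := setT) (f := EFin \o g).
rewrite preimage_setT => -> //.
exact/measurable_EFinP.
Qed.

Lemma normals_sqint k : sqint P (N k).
Proof.
split; first exact: mN.
have [kn|nk] := ltnP k n; last first.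
  by rewrite (N0 nk); under eq_fun do rewrite expr0n; exact: integrable0.
have [h _ _] := normal_mean_var (v0 kn).
by have [] := normals_transfer kn h.
Qed.

Lemma normals_var k : (k < n)%N -> \int[P]_w (N k w ^+ 2) = v k.
Proof.
move=> kn; have [h _ hv] := normal_mean_var (v0 kn).
by have [_ ->] := normals_transfer kn h.
Qed.

Lemma normals_orth j k : j != k -> \int[P]_w (N j w * N k w) = 0.
Proof.
move=> jk.
have [kn|nk] := ltnP k n; last first.
  by rewrite (N0 nk); under eq_Rintegral do rewrite mulr0; rewrite Rint_cst.
apply/eqP; rewrite -normr_le0.
apply: (@normals_freeze k (fun y x => x j * y) 0 kn).
- move=> d' T u f mu mf; exact: measurable_funM.
- exact: sqintM (normals_sqint j) (normals_sqint k).
move=> x; rewrite /update (negbTE jk).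
have [h hm _] := normal_mean_var (v0 kn).
have h1 : intg (normal_prob 0 (Num.sqrt (v k))) (fun x : R => x).
  apply: sqint_intg; split => //; exact: measurable_id.
rewrite -EFin_normr_Rintegral//; last exact: intgZ.
by rewrite RintegralZl// hm mulr0 normr0.
Qed.

Let shift1 (x : nat -> R) k (h : R) : nat -> R :=
  fun j => x j + (if j == k then h else 0).

(** Gaussian integration by parts in one of the variables, as the first-order
    effect of a translation *)
Lemma normals_shift k (F : (nat -> R) -> R) (C e : R) : (k < n)%N -> `|e| <= 1 ->
  measurable_functional F -> (forall x, `|F x| <= C) ->
  `|\int[P]_w (F (shift1 (N ^~ w) k (e * v k)) - F (N ^~ w) - e * (N k w * F (N ^~ w)))|
    <= C * normal_cst (v k) * e ^+ 2.
Proof.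
move=> kn e1 mF FC.
have mF1 : measurable_fun setT (fun w => F (shift1 (N ^~ w) k (e * v k))).
  by apply: mF => i; apply: measurable_funD.
have mF0 : measurable_fun setT (fun w => F (N ^~ w)) by exact: mF.
apply: (@normals_freeze k (fun y x => F (shift1 x k (e * v k)) - F x - e * (y * F x)) _ kn).
- move=> d' T u f mu mf; apply: measurable_funB.
    by apply: measurable_funB; apply: mF => // i; apply: measurable_funD.
  by apply: measurable_funM => //; apply: measurable_funM => //; exact: mF.
- apply: intgB; last first.
    exact: (intgZ e (sqintM (normals_sqint k) (sqint_bounded P mF0 (fun w => FC _)))).
  by apply: intgB; [exact: (intg_bounded P mF1 (fun w => FC _))|exact: (intg_bounded P mF0 (fun w => FC _))].
move=> x.
have mg : measurable_fun setT (fun y : R => F (update x k y)).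
  by apply: mF => i; rewrite /update; case: (i == k).
have gC (y : R) : `|F (update x k y)| <= C * expR `|y|.
  have C0 : 0 <= C by exact: le_trans (FC x).
  by rewrite (le_trans (FC _))// ler_peMr// -expR0 ler_expR.
have [h1 h2] := normal_shift (v0 kn) e1 mg gC.
have hE (y : R) : F (shift1 (update x k y) k (e * v k)) - F (update x k y)
     - e * (y * F (update x k y)) =
   F (update x k (y + e * v k)) - F (update x k y) - e * (y * F (update x k y)).
  congr (F _ - _ - _); apply/funext => j; rewrite /shift1 /update.
  by case: eqP; rewrite ?addr0.
under eq_integral do rewrite hE.
by rewrite -EFin_normr_Rintegral// lee_fin.
Qed.

(** Adding up the shifts of all coordinates: the derivative of a bounded
    functional in the direction of the covariances of xi = sum_j a_j N_j
    controls its correlation with xi *)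
Lemma normals_ibp (a : nat -> R) (F : (nat -> R) -> R) (C L D : R) :
  measurable_functional F -> (forall x, `|F x| <= C) -> 0 <= L -> 0 <= D ->
  (forall x y, `|F x - F y| <= L * \sum_(j < n) `|x j - y j|) ->
  (forall x e, 0 < e -> `|F (fun j => x j + (if (j < n)%N then e * (a j * v j) else 0)) - F x| <= e * D) ->
  `|\int[P]_w ((\sum_(j < n) a j * N j w) * F (N ^~ w))| <= D.
Proof.
move=> mF FC L0 D0 FL FD.
pose Fs e k x := F (fun j => x j + (if (j < k)%N then e * (a j * v j) else 0)).
have mFs e k : measurable_functional (Fs e k).
  by move=> d' T f mf; apply: mF => i; apply: measurable_funD.
have FsC e k x : `|Fs e k x| <= C by exact: FC.
have mFsN e k : measurable_fun setT (fun w => Fs e k (N ^~ w)) by exact: mFs.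
have mFN : measurable_fun setT (fun w => F (N ^~ w)) by exact: mF.
have iFs e k : intg P (fun w => Fs e k (N ^~ w)) by exact: (intg_bounded P (mFsN e k) (fun w => FsC _ _ _)).
have sF : sqint P (fun w => F (N ^~ w)) by exact: (sqint_bounded P mFN (fun w => FC _)).
have sFs e k : sqint P (fun w => Fs e k (N ^~ w)) by exact: (sqint_bounded P (mFsN e k) (fun w => FsC _ _ _)).
have iNF k : intg P (fun w => N k w * F (N ^~ w)) by exact: (sqintM (normals_sqint k) sF).
have iNFs e k j : intg P (fun w => N j w * Fs e k (N ^~ w)).
  exact: (sqintM (normals_sqint j) (sFs e k)).
pose A := \sum_(j < n) `|a j|.
pose V := \sum_(j < n) `|a j * v j|.
pose S := \sum_(k < n) (C * normal_cst (v k) * a k ^+ 2 +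
   `|a k| * (\int[P]_w `|N k w| * (L * V))).
have S0 : 0 <= S.
  apply: sumr_ge0 => k _; apply: addr_ge0.
    rewrite mulr_ge0 ?sqr_ge0// mulr_ge0//; first exact: le_trans (FC (fun=> 0)).
    by apply: normal_cst_ge0.
  rewrite !mulr_ge0 ?sumr_ge0//; apply: Rintegral_ge0 => //.
have aA k : (k < n)%N -> `|a k| <= A.
  by move=> kn; rewrite /A (bigD1 (Ordinal kn))//= lerDl sumr_ge0.
have A0 : 0 <= A by exact: sumr_ge0.
have step e k : 0 < e -> e * A <= 1 -> (k < n)%N ->
  `|\int[P]_w Fs e k.+1 (N ^~ w) - \int[P]_w Fs e k (N ^~ w)
     - e * a k * \int[P]_w (N k w * F (N ^~ w))| <=
  e ^+ 2 * (C * normal_cst (v k) * a k ^+ 2 + `|a k| * (\int[P]_w `|N k w| * (L * V))).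
  move=> e0 eA kn.
  have ea1 : `|e * a k| <= 1.
    by rewrite normrM (gtr0_norm e0) (le_trans _ eA)// ler_pM2l// aA.
  have := normals_shift kn ea1 (mFs e k) (FsC e k).
  have sE w : Fs e k (shift1 (N ^~ w) k (e * a k * v k)) = Fs e k.+1 (N ^~ w).
    congr F; apply/funext => j; rewrite /shift1 ltnS (leq_eqVlt j).
    case: (eqVneq j k) => [->|jk]; first by rewrite ltnn addr0/= mulrA.
    by rewrite addr0.
  under eq_Rintegral do rewrite sE.
  rewrite RintegralB//; [|by apply: intgB|by apply: intgZ].
  rewrite RintegralB// RintegralZl// => h1.
  have h2 : `|\int[P]_w (N k w * Fs e k (N ^~ w)) - \int[P]_w (N k w * F (N ^~ w))|
      <= \int[P]_w `|N k w| * (e * (L * V)).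
    rewrite -RintegralB// -RintegralZr//; last exact/intg_abs/sqint_intg/normals_sqint.
    apply: le_Rint_abs.
    - exact: intgB.
    - under eq_fun do rewrite mulrC.
      by apply: intgZ; exact/intg_abs/sqint_intg/normals_sqint.
    move=> w; rewrite -mulrBr normrM ler_wpM2l// (le_trans (FL _ _))//.
    rewrite mulrCA ler_wpM2l// /V mulr_sumr; apply: ler_sum => j _.
    rewrite addrAC subrr add0r; case: ifP => _.
      by rewrite normrM (gtr0_norm e0).
    by rewrite normr0 mulr_ge0// ltW.
  have -> : \int[P]_w Fs e k.+1 (N ^~ w) - \int[P]_w Fs e k (N ^~ w)
     - e * a k * \int[P]_w (N k w * F (N ^~ w)) =
    (\int[P]_w Fs e k.+1 (N ^~ w) - \int[P]_w Fs e k (N ^~ w)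
     - e * a k * \int[P]_w (N k w * Fs e k (N ^~ w))) +
    e * a k * (\int[P]_w (N k w * Fs e k (N ^~ w)) - \int[P]_w (N k w * F (N ^~ w))).
    by ring.
  rewrite (le_trans (ler_normD _ _))// [leRHS]mulrDr; apply: lerD.
    by rewrite (le_trans h1)// exprMn; rewrite le_eqVlt; apply/orP; left; apply/eqP; ring.
  rewrite normrM; apply: (le_trans (ler_wpM2l _ h2)) => //.
  rewrite normrM (gtr0_norm e0) le_eqVlt; apply/orP; left; apply/eqP.
  by set I1 := \int[P]_w _; ring.
set X := \int[P]_w _.
have XE : X = \sum_(k < n) a k * \int[P]_w (N k w * F (N ^~ w)).
  rewrite /X; under eq_Rintegral do rewrite mulr_suml.
  rewrite Rint_sum; last first.
    by move=> i; under eq_fun do rewrite -mulrA; exact: intgZ.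
  apply: eq_bigr => i _; under eq_Rintegral do rewrite -mulrA.
  by rewrite RintegralZl.
have main e : 0 < e -> e * A <= 1 -> `|X| <= D + e * S.
  move=> e0 eA.
  have h1 : `|\int[P]_w Fs e n (N ^~ w) - \int[P]_w Fs e 0 (N ^~ w) - e * X| <= e ^+ 2 * S.
    have -> : \int[P]_w Fs e n (N ^~ w) - \int[P]_w Fs e 0 (N ^~ w) - e * X =
      \sum_(k < n) (\int[P]_w Fs e k.+1 (N ^~ w) - \int[P]_w Fs e k (N ^~ w)
       - e * a k * \int[P]_w (N k w * F (N ^~ w))).
      rewrite sumrB -(big_mkord xpredT (fun k => \int[P]_w Fs e k.+1 (N ^~ w) - \int[P]_w Fs e k (N ^~ w))).
      rewrite (telescope_sumr (fun k => \int[P]_w Fs e k (N ^~ w)))// XE mulr_sumr.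
      by congr (_ - _); apply: eq_bigr => i _; rewrite mulrA.
    rewrite (le_trans (ler_norm_sum _ _ _))// /S mulr_sumr.
    by apply: ler_sum => k _; exact: step.
  have h2 : `|\int[P]_w Fs e n (N ^~ w) - \int[P]_w Fs e 0 (N ^~ w)| <= e * D.
    rewrite -RintegralB// -[leRHS](Rint_cst P).
    apply: le_Rint_abs; [exact: intgB|exact: intg_cst|move=> w].
    have -> : Fs e 0%N (N ^~ w) = F (N ^~ w).
      by congr F; apply/funext => j; rewrite addr0.
    exact: FD.
  have : e * `|X| <= e * D + e ^+ 2 * S.
    rewrite -[X in X * _](gtr0_norm e0) -normrM.
    move: h1 h2; set Z := \int[P]_w Fs e n _ - _ => h1 h2.
    have -> : e * X = Z - (Z - e * X) by ring.
    by rewrite (le_trans (ler_normB _ _))//; exact: lerD.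
  by rewrite expr2 -mulrA -mulrDr ler_pM2l.
apply/ler_addgt0Pr => t t0.
pose e := Num.min (1 / (A + 1)) (t / (S + 1)).
have e0 : 0 < e by rewrite lt_min !divr_gt0// ltr_wpDl.
apply: (le_trans (main e e0 _)).
  apply: (@le_trans _ _ (1 / (A + 1) * A)).
    by rewrite ler_wpM2r// ge_min lexx.
  by rewrite mulrAC mul1r ler_pdivrMr ?mul1r ?lerDl// ltr_wpDl.
rewrite lerD2l; apply: (@le_trans _ _ (t / (S + 1) * S)).
  by rewrite ler_wpM2r// ge_min lexx orbT.
by rewrite mulrAC ler_pdivrMr ?ltr_wpDl// ler_pM2l// lerDl.
Qed.

End independent_normals.

(** * Integrals of step functions against Brownian motion *)

Lemma orth_inner d (T : measurableType d) (R : realType)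
    (mu : {measure set T -> \bar R}) (n : nat) (e : nat -> T -> R) (v a b : nat -> R) :
  (forall j, (j < n)%N -> sqint mu (e j)) ->
  (forall j k, (j < n)%N -> (k < n)%N ->
    \int[mu]_x (e j x * e k x) = if j == k then v j else 0) ->
  \int[mu]_x ((\sum_(j < n) a j * e j x) * (\sum_(k < n) b k * e k x)) =
  \sum_(j < n) a j * b j * v j.
Proof.
move=> he orth.
have hi (j k : 'I_n) : intg mu (fun x => a j * e j x * (b k * e k x)).
  by apply: sqintM; apply: sqintZ; exact: he.
under eq_Rintegral do rewrite mulr_suml.
rewrite Rint_sum; last first.
  by move=> j; under eq_fun do rewrite mulr_sumr; exact: intg_sum.
apply: eq_bigr => j _; under eq_Rintegral do rewrite mulr_sumr.
rewrite Rint_sum// (bigD1 j)//= big1 ?addr0.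
  under eq_Rintegral do rewrite mulrACA.
  by rewrite RintegralZl// ?orth// ?eqxx//; apply: sqintM; exact: he.
move=> k kj; under eq_Rintegral do rewrite mulrACA.
rewrite RintegralZl//; last by apply: sqintM; exact: he.
by rewrite orth// val_eqE eq_sym (negbTE kj) mulr0.
Qed.

Section partition.
Context {R : realType}.

(** t enumerates 0, ..., n as the points of a strictly increasing partition,
    and is constant afterwards *)
Definition is_partition (n : nat) (t : nat -> R) : Prop :=
  (forall i j, (i < j)%N -> (j <= n)%N -> t i < t j) /\
  (forall i, (n <= i)%N -> t i = t n).

Lemma partition_exists (l : seq R) : exists n t, is_partition n t /\
  forall x, x \in l -> exists2 i, (i <= n)%N & t i = x.
Proof.
pose ps := sort <=%O (undup (0 :: l)).
have ups : uniq ps by rewrite sort_uniq undup_uniq.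
have sps : sorted <%O ps by rewrite sort_lt_sorted undup_uniq.
have s0 : (0 < size ps)%N.
  have : 0 \in ps by rewrite mem_sort mem_undup mem_head.
  by case: ps {ups sps}.
have memps x : x \in l -> x \in ps.
  by move=> xl; rewrite mem_sort mem_undup inE xl orbT.
exists (size ps).-1, (fun i => nth (last 0 ps) ps i); split; first split.
- move=> i j ij jn; apply: sorted_ltn_nth => //; first exact: lt_trans.
    by rewrite inE (ltn_trans ij)// (leq_ltn_trans jn)// prednK.
  by rewrite inE (leq_ltn_trans jn)// prednK.
- move=> i; rewrite leq_eqVlt => /predU1P[->//|]; rewrite prednK// => ni.
  by rewrite (nth_default _ ni) nth_last; case: ps s0 {ups sps memps ni}.
- move=> x /memps xps; exists (index x ps); last exact: nth_index.
  by rewrite -ltnS prednK// index_mem.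
Qed.

Variables (n : nat) (t : nat -> R).
Hypothesis ht : is_partition n t.

(** The value of step_fun s on the cell ]t j, t j.+1], when the end points of
    the intervals of s are points of the partition *)
Definition step_coef (s : seq (R * R * R)) (j : nat) : R :=
  \sum_(p <- s) p.1.1 * ((p.1.2 <= t j) && (t j.+1 <= p.2))%:R.

Definition on_partition (s : seq (R * R * R)) : Prop :=
  forall p, p \in s -> p.1.2 <= p.2 /\
    ((exists2 i, (i <= n)%N & t i = p.1.2) /\ (exists2 i, (i <= n)%N & t i = p.2)).

Lemma partition_le i j : (i <= n)%N -> (j <= n)%N -> (t i <= t j) = (i <= j)%N.
Proof.
move=> hi hj; have [hlt _] := ht; have [ij|ji] := leqP i j.
  by move: ij; rewrite leq_eqVlt => /predU1P[->|ij]; rewrite ?lexx// ltW// hlt.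
by apply/negbTE; rewrite -ltNge hlt.
Qed.

Lemma partition_telescope (g : R -> R) p q : (p <= n)%N -> (q <= n)%N -> t p <= t q ->
  g (t q) - g (t p) =
  \sum_(j < n) ((t p <= t j) && (t j.+1 <= t q))%:R * (g (t j.+1) - g (t j)).
Proof.
move=> pn qn; rewrite partition_le// => pq.
rewrite -(telescope_sumr (fun j => g (t j)) pq).
rewrite -(big_mkord xpredT (fun j => ((t p <= t j) && (t j.+1 <= t q))%:R *
  (g (t j.+1) - g (t j)))).
rewrite (big_cat_nat (leq0n q) qn)//= (big_cat_nat (leq0n p) pq)//=.
rewrite [X in _ = X + _ + _]big_nat [X in _ = X + _ + _]big1 ?add0r; last first.
  move=> j /= jp; rewrite partition_le//; last by rewrite ltnW// (leq_trans jp).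
  by rewrite leqNgt jp mul0r.
rewrite [X in _ = _ + X]big_nat [X in _ = _ + X]big1 ?addr0; last first.
  move=> j /andP[qj jn].
  by rewrite [X in _ && X]partition_le// ltnNge qj andbF mul0r.
apply: eq_big_nat => j /andP[pj jq].
rewrite !partition_le// ?pj ?jq ?mul1r//; first exact: leq_trans qn.
by rewrite ltnW// (leq_trans jq).
Qed.

Lemma step_sum_coef (g : R -> R) (s : seq (R * R * R)) : on_partition s ->
  \sum_(p <- s) p.1.1 * (g p.2 - g p.1.2) =
  \sum_(j < n) step_coef s j * (g (t j.+1) - g (t j)).
Proof.
elim: s => [|p s ih] hs.
  by rewrite big_nil big1// => j _; rewrite /step_coef big_nil mul0r.
rewrite big_cons ih; last by move=> q qs; apply: hs; rewrite inE qs orbT.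
have [ab [[i hi ti] [k hk tk]]] := hs p (mem_head _ _).
rewrite -ti -tk in ab *; rewrite (partition_telescope g hi hk ab) mulr_sumr -big_split/=.
by apply: eq_bigr => j _; rewrite /step_coef big_cons mulrDl ti tk mulrA.
Qed.

(** The indicator of ]t j, t j.+1], as a difference of the values of one
    function at t j.+1 and t j, so that sums over cells telescope *)
Definition cell (j : nat) (x : R) : R := (x <= t j.+1)%R%:R - (x <= t j)%R%:R.

Lemma cellE j : (j < n)%N -> cell j = \1_(`]t j, t j.+1]).
Proof.
move=> jn; have [hlt _] := ht; have tj := hlt _ _ (ltnSn j) jn.
apply/funext => x; rewrite /cell indicE mem_setE in_itv/=.
have [xj|xj] := leP x (t j); last by rewrite subr0.
by rewrite (le_trans xj (ltW tj)) subrr.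
Qed.

Lemma step_fun_coef s x : on_partition s ->
  step_fun s x = \sum_(j < n) step_coef s j * cell j x.
Proof.
move=> hs; rewrite -(step_sum_coef (fun y => (x <= y)%R%:R) hs) /step_fun.
rewrite !big_seq; apply: eq_bigr => p ps; congr (_ * _).
rewrite indicE mem_setE in_itv/=; have [ab _] := hs p ps.
have [xa|xa] := leP x p.1.2; last by rewrite subr0.
by rewrite (le_trans xa ab) subrr.
Qed.

Lemma sqint_cell j : (j < n)%N -> sqint (@lebesgue_measure R) (cell j).
Proof.
move=> jn; rewrite cellE//; split; first exact: measurable_indic.
have -> : (fun x : R => (\1_(`]t j, t j.+1]) x : R) ^+ 2) = \1_(`]t j, t j.+1]).
  by apply/funext => x; rewrite indicE; case: (x \in _); rewrite ?expr1n ?expr0n.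
exact: integrable_indic_itv.
Qed.

Lemma cell_orth j k : (j < n)%N -> (k < n)%N ->
  \int[@lebesgue_measure R]_x (cell j x * cell k x) =
  if j == k then t j.+1 - t j else 0.
Proof.
move=> jn kn; have [hlt _] := ht; have tj := hlt _ _ (ltnSn j) jn.
have [<-|jk] := eqVneq j k.
  have -> : \int[lebesgue_measure]_x (cell j x * cell j x) =
      \int[lebesgue_measure]_x (\1_(`]t j, t j.+1]) x).
    apply: eq_Rintegral => x _; rewrite cellE// indicE.
    by case: (x \in _); rewrite ?mulr1 ?mulr0.
  rewrite /Rintegral integral_indic// setIT.
  by have /= := @lebesgue_measure_itv R `]t j, t j.+1]; rewrite lte_fin tj => ->.
have dis x : cell j x * cell k x = 0.
  rewrite !cellE// !indicE !mem_setE !in_itv/=.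
  have : (j < k)%N || (k < j)%N by rewrite -neq_ltn.
  case/orP => h.
    have h1 : t j.+1 <= t k by rewrite partition_le// ltnW.
    have [xj|xj] := leP x (t j.+1); last by rewrite andbF mul0r.
    by rewrite [t k < x]ltNge (le_trans xj h1) mulr0.
  have h1 : t k.+1 <= t j by rewrite partition_le// ltnW.
  have [xj|xj] := leP x (t k.+1); last by rewrite andbF mulr0.
  by rewrite [t j < x]ltNge (le_trans xj h1) mul0r.
under eq_Rintegral do rewrite dis.
by rewrite /Rintegral integral0.
Qed.

End partition.

Section brownian_steps.
Context {R : realType} d (Omega : measurableType d) (P : probability Omega R).
Variable B : R -> {RV P >-> R}.
Hypothesis hB : is_brownian_motion B.

Lemma increment_normals n t : @is_partition R n t ->
  let N j w := B (t j.+1) w - B (t j) w in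
  let v j := t j.+1 - t j in
  [/\ forall j, measurable_fun setT (N j),
      forall j, (n <= j)%N -> N j = fun=> 0,
      forall j, (j < n)%N -> 0 < v j,
      forall j, (j < n)%N -> forall A, measurable A ->
        P (N j @^-1` A) = normal_prob 0 (Num.sqrt (v j)) A
    & forall A : nat -> set R, (forall i, measurable (A i)) ->
      (P (\bigcap_(i in `I_n) (N i @^-1` A i)) = \prod_(i < n) P (N i @^-1` A i))%E].
Proof.
move=> [hlt hcst] N v; split.
- by move=> j; apply: measurable_funB.
- move=> j nj; apply/funext => w; rewrite /N (hcst j nj) (hcst j.+1) ?subrr//.
  exact: leqW.
- by move=> j jn; rewrite subr_gt0 hlt.
- by move=> j jn A mA; apply: (bm_normal hB) => //; exact: hlt.
- by move=> A mA; apply: (bm_indep hB) => // i jn; rewrite ltW// hlt.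
Qed.

Lemma step_integral_coef n t s w : @is_partition R n t -> on_partition n t s ->
  step_integral B s w = \sum_(j < n) step_coef t s j * (B (t j.+1) w - B (t j) w).
Proof. by move=> ht hs; rewrite -(step_sum_coef ht (fun y => B y w) hs). Qed.

Definition ordered_steps (s : seq (R * R * R)) := all (fun p => p.1.2 <= p.2) s.

Lemma common_partition (ss : seq (seq (R * R * R))) : all ordered_steps ss ->
  exists n t, @is_partition R n t /\ forall s, s \in ss -> on_partition n t s.
Proof.
move=> hss; pose l := flatten [seq flatten [seq [:: p.1.2; p.2] | p <- s] | s <- ss].
have [n [t [ht hl]]] := partition_exists l; exists n, t; split => // s sss p ps.
have lp x : x \in [:: p.1.2; p.2] -> x \in l.
  move=> xp; apply/flattenP; exists (flatten [seq [:: p.1.2; p.2] | p <- s]).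
    exact: map_f.
  by apply/flattenP; exists [:: p.1.2; p.2] => //; exact: (map_f (fun p => [:: p.1.2; p.2])).
split; first by move/allP : hss => /(_ s sss)/allP/(_ p ps).
by split; apply/hl/lp; rewrite !inE eqxx ?orbT.
Qed.

Lemma sqint_step_integral s : ordered_steps s -> sqint P (step_integral B s).
Proof.
move=> hs; have [|n [t [ht hp]]] := @common_partition [:: s]; first by rewrite /= hs.
have [mN N0 v0 lawN indN] := increment_normals ht.
have -> : step_integral B s =
    fun w => \sum_(j < n) step_coef t s j * (B (t j.+1) w - B (t j) w).
  by apply/funext => w; apply: step_integral_coef => //; apply: hp; rewrite mem_head.
apply: sqint_sum => j; apply: sqintZ.
exact: (normals_sqint mN N0 v0 lawN).
Qed.

(** On a common partition both sides expand in the same way, since the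
    increments of B over the cells are orthogonal, as the cells are *)
Lemma step_isometry s s' : ordered_steps s -> ordered_steps s' ->
  \int[P]_w (step_integral B s w * step_integral B s' w) =
  \int[lebesgue_measure]_x (step_fun s x * step_fun s' x).
Proof.
move=> hs hs'; have [|n [t [ht hp]]] := @common_partition [:: s; s'].
  by rewrite /= hs hs'.
have [mN N0 v0 lawN indN] := increment_normals ht.
have sp : on_partition n t s by apply: hp; rewrite !inE eqxx.
have sp' : on_partition n t s' by apply: hp; rewrite !inE eqxx orbT.
under eq_Rintegral do rewrite !(@step_integral_coef n t)//.
under [RHS]eq_Rintegral do rewrite !(step_fun_coef ht)//.
rewrite (orth_inner (e := fun j w => B (t j.+1) w - B (t j) w)
  (v := fun j => t j.+1 - t j)); last 2 first.
- by move=> j _; exact: (normals_sqint mN N0 v0 lawN).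
- move=> j k jn kn; case: eqVneq => [<-|jk].
    by rewrite -(normals_var mN v0 lawN jn).
  exact: (normals_orth mN N0 v0 lawN indN jk).
rewrite (@orth_inner _ (measurableTypeR R) R lebesgue_measure n (cell t)
  (fun j => t j.+1 - t j))//.
- by move=> j jn; exact: (sqint_cell ht).
- by move=> j k jn kn; exact: (cell_orth ht).
Qed.

(** On a common partition xi and the S i are combinations of independent normal
    increments. Integration by parts turns the correlation into a derivative
    of F along the vector of the covariances E(xi S i), which the Lipschitz
    bound of F controls *)
Lemma step_gauss (m : nat) (xi : seq (R * R * R)) (S : nat -> seq (R * R * R))
    (F : (nat -> R) -> R) (C L K : R) :
  ordered_steps xi -> (forall i, ordered_steps (S i)) ->
  measurable_functional F -> (forall x, `|F x| <= C) -> 0 <= L -> 0 <= K ->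
  (forall x y k, 0 <= k -> (forall i, (i < m)%N -> `|x i - y i| <= k) ->
     `|F x - F y| <= L * k) ->
  (forall i, (i < m)%N ->
     `|\int[P]_w (step_integral B xi w * step_integral B (S i) w)| <= K) ->
  `|\int[P]_w (step_integral B xi w * F (fun i => step_integral B (S i) w))| <= L * K.
Proof.
move=> hxi hS mF FC L0 K0 FL hK.
pose ST i := if (i < m)%N then S i else [::].
have [|n [t [ht hp]]] := @common_partition (xi :: map S (iota 0 m)).
  by rewrite /= hxi all_map; apply/allP => i _ /=.
have [mN N0 v0 lawN indN] := increment_normals ht.
have xip : on_partition n t xi by apply: hp; rewrite mem_head.
have Sp i : (i < m)%N -> on_partition n t (S i).
  by move=> im; apply: hp; rewrite inE map_f ?orbT// mem_iota.
pose g i j := step_coef t (S i) j.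
pose G (x : nat -> R) : R := F (fun i => \sum_(j < n) g i j * x j).
have FE w : F (fun i => step_integral B (S i) w) = G (fun j => B (t j.+1) w - B (t j) w).
  apply/eqP; rewrite -subr_eq0 -normr_le0 -[X in _ <= X](mulr0 L).
  by apply: FL => // i im; rewrite (@step_integral_coef n t)// ?subrr ?normr0//; exact: Sp.
under eq_Rintegral do rewrite FE (@step_integral_coef n t)//.
pose Lam := \sum_(i < m) \sum_(j < n) `|g i j|.
apply: (normals_ibp mN N0 v0 lawN indN (C := C) (L := L * Lam)).
- move=> d' T f mf; apply: mF => i; apply: measurable_sum => j.
  exact: measurable_funM.
- by move=> x; exact: FC.
- by rewrite mulr_ge0// sumr_ge0// => i _; rewrite sumr_ge0.
- by rewrite mulr_ge0.
- move=> x y; rewrite -mulrA; apply: FL.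
    by rewrite mulr_ge0 ?sumr_ge0// => i _; rewrite sumr_ge0.
  move=> i im; rewrite -sumrB.
  apply: (@le_trans _ _ (\sum_(j < n) `|g i j| * `|x j - y j|)).
    by rewrite (le_trans (ler_norm_sum _ _ _))// ler_sum// => j _; rewrite -mulrBr normrM.
  apply: (@le_trans _ _ ((\sum_(j < n) `|g i j|) * \sum_(j < n) `|x j - y j|)).
    rewrite mulr_suml; apply: ler_sum => j _; rewrite ler_wpM2l//.
    by rewrite (bigD1 j)//= lerDl sumr_ge0.
  rewrite ler_wpM2r ?sumr_ge0// /Lam (bigD1 (Ordinal im))//= lerDl.
  by rewrite sumr_ge0// => k _; rewrite sumr_ge0.
- move=> x e e0; rewrite mulrCA; apply: FL; first by rewrite mulr_ge0// ltW.
  move=> i im; rewrite -sumrB.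
  have -> : \sum_(j < n) (g i j * (x j + (if (j < n)%N then
      e * (step_coef t xi j * (t j.+1 - t j)) else 0)) - g i j * x j) =
    e * \int[P]_w (step_integral B xi w * step_integral B (S i) w).
    have Sip := Sp i im; rewrite step_isometry//.
    under eq_Rintegral do rewrite (step_fun_coef ht _ xip) (step_fun_coef ht _ Sip).
    rewrite (@orth_inner _ (measurableTypeR R) R lebesgue_measure n (cell t)
      (fun j => t j.+1 - t j)); last 2 first.
    - by move=> j jn; exact: (sqint_cell ht).
    - by move=> j k jn kn; exact: (cell_orth ht).
    rewrite mulr_sumr; apply: eq_bigr => j _; rewrite ltn_ord /g; ring.
  by rewrite normrM (gtr0_norm e0) ler_wpM2l ?(ltW e0)// hK.
Qed.

End brownian_steps.

(** * Wiener integrals *)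

Lemma ler_addgt0_small (R : realType) (x y Q : R) : 0 <= Q ->
  (forall e, 0 < e -> e <= 1 -> x <= y + e * Q) -> x <= y.
Proof.
move=> Q0 h; apply/ler_addgt0Pr => t t0.
have Q1 : 0 < Q + 1 by rewrite ltr_wpDl.
have e0 : 0 < Num.min 1 (t / (Q + 1)) by rewrite lt_min ltr01 divr_gt0.
apply: (le_trans (h _ e0 _)); first by rewrite ge_min lexx.
rewrite lerD2l; apply: (@le_trans _ _ (t / (Q + 1) * Q)).
  by rewrite ler_wpM2r// ge_min lexx orbT.
by rewrite mulrAC ler_pdivrMr// ler_pM2l// lerDl.
Qed.

(** A correlation inequality for jointly Gaussian variables survives limits in L^2 *)
Section gauss_closure.
Context d (Omega : measurableType d) (R : realType) (P : probability Omega R).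
Variables (Phi : Omega -> (nat -> R) -> R) (m : nat) (C L : R).
Hypothesis mPhi : forall f : nat -> Omega -> R,
  (forall i, measurable_fun setT (f i)) ->
  measurable_fun setT (fun w => Phi w (fun i => f i w)).
Hypothesis PhiC : forall w x, `|Phi w x| <= C.
Hypothesis L0 : 0 <= L.
Hypothesis PhiL : forall w x y k, 0 <= k ->
  (forall i, (i < m)%N -> `|x i - y i| <= k) -> `|Phi w x - Phi w y| <= L * k.

(** A weak form of E(xi Phi(S)) = sum_i E(xi S_i) E(d_i Phi(S)), for a
    Lipschitz function Phi. The first argument of Phi makes room for
    variables that are independent of xi and S *)
Definition gauss_ineq (xi : Omega -> R) (S : nat -> Omega -> R) : Prop :=
  forall K, 0 <= K -> (forall i, (i < m)%N -> `|\int[P]_w (xi w * S i w)| <= K) ->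
  `|\int[P]_w (xi w * Phi w (fun i => S i w))| <= L * K.

Lemma gauss_closure (xi : Omega -> R) (S : nat -> Omega -> R) :
  sqint P xi -> (forall i, sqint P (S i)) ->
  (forall e, 0 < e -> exists xi' S', [/\ sqint P xi', forall i, sqint P (S' i),
     nrm2 P (fun w => xi' w - xi w) <= e,
     forall i, nrm2 P (fun w => S' i w - S i w) <= e & gauss_ineq xi' S']) ->
  gauss_ineq xi S.
Proof.
move=> hxi hS app K K0 hK.
have C0 : 0 <= C by apply: le_trans (PhiC point (fun=> 0)).
set a := nrm2 P xi; pose b := \sum_(i < m) nrm2 P (S i).
have a0 : 0 <= a by exact: nrm2_ge0.
have b0 : 0 <= b by apply: sumr_ge0 => i _; exact: nrm2_ge0.
have bS i : (i < m)%N -> nrm2 P (S i) <= b.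
  move=> im; rewrite /b (bigD1 (Ordinal im))//= lerDl.
  by apply: sumr_ge0 => j _; exact: nrm2_ge0.
apply: (@ler_addgt0_small _ _ _ (L * (a + b + 1) + C + L * (m%:R * (a + 1)))).
  by rewrite !addr_ge0// mulr_ge0// ?mulr_ge0 ?addr_ge0.
move=> e e0 e1; have [xi' [S' [hxi' hS' xe Se ineq]]] := app e e0.
have xi'a : nrm2 P xi' <= a + 1.
  by rewrite (le_trans (nrm2_le hxi' hxi))// lerD2l (le_trans xe).
have hK' i : (i < m)%N -> `|\int[P]_w (xi' w * S' i w)| <= K + e * (a + b + 1).
  move=> im; have := inner_close hxi' hxi (hS' i) (hS i).
  set u := \int[P]_w _; set v := \int[P]_w _ => huv.
  have -> : u = v + (u - v) by ring.
  rewrite (le_trans (ler_normD _ _))// lerD// ?hK//.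
  apply: (le_trans huv); have -> : a + b + 1 = (b + 1) + a by ring.
  rewrite mulrDr lerD//.
    apply: ler_pM => //; try exact: nrm2_ge0.
    by rewrite (le_trans (nrm2_le (hS' i) (hS i)))// lerD ?bS// (le_trans (Se i)).
  by rewrite mulrC ler_wpM2r.
have mP (f : nat -> Omega -> R) : (forall i, sqint P (f i)) ->
    sqint P (fun w => Phi w (fun i => f i w)).
  move=> hf; apply: (@sqint_bounded _ _ _ _ _ C) => //.
  by apply: mPhi => i; have [] := hf i.
have hP := mP S hS; have hP' := mP S' hS'.
have h1 := ineq _ (addr_ge0 K0 (mulr_ge0 (ltW e0) (addr_ge0 (addr_ge0 a0 b0) ler01))) hK'.
have -> : \int[P]_w (xi w * Phi w (fun i => S i w)) =
   \int[P]_w (xi' w * Phi w (fun i => S' i w))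
   - \int[P]_w ((xi' w - xi w) * Phi w (fun i => S i w))
   - \int[P]_w (xi' w * (Phi w (fun i => S' i w) - Phi w (fun i => S i w))).
  have i1 := sqintM hxi' hP'.
  have i2 := sqintM (sqintB hxi' hxi) hP.
  have i3 := sqintM hxi' (sqintB hP' hP).
  rewrite -RintegralB// -RintegralB//; last exact: (intgB i1 i2).
  by apply: eq_Rintegral => w _; ring.
have h2 : `|\int[P]_w ((xi' w - xi w) * Phi w (fun i => S i w))| <= e * C.
  rewrite (le_trans (cauchy_schwarz (sqintB hxi' hxi) hP))//.
  apply: ler_pM => //; try exact: nrm2_ge0.
  rewrite -(ler_sqr) ?nnegrE ?nrm2_ge0// nrm2K -[leRHS](Rint_cst P).
  apply: le_Rintegral => //; [by case: hP|exact: intg_cst|].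
  by move=> w _; rewrite -[X in X <= _]real_normK ?num_real// lerXn2r ?nnegrE.
have h3 : `|\int[P]_w (xi' w * (Phi w (fun i => S' i w) - Phi w (fun i => S i w)))| <=
    e * (L * (m%:R * (a + 1))).
  have hd i : sqint P (fun w => `|S' i w - S i w|) by apply/sqint_abs/sqintB.
  have hs : sqint P (fun w => \sum_(i < m) `|S' i w - S i w|).
    by apply: sqint_sum => i; exact: hd.
  apply: (@le_trans _ _ (\int[P]_w (L * (\sum_(i < m) (`|xi' w| * `|S' i w - S i w|))))).
    apply: le_Rint_abs.
    - exact: sqintM hxi' (sqintB hP' hP).
    - by apply: intgZ; apply: intg_sum => i; apply: sqintM (hd i); exact: sqint_abs.
    move=> w; rewrite normrM -mulr_sumr mulrCA ler_wpM2l//; apply: PhiL.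
      by rewrite sumr_ge0.
    by move=> i im; rewrite (bigD1 (Ordinal im))//= lerDl sumr_ge0.
  have iM (i : 'I_m) : intg P (fun w => `|xi' w| * `|S' i w - S i w|).
    by apply: sqintM (hd i); exact: sqint_abs.
  rewrite RintegralZl//; last exact: intg_sum.
  rewrite mulrCA ler_wpM2l// Rint_sum//.
  apply: (@le_trans _ _ (\sum_(i < m) (e * (a + 1)))).
    apply: ler_sum => i _.
    rewrite (le_trans (cauchy_schwarz_abs hxi' (sqintB (hS' i) (hS i))))// mulrC.
    by apply: ler_pM => //; exact: nrm2_ge0.
  by rewrite sumr_const card_ord -[_ *+ m]mulr_natl mulrCA lexx.
rewrite (le_trans (ler_normB _ _))//.
apply: (le_trans (lerD (ler_normB _ _) (lexx _))).
apply: (le_trans (lerD (lerD h1 h2) h3)); lra.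
Qed.

End gauss_closure.

Section wiener_integrals.
Context {R : realType} d (Omega : measurableType d) (P : probability Omega R).
Variable B : R -> {RV P >-> R}.
Hypothesis hB : is_brownian_motion B.
Local Notation leb := (@lebesgue_measure R).

(** I is the Wiener integral of g, in terms of L^2 norms; unlike
    sequences of approximations, this form is visibly linear *)
Definition wiener (g : R -> R) (I : Omega -> R) : Prop :=
  [/\ sqint leb g, sqint P I & forall e, 0 < e -> exists s,
    [/\ ordered_steps s, nrm2 leb (fun x => step_fun s x - g x) <= e
      & nrm2 P (fun w => step_integral B s w - I w) <= e]].

Lemma sqint_step_fun (s : seq (R * R * R)) : sqint leb (step_fun s).
Proof.
apply: sqint_sum => p; apply: sqintZ; split; first exact: measurable_indic.
have -> : (fun x : R => (\1_(`]p.1.2, p.2]) x : R) ^+ 2) = \1_(`]p.1.2, p.2]).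
  by apply/funext => x; rewrite indicE; case: (x \in _); rewrite ?expr1n ?expr0n.
exact: integrable_indic_itv.
Qed.

Lemma nrm2_small d' (T : measurableType d') (mu : {measure set T -> \bar R})
    (f : nat -> T -> R) (e : R) : 0 < e ->
  ((\int[mu]_x ((f n x) ^+ 2)%:E)%E @[n --> \oo] --> 0%E) ->
  \forall n \near \oo, (\int[mu]_x ((f n x) ^+ 2)%:E < +oo)%E /\ nrm2 mu (f n) <= e.
Proof.
move=> e0 /fine_cvgP[fin /cvgrPdist_le /(_ (e ^+ 2))].
rewrite exprn_gt0// => /(_ isT) h.
near=> n.
have hn : `|0 - fine (\int[mu]_x ((f n x) ^+ 2)%:E)%E| <= e ^+ 2 by near: n.
have fn : (\int[mu]_x ((f n x) ^+ 2)%:E)%E \is a fin_num by near: n.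
split; first by rewrite ltey_eq fn.
rewrite -ler_sqr ?nnegrE ?nrm2_ge0 ?(ltW e0)// nrm2K.
by move: hn; rewrite sub0r normrN => /(le_trans (ler_norm _)).
Unshelve. all: by end_near. Qed.

Lemma wiener_def g (I : {RV P >-> R}) : is_wiener_integral B g I -> wiener g I.
Proof.
move=> [gL [s [so hg hI]]].
have sg : sqint leb g.
  split; last exact: Lfun2_integrable_sqr.
  by move: gL; rewrite inE => /andP[]; rewrite inE.
have mI : measurable_fun setT I by [].
have sI : sqint P I.
  have := nrm2_small (f := fun n w => step_integral B (s n) w - I w) ltr01 hI.
  move=> [n _ /(_ n (leqnn n)) [fin _]].
  have sd : sqint P (fun w => step_integral B (s n) w - I w).
    have mst := (sqint_step_integral hB (so n)).1.
    have md : measurable_fun setT (fun w => step_integral B (s n) w - I w).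
      exact: measurable_funB.
    split => //; apply/integrableP; split.
      by apply/measurable_EFinP; exact: measurable_funX.
    by under eq_integral do rewrite /= ger0_norm ?sqr_ge0//.
  have := sqintB (sqint_step_integral hB (so n)) sd.
  by under eq_fun do rewrite opprB addrC subrK.
split => // e e0.
have h1 := @nrm2_small _ (measurableTypeR R) leb (fun n x => step_fun (s n) x - g x) e e0 hg.
have h2 := nrm2_small (f := fun n w => step_integral B (s n) w - I w) e0 hI.
have [n _ /(_ n (leqnn n)) [[_ ?] [_ ?]]] := filterI h1 h2.
by exists (s n); split => //; exact: so.
Unshelve. all: by end_near. Qed.

Lemma wienerD (c : R) g g' I I' : wiener g I -> wiener g' I' ->
  wiener (fun x => g x + c * g' x) (fun w => I w + c * I' w).
Proof.
move=> [sg sI h] [sg' sI' h']; split.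
- by apply: sqintD => //; exact: sqintZ.
- by apply: sqintD => //; exact: sqintZ.
move=> e e0; have c0 : 0 < 1 + `|c| by rewrite ltr_pwDl.
have [|s [so s1 s2]] := h (e / (1 + `|c|)); first by rewrite divr_gt0.
have [|s' [so' s1' s2']] := h' (e / (1 + `|c|)); first by rewrite divr_gt0.
pose sc := [seq (c * p.1.1, p.1.2, p.2) | p <- s'].
have bound d' (T : measurableType d') (mu : {measure set T -> \bar R}) (f f' f1 f2 : T -> R) :
    sqint mu f -> sqint mu f' -> sqint mu f1 -> sqint mu f2 ->
    nrm2 mu (fun x => f x - f1 x) <= e / (1 + `|c|) ->
    nrm2 mu (fun x => f' x - f2 x) <= e / (1 + `|c|) ->
    nrm2 mu (fun x => f x + c * f' x - (f1 x + c * f2 x)) <= e.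
  move=> hf hf' hf1 hf2 h1 h2.
  have -> : (fun x => f x + c * f' x - (f1 x + c * f2 x)) =
      (fun x => (f x - f1 x) + c * (f' x - f2 x)) by apply/funext => x; ring.
  apply: (le_trans (nrm2D (sqintB hf hf1) (sqintZ c (sqintB hf' hf2)))).
  rewrite nrm2Z; last exact: sqintB.
  apply: (le_trans (lerD h1 (ler_wpM2l (normr_ge0 _) h2))).
  by rewrite -[X in X + _]mul1r -mulrDl mulrC divfK// gt_eqF.
have sfE x : step_fun (s ++ sc) x = step_fun s x + c * step_fun s' x.
  rewrite /step_fun big_cat/= big_map mulr_sumr; congr (_ + _).
  by apply: eq_bigr => p _; rewrite mulrA.
have siE w : step_integral B (s ++ sc) w = step_integral B s w + c * step_integral B s' w.
  rewrite /step_integral big_cat/= big_map mulr_sumr; congr (_ + _).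
  by apply: eq_bigr => p _; rewrite mulrA.
exists (s ++ sc); split.
- by rewrite /ordered_steps all_cat; apply/andP; split => //; rewrite all_map.
- under eq_fun do rewrite sfE.
  by apply: bound => //; exact: sqint_step_fun.
- under eq_fun do rewrite siE.
  by apply: bound => //; exact: sqint_step_integral.
Qed.

Lemma wiener0 : wiener (fun=> 0) (fun=> 0).
Proof.
have s0 d' (T : measurableType d') (mu : {measure set T -> \bar R}) :
    sqint mu (fun=> 0 : R).
  by split => //; under eq_fun do rewrite expr0n; exact: integrable0.
split; [exact: s0|exact: s0|move=> e e0]; exists [::]; split => //.
  rewrite /nrm2 (_ : Rintegral _ _ _ = 0) ?sqrtr0 ?(ltW e0)//.
  under eq_Rintegral do rewrite /step_fun big_nil subrr expr0n/=.
  by rewrite Rintegral_cst// mul0r.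
rewrite /nrm2 (_ : Rintegral _ _ _ = 0) ?sqrtr0 ?(ltW e0)//.
under eq_Rintegral do rewrite /step_integral big_nil subrr expr0n/=.
by rewrite Rintegral_cst// mul0r.
Qed.

(** Both sides are continuous in L^2, and they agree for step functions *)
Lemma wiener_isometry g g' I I' : wiener g I -> wiener g' I' ->
  \int[P]_w (I w * I' w) = \int[leb]_x (g x * g' x).
Proof.
move=> [sg sI h] [sg' sI' h']; apply/eqP; rewrite -subr_eq0 -normr_le0.
pose Q := nrm2 P I' + (nrm2 P I + 1) + (nrm2 leb g' + (nrm2 leb g + 1)).
apply: (@ler_addgt0_small _ _ _ Q).
  by rewrite !addr_ge0// nrm2_ge0.
move=> e e0 e1; rewrite add0r.
have [s [so s1 s2]] := h e e0; have [s' [so' s1' s2']] := h' e e0.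
have sf := sqint_step_fun s; have sf' := sqint_step_fun s'.
have si := sqint_step_integral hB so; have si' := sqint_step_integral hB so'.
have bound d' (T : measurableType d') (mu : {measure set T -> \bar R}) (f f' f1 f2 : T -> R) :
    sqint mu f -> sqint mu f' -> sqint mu f1 -> sqint mu f2 ->
    nrm2 mu (fun x => f x - f1 x) <= e -> nrm2 mu (fun x => f' x - f2 x) <= e ->
    `|\int[mu]_x (f1 x * f2 x) - \int[mu]_x (f x * f' x)| <=
      e * (nrm2 mu f2 + (nrm2 mu f1 + 1)).
  move=> hf hf' hf1 hf2 h1 h2; rewrite (le_trans (inner_close hf1 hf hf2 hf'))//.
  rewrite mulrDr; apply: lerD.
    by rewrite nrm2BC ler_wpM2r ?nrm2_ge0.
  rewrite mulrC nrm2BC; apply: ler_pM => //; try exact: nrm2_ge0.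
  by rewrite (le_trans (nrm2_le hf hf1))// lerD2l (le_trans h1).
have b1 := bound _ _ _ _ _ _ _ si si' sI sI' s2 s2'.
have b2 := bound _ _ _ _ _ _ _ sf sf' sg sg' s1 s1'.
rewrite (step_isometry hB so so') in b1.
set u := \int[P]_w _ in b1 *; set v := \int[leb]_x (g x * _) in b2 *.
set z := \int[leb]_x _ in b1 b2.
have -> : u - v = (u - z) - (v - z) by ring.
by rewrite (le_trans (ler_normB _ _))// /Q [leRHS]mulrDr lerD.
Qed.

Lemma wiener_gauss (m : nat) (g : R -> R) (xi : Omega -> R) (h : nat -> R -> R)
    (S : nat -> Omega -> R) (F : (nat -> R) -> R) (C L : R) :
  wiener g xi -> (forall i, wiener (h i) (S i)) ->
  measurable_functional F -> (forall x, `|F x| <= C) -> 0 <= L ->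
  (forall x y k, 0 <= k -> (forall i, (i < m)%N -> `|x i - y i| <= k) ->
     `|F x - F y| <= L * k) ->
  gauss_ineq P (fun=> F) m L xi S.
Proof.
move=> [sg sxi hxi] hS mF FC L0 FL.
apply: (@gauss_closure _ _ _ P _ m C) => //.
- by move=> f mf; exact: mF.
- by move=> i; have [] := hS i.
move=> e e0; have [s [so _ s2]] := hxi e e0.
have hi i : exists s', ordered_steps s' /\
    nrm2 P (fun w => step_integral B s' w - S i w) <= e.
  by have [_ _ /(_ e e0)[s' [? _ ?]]] := hS i; exists s'.
have [S' hS'] := choice hi.
exists (step_integral B s), (fun i => step_integral B (S' i)); split => //.
- exact: sqint_step_integral.
- by move=> i; apply: sqint_step_integral => //; have [] := hS' i.
- by move=> i; have [] := hS' i.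
- move=> K K0 hK; apply: (step_gauss hB (m := m) (C := C)) => //.
  by move=> i; have [] := hS' i.
Qed.

End wiener_integrals.

(** * The kernels of Riesz potentials *)

Section riesz_kernel.
Context {R : realType}.
Local Notation mu := (@lebesgue_measure R).
Implicit Types (a b c x y u r : R).

Definition kern b x : R := (`|x| `^ b)^-1.

Lemma kern_ge0 b x : 0 <= kern b x.
Proof. by rewrite invr_ge0 powR_ge0. Qed.

Lemma kernN b x : kern b (- x) = kern b x.
Proof. by rewrite /kern normrN. Qed.

Lemma kern_mul b x y : kern b (x * y) = kern b x * kern b y.
Proof. by rewrite /kern normrM powRM// invfM. Qed.

Lemma kernD b c x : x != 0 -> kern (b + c) x = kern b x * kern c x.
Proof.
by move=> x0; rewrite /kern powRD ?invfM// normr_eq0 x0 implybT.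
Qed.

Lemma kern_le1 b x : 0 <= b -> 1 <= `|x| -> kern b x <= 1.
Proof.
move=> b0 x1; rewrite invf_le1; last by rewrite powR_gt0// (lt_le_trans ltr01).
by rewrite -(powRr0 `|x|) ler_powR.
Qed.

Lemma measurable_kern b : measurable_fun setT (kern b).
Proof.
have -> : kern b = fun x => `|x| `^ (- b) by apply/funext => x; rewrite powRN.
by apply: (measurableT_comp (measurable_powR (- b))).
Qed.

Lemma pow2_lt b c : b < c -> (2 : R) `^ b < 2 `^ c.
Proof.
move=> bc; rewrite /powR pnatr_eq0/= ltr_expR ltr_pM2r// ln_gt0// ltr1n.
by [].
Qed.

Lemma kern2 b x : kern b (2 * x) = kern b x / 2 `^ b.
Proof. by rewrite kern_mul mulrC /kern normr_nat. Qed.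

Definition ball_ind (k x : R) : R := (`|x| <= k)%R%:R.

Lemma measurable_ball_ind k : measurable_fun setT (ball_ind k).
Proof.
have -> : ball_ind k = \1_(`[- k, k]).
  by apply/funext => x; rewrite /ball_ind indicE mem_setE in_itv/= ler_norml.
exact: measurable_indic.
Qed.

Lemma integral_ball_ind k : 0 <= k -> (\int[mu]_x (ball_ind k x)%:E = (2 * k)%:E)%E.
Proof.
move=> k0; have -> : ball_ind k = \1_(`[- k, k]).
  by apply/funext => x; rewrite /ball_ind indicE mem_setE in_itv/= ler_norml.
rewrite integral_indic// setIT.
have /= -> := @lebesgue_measure_itv R `[- k, k].
rewrite lte_fin; case: ltP => h.
  by rewrite -EFinD; congr EFin; ring.
by rewrite (_ : k = 0) ?mulr0//; lra.
Qed.

(** If f(x) <= c f(lam x) + g(x) with c < lam, then by scaling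
    ||f|| <= (c / lam) ||f|| + ||g|| in L^1 *)
Lemma selfsimilar_bound (f : R -> R) (lam c C : R) :
  measurable_fun setT f -> (forall x, 0 <= f x) -> (\int[mu]_x (f x)%:E < +oo)%E ->
  0 < lam -> 0 <= c -> c < lam -> 0 <= C ->
  (forall x, f x <= c * f (lam * x) + C * ball_ind 2 x) ->
  (\int[mu]_x (f x)%:E <= (4 * C / (1 - c / lam))%:E)%E.
Proof.
move=> mf f0 flt l0 c0 cl C0 hf.
have mfl : measurable_fun setT (fun x => f (lam * x)).
  by apply: measurableT_comp => //; exact: measurable_funM.
have m1 : measurable_fun setT (fun x : R => c * f (lam * x)) by exact: measurable_funM.
have m2 : measurable_fun setT (fun x : R => C * ball_ind 2 x).
  by apply: measurable_funM => //; exact: measurable_ball_ind.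
have h : (\int[mu]_x (f x)%:E <= c%:E * \int[mu]_x (f (lam * x))%:E + (4 * C)%:E)%E.
  apply: (@le_trans _ _ (\int[mu]_x ((c * f (lam * x))%:E + (C * ball_ind 2 x)%:E))%E).
    apply: ge0_le_integral => //.
    - by move=> x _; rewrite lee_fin.
    - exact/measurable_EFinP.
    - by apply: emeasurable_funD; exact/measurable_EFinP.
    - by move=> x _; rewrite -EFinD lee_fin.
  rewrite ge0_integralD//=; last 4 first.
  - by move=> x _; rewrite lee_fin mulr_ge0.
  - exact/measurable_EFinP.
  - by move=> x _; rewrite lee_fin mulr_ge0// ler0n.
  - exact/measurable_EFinP.
  under eq_integral do rewrite EFinM.
  rewrite ge0_integralZl//; last 2 first.
  - exact/measurable_EFinP.
  - by move=> x _; rewrite lee_fin.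
  under [X in (_ + X <= _)%E]eq_integral do rewrite EFinM.
  rewrite ge0_integralZl//; last 2 first.
  - by apply/measurable_EFinP; exact: measurable_ball_ind.
  - by move=> x _; rewrite lee_fin ler0n.
  rewrite integral_ball_ind// leeD2l// -EFinM lee_fin.
  by rewrite le_eqVlt; apply/orP; left; apply/eqP; ring.
pose J := fine (\int[mu]_x (f x)%:E)%E.
have JE : (\int[mu]_x (f x)%:E = J%:E)%E.
  by rewrite fineK// ge0_fin_numE// integral_ge0// => x _; rewrite lee_fin.
have hs : (\int[mu]_x (f (lam * x))%:E = (J / lam)%:E)%E.
  have := @ge0_integral_scale _ lam (fun x => (f x)%:E) l0.
  rewrite JE => hs; have {hs} : (lam%:E * \int[mu]_x (f (lam * x)%R)%:E = J%:E)%E.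
    by apply: hs => //; exact/measurable_EFinP.
  move=> /(congr1 (fun z => (lam^-1)%:E * z)%E).
  by rewrite muleA -EFinM mulVf ?gt_eqF// mul1e -EFinM mulrC.
rewrite JE hs -EFinM -EFinD lee_fin in h; rewrite JE lee_fin.
have cl1 : 0 < 1 - c / lam by rewrite subr_gt0 ltr_pdivrMr// mul1r.
by rewrite ler_pdivlMr// mulrBr mulr1 lerBlDl mulrCA.
Qed.

(** Suprema of truncations: Fatou's lemma in a form suited to kernels *)
Lemma integral_trunc_bound (f : nat -> R -> R) (g : R -> R) (C : R) :
  (forall n, measurable_fun setT (f n)) -> (forall n x, 0 <= f n x) ->
  (forall n m x, (n <= m)%N -> f n x <= f m x) ->
  (forall x, \forall n \near \oo, f n x = g x) ->
  (forall n, (\int[mu]_x (f n x)%:E <= C%:E)%E) ->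
  (\int[mu]_x (g x)%:E <= C%:E)%E.
Proof.
move=> mf f0 nd fg fC.
have <- : (\int[mu]_x limn (fun n => (f n x)%:E) = \int[mu]_x (g x)%:E)%E.
  apply: eq_integral => x _; apply/cvg_lim => //.
  apply: (@cvg_near_cst); near=> n; congr EFin; near: n; exact: fg.
rewrite monotone_convergence//.
- apply: lime_le; last by apply: nearW => n; exact: fC.
  apply: ereal_nondecreasing_is_cvgn => a b ab; apply: ge0_le_integral => //.
  + by move=> x _; rewrite lee_fin.
  + by apply/measurable_EFinP; exact: mf.
  + by apply/measurable_EFinP; exact: mf.
  + by move=> x _; rewrite lee_fin nd.
- by move=> n; apply/measurable_EFinP; exact: mf.
- by move=> n x _; rewrite lee_fin.
- by move=> x _ a b ab; rewrite lee_fin nd.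
Unshelve. all: by end_near. Qed.

(** Integrability at the origin, from selfsimilarity: the truncations f of
    |x|^{-b} on the unit ball satisfy f(x) <= 2^b f(2 x) + O(1), and 2^b < 2 *)
Lemma kern_near b : 0 <= b -> b < 1 ->
  (\int[mu]_x (kern b x * ball_ind 1 x)%:E < +oo)%E.
Proof.
move=> b0 b1; have p2 : (2 : R) `^ b < 2 by rewrite -[X in _ < X]powRr1// pow2_lt.
have p1 : 1 <= (2 : R) `^ b by rewrite -[X in X <= _](powRr0 2) ler_powR// ler1n.
have p0 : 0 < (2 : R) `^ b by lra.
pose f (n : nat) x : R := Num.min (kern b x) n%:R * ball_ind 1 x.
have mf n : measurable_fun setT (f n).
  apply: measurable_funM; last exact: measurable_ball_ind.
  by apply: measurable_minr => //; exact: measurable_kern.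
have f0 n x : 0 <= f n x.
  by rewrite mulr_ge0 ?ler0n// le_min kern_ge0 ler0n.
apply: (@le_lt_trans _ _ ((4 * 2 `^ b / (1 - 2 `^ b / 2))%:E)%E); last by rewrite ltry.
apply: (@integral_trunc_bound f) => //.
- move=> n m x nm; rewrite ler_wpM2r ?ler0n// le_min ge_min lexx/= ge_min.
  by rewrite ler_nat nm orbT.
- move=> x; near=> n; rewrite /f; congr (_ * _); apply/min_idPl.
  near: n; exact: nbhs_infty_ger.
move=> n; apply: selfsimilar_bound => //.
- apply: (@le_lt_trans _ _ (\int[mu]_x (n%:R%:E * (ball_ind 1 x)%:E))%E).
    apply: ge0_le_integral => //.
    + by move=> x _; rewrite lee_fin.
    + by apply/measurable_EFinP; exact: mf.
    + by apply: emeasurable_funM => //; apply/measurable_EFinP; exact: measurable_ball_ind.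
    + by move=> x _; rewrite -EFinM lee_fin ler_wpM2r ?ler0n// ge_min lexx orbT.
  rewrite ge0_integralZl//; last 2 first.
  + by apply/measurable_EFinP; exact: measurable_ball_ind.
  + by move=> x _; rewrite lee_fin ler0n.
  by rewrite integral_ball_ind// -EFinM ltry.
move=> x; rewrite /f kern2 /ball_ind normrM normr_nat.
have [xh|xh] := leP (2 * `|x|) 1.
  have -> : `|x| <= 1 by have := normr_ge0 x; lra.
  rewrite !mulr1; apply: (@le_trans _ _ (2 `^ b * Num.min (kern b x / 2 `^ b) n%:R)).
    rewrite (minr_pMr _ _ (ltW p0)) mulrCA divff ?gt_eqF// mulr1.
    by rewrite le_min ge_min lexx/= ge_min ler_peMl ?orbT.
  by rewrite lerDl mulr_ge0 ?ler0n// ltW.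
rewrite mulr0 mulr0 add0r; have [x1|x1] := leP `|x| 1; last first.
  by rewrite mulr0 mulr_ge0 ?ler0n// ltW.
have -> : `|x| <= 2 by lra.
rewrite !mulr1 ge_min; apply/orP; left.
have hk : kern b (2 * x) <= 1.
  by apply: kern_le1 => //; rewrite normrM normr_nat ltW.
by rewrite kern2 ler_pdivrMr// mul1r in hk.
Unshelve. all: by end_near. Qed.

(** The argument of kern_near with the inverse scaling *)
Lemma kern_far b : 1 < b ->
  (\int[mu]_x (kern b x * (1 < `|x|)%R%:R)%:E < +oo)%E.
Proof.
move=> b1; have p2 : (2 : R) < 2 `^ b by rewrite -[X in X < _]powRr1// pow2_lt.
have p0 : 0 < (2 : R) `^ b by lra.
have b0 : 0 <= b by lra.
pose f (n : nat) x : R := kern b x * (ball_ind n%:R x * (1 < `|x|)%R%:R).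
have mt : measurable_fun setT (fun x : R => (1 < `|x|)%R%:R : R).
  have -> : (fun x : R => (1 < `|x|)%R%:R : R) = fun x => 1 - ball_ind 1 x.
    by apply/funext => x; rewrite /ball_ind; case: ltP; rewrite ?subr0 ?subrr.
  by apply: measurable_funB => //; exact: measurable_ball_ind.
have mf n : measurable_fun setT (f n).
  apply: measurable_funM; first exact: measurable_kern.
  by apply: measurable_funM => //; exact: measurable_ball_ind.
have f0 n x : 0 <= f n x by rewrite !mulr_ge0 ?ler0n ?kern_ge0.
have ballE n m x : (n <= m)%N -> ball_ind n%:R x <= ball_ind m%:R x.
  move=> nm; rewrite /ball_ind ler_nat; case: (leP `|x| n%:R) => // h.
  by rewrite (le_trans h)// ler_nat.
apply: (@le_lt_trans _ _ ((4 * 1 / (1 - (2 `^ b)^-1 / 2^-1))%:E)%E); last by rewrite ltry.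
apply: (@integral_trunc_bound f) => //.
- move=> n m x nm; rewrite ler_wpM2l ?kern_ge0// ler_wpM2r ?ler0n//.
  exact: ballE.
- move=> x; near=> n; rewrite /f; congr (_ * _).
  suff -> : ball_ind n%:R x = 1 by rewrite mul1r.
  rewrite /ball_ind; suff -> : `|x| <= n%:R by [].
  near: n; exact: nbhs_infty_ger.
move=> n; apply: selfsimilar_bound => //.
- apply: (@le_lt_trans _ _ (\int[mu]_x (ball_ind n%:R x)%:E)%E).
    apply: ge0_le_integral => //.
    + by move=> x _; rewrite lee_fin.
    + by apply/measurable_EFinP; exact: mf.
    + by apply/measurable_EFinP; exact: measurable_ball_ind.
    + move=> x _; rewrite lee_fin /f; case: (ltP 1 `|x|) => h.
        by rewrite mulr1 ler_piMl ?ler0n// kern_le1// ltW.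
      by rewrite mulr0 mulr0 ler0n.
  by rewrite integral_ball_ind// ltry.
- by rewrite ltf_pV2 ?posrE.
move=> x.
have hx : kern b (2^-1 * x) = 2 `^ b * kern b x.
  have e2 : x = 2 * (2^-1 * x) by rewrite mulrA divff// mul1r.
  by rewrite [X in _ = _ * kern b X]e2 kern2 mulrCA divff ?gt_eqF// mulr1.
have nx : `|2^-1 * x| = `|x| / 2 by rewrite normrM normfV normr_nat mulrC.
rewrite /f hx nx.
have [x2|x2] := leP `|x| 2.
  have -> : ball_ind 2 x = 1 by rewrite /ball_ind x2.
  apply: (@le_trans _ _ 1).
    case: (ltP 1 `|x|) => h; last by rewrite mulr0 mulr0 ler01.
    rewrite mulr1 -[X in _ <= X]mulr1 ler_pM ?kern_ge0 ?ler0n//.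
      by rewrite kern_le1// ltW.
    by rewrite /ball_ind lern1; case: (`|x| <= n%:R).
  rewrite mulr1 lerDr; repeat apply: mulr_ge0; rewrite ?invr_ge0 ?ler0n ?kern_ge0//.
have -> : ball_ind 2 x = 0 by rewrite /ball_ind leNgt x2.
rewrite mulr0 addr0 -!mulrA mulKf ?gt_eqF// ler_wpM2l ?kern_ge0// /ball_ind nx.
have -> : 1 < `|x| by lra.
have -> : 1 < `|x| / 2 by lra.
rewrite !mulr1 ler_nat; case: (leP `|x| n%:R) => // h.
suff -> : `|x| / 2 <= n%:R by [].
by have := normr_ge0 x; lra.
Unshelve. all: by end_near. Qed.

End riesz_kernel.

Section kernel_bounds.
Context {R : realType}.
Local Notation mu := (@lebesgue_measure R).
Implicit Types (a b c x y u r t : R).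

(** The kernel is at most 1 outside of the unit ball around r, and integrable
    inside it *)
Lemma kern_window b T : 0 <= b -> b < 1 -> 0 <= T -> exists2 W : R, 0 <= W &
  forall r, (\int[mu]_u (\1_(`[0, T]) u * kern b (u - r))%:E <= W%:E)%E.
Proof.
move=> b0 b1 T0; have near := kern_near b0 b1.
set I := (\int[mu]_x _)%E in near.
have I0 : (0 <= I)%E.
  by apply: integral_ge0 => x _; rewrite lee_fin mulr_ge0 ?kern_ge0 ?ler0n.
have mI : measurable_fun setT (fun x : R => kern b x * ball_ind 1 x).
  by apply: measurable_funM; [exact: measurable_kern|exact: measurable_ball_ind].
have mind : measurable_fun setT (\1_(`[0, T]) : R -> R) by exact: measurable_indic.
have mk r : measurable_fun setT (fun u : R => kern b (u - r)).
  apply: (measurableT_comp (@measurable_kern R b)).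
  exact: measurable_funB.
exists (fine I + T); first by rewrite addr_ge0// fine_ge0.
move=> r.
have mIr : measurable_fun setT (fun u : R => kern b (u - r) * ball_ind 1 (u - r)).
  by apply: (measurableT_comp mI); exact: measurable_funB.
have m1 : measurable_fun setT (fun u : R => \1_(`[0, T]) u * kern b (u - r)).
  by apply: measurable_funM => //; exact: mk.
apply: (@le_trans _ _ (\int[mu]_u ((kern b (u - r) * ball_ind 1 (u - r))%:E +
    (\1_(`[0, T]) u)%:E))%E).
  apply: ge0_le_integral => //.
  - by move=> u _; rewrite lee_fin mulr_ge0 ?kern_ge0.
  - exact/measurable_EFinP.
  - by apply: emeasurable_funD; exact/measurable_EFinP.
  - move=> u _; rewrite -EFinD lee_fin /ball_ind.
    have i1 : (\1_(`[0, T]) u : R) <= 1 by rewrite indicE; case: (_ \in _).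
    have [h|h] := leP `|u - r| 1.
      by rewrite mulr1 ler_wpDr// ler_piMl ?kern_ge0.
    rewrite mulr0 add0r -[X in _ <= X]mulr1 ler_wpM2l// kern_le1// ltW//.
rewrite ge0_integralD//; last 3 first.
- by move=> u _; rewrite lee_fin mulr_ge0 ?kern_ge0 ?ler0n.
- exact/measurable_EFinP.
- exact/measurable_EFinP.
rewrite EFinD; apply: leeD.
  rewrite (ge0_integral_shift (- r) (f := fun x => (kern b x * ball_ind 1 x)%:E)).
  - by rewrite fineK// ge0_fin_numE.
  - exact/measurable_EFinP.
  - by move=> x; rewrite lee_fin mulr_ge0 ?kern_ge0 ?ler0n.
rewrite integral_indic// setIT.
have /= -> := @lebesgue_measure_itv R `[0, T].
by rewrite lte_fin; case: ltP => // h; rewrite oppr0 adde0.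
Qed.

(** Near 0 and near 1 one of the factors is bounded, and at infinity the
    product decays like |y|^{-2a}, where 2a > 1 *)
Lemma kern_conv_fin a : 2^-1 < a -> a < 1 ->
  (\int[mu]_y (kern a y * kern a (1 - y))%:E < +oo)%E.
Proof.
move=> ah a1; have a0 : 0 <= a by lra.
pose g1 x : R := kern a x * ball_ind 1 x.
pose g2 x : R := kern (2 * a) x * (1 < `|x|)%R%:R.
have mt : measurable_fun setT (fun x : R => (1 < `|x|)%R%:R : R).
  have -> : (fun x : R => (1 < `|x|)%R%:R : R) = fun x => 1 - ball_ind 1 x.
    by apply/funext => x; rewrite /ball_ind; case: ltP; rewrite ?subr0 ?subrr.
  by apply: measurable_funB => //; exact: measurable_ball_ind.
have mg1 : measurable_fun setT g1.
  by apply: measurable_funM; [exact: measurable_kern|exact: measurable_ball_ind].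
have mg2 : measurable_fun setT g2.
  by apply: measurable_funM => //; exact: measurable_kern.
pose g x := 2 * g1 x + g2 x.
have g10 x : 0 <= g1 x by rewrite mulr_ge0 ?kern_ge0 ?ler0n.
have g20 x : 0 <= g2 x by rewrite mulr_ge0 ?kern_ge0 ?ler0n.
have g0 x : 0 <= g x by rewrite addr_ge0// mulr_ge0.
have mg : measurable_fun setT g by apply: measurable_funD => //; exact: measurable_funM.
have gfin : (\int[mu]_x (g x)%:E < +oo)%E.
  under eq_integral do rewrite EFinD EFinM.
  rewrite ge0_integralD//; last 4 first.
  - by move=> x _; rewrite -EFinM lee_fin mulr_ge0.
  - by apply: emeasurable_funM => //; exact/measurable_EFinP.
  - by move=> x _; rewrite lee_fin.
  - exact/measurable_EFinP.
  rewrite ge0_integralZl//; last 2 first.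
  - exact/measurable_EFinP.
  - by move=> x _; rewrite lee_fin.
  apply: lte_add_pinfty.
    by rewrite lte_mul_pinfty// kern_near.
  by apply: kern_far; lra.
have gs : (\int[mu]_y (g (1 - y))%:E = \int[mu]_y (g y)%:E)%E.
  rewrite -(ge0_integral_opp (f := fun y => (g y)%:E)); last 2 first.
  - exact/measurable_EFinP.
  - by move=> x; rewrite lee_fin.
  rewrite -(ge0_integral_shift (-1) (f := fun y => (g (- y))%:E)); last 2 first.
  - by apply/measurable_EFinP; apply: (measurableT_comp mg).
  - by move=> x; rewrite lee_fin.
  by apply: eq_integral => y _; rewrite opprD opprK addrC.
have mgs : measurable_fun setT (fun y : R => g (1 - y)).
  by apply: (measurableT_comp mg); exact: measurable_funB.
have mk : measurable_fun setT (fun y : R => kern a y * kern a (1 - y)).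
  apply: measurable_funM; first exact: measurable_kern.
  by apply: (measurableT_comp (@measurable_kern R a)); exact: measurable_funB.
apply: (@le_lt_trans _ _ (\int[mu]_y ((g y)%:E + (g (1 - y))%:E))%E).
  apply: ge0_le_integral => //.
  - by move=> y _; rewrite lee_fin mulr_ge0 ?kern_ge0.
  - exact/measurable_EFinP.
  - by apply: emeasurable_funD; exact/measurable_EFinP.
  move=> y _; rewrite -EFinD lee_fin.
  have half x : 2^-1 <= `|x| -> kern a x <= 2.
    move=> xh; have : kern a (2 * x) <= 1.
      by apply: kern_le1 => //; rewrite normrM normr_nat; lra.
    rewrite kern2 ler_pdivrMr ?powR_gt0// mul1r => /le_trans; apply.
    by rewrite -[X in _ <= X](powRr1 (ler0n _ 2)) ler_powR ?ler1n// ltW.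
  have nonneg := g0 y; have nonneg' := g0 (1 - y).
  have tri : 1 <= `|y| + `|1 - y|.
    by have := ler_normD y (1 - y); rewrite addrC subrK normr1.
  have case1 x z : `|x| <= 1 -> 2^-1 <= `|z| -> kern a x * kern a z <= g x.
    move=> x1 zh; rewrite /g /g1 /ball_ind x1 mulr1.
    apply: (@le_trans _ _ (kern a x * 2)); first by rewrite ler_wpM2l ?kern_ge0// half.
    by rewrite mulrC lerDl.
  have [y1|y1] := leP `|y| 1.
    have [z1|z1] := leP 2^-1 `|1 - y|.
      by have := case1 y (1 - y) y1 z1; lra.
    have : kern a (1 - y) * kern a y <= g (1 - y) by apply: case1; lra.
    by rewrite mulrC; lra.
  have [z1|z1] := leP `|1 - y| 1.
    have : kern a (1 - y) * kern a y <= g (1 - y) by apply: case1; lra.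
    by rewrite mulrC; lra.
  have y0 : y != 0 by rewrite -normr_gt0; lra.
  have z0 : 1 - y != 0 by rewrite -normr_gt0; lra.
  have sq x : x != 0 -> 1 < `|x| -> kern a x ^+ 2 <= g x.
    move=> x0 x1; rewrite /g /g2 x1 mulr1 (_ : 2 * a = a + a) ?kernD -?expr2//; last by ring.
    by rewrite lerDr mulr_ge0.
  have := sq y y0 y1; have := sq (1 - y) z0 z1.
  have := sqr_ge0 (kern a y - kern a (1 - y)).
  have := mulr_ge0 (kern_ge0 a y) (kern_ge0 a (1 - y)).
  by rewrite sqrrB -mulr_natl; lra.
rewrite ge0_integralD//; last 4 first.
- by move=> y _; rewrite lee_fin.
- exact/measurable_EFinP.
- by move=> y _; rewrite lee_fin.
- exact/measurable_EFinP.
by rewrite gs; apply: lte_add_pinfty.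
Qed.

End kernel_bounds.

(** * Riesz potentials of bounded functions *)

Section riesz_potential.
Context {R : realType}.
Local Notation mu := (@lebesgue_measure R).
Implicit Types (a b c x y u r t T C : R) (f g : R -> R).

(** The beta-type constant in  kern a * kern a = riesz_cst a . kern (2a - 1) *)
Definition riesz_cst a : R := fine (\int[mu]_y (kern a y * kern a (1 - y))%:E)%E.

Lemma riesz_cst_ge0 a : 0 <= riesz_cst a.
Proof.
by apply: fine_ge0; apply: integral_ge0 => x _; rewrite lee_fin mulr_ge0 ?kern_ge0.
Qed.

(** The scaling x = u + (r - u) y maps the integral to the one that defines
    the constant *)
Lemma kern_comp a u r : 2^-1 < a -> a < 1 -> u != r ->
  (\int[mu]_x (kern a (u - x) * kern a (r - x))%:E =
   (riesz_cst a * kern (2 * a - 1) (u - r))%:E)%E.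
Proof.
move=> ah a1; wlog ur : u r / u < r => [hw|_].
  move=> h; have [ur|ru] := ltP u r; first exact: hw.
  have {}ru : r < u by rewrite lt_neqAle eq_sym h.
  have -> : kern (2 * a - 1) (u - r) = kern (2 * a - 1) (r - u) by rewrite -kernN opprB.
  have ne : r != u by rewrite lt_eqF.
  apply: (etrans _ (hw r u ru ne)).
  by apply: eq_integral => x _; rewrite mulrC.
have l0 : 0 < r - u by rewrite subr_gt0.
have mk z : measurable_fun setT (fun x : R => kern a (z - x)).
  by apply: (measurableT_comp (@measurable_kern R a)); exact: measurable_funB.
have m1 : measurable_fun setT (fun x : R => kern a (u - x) * kern a (r - x)).
  by apply: measurable_funM; exact: mk.
have m2 : measurable_fun setT (fun x : R => kern a (u - (x + u)) * kern a (r - (x + u))).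
  by apply: (measurableT_comp m1); exact: measurable_funD.
rewrite -(ge0_integral_shift u (f := fun x => (kern a (u - x) * kern a (r - x))%:E)); last 2 first.
- exact/measurable_EFinP.
- by move=> x; rewrite lee_fin mulr_ge0 ?kern_ge0.
rewrite -(@ge0_integral_scale _ (r - u)
  (fun x => (kern a (u - (x + u)) * kern a (r - (x + u)))%:E))//; last 2 first.
- exact/measurable_EFinP.
- by move=> x; rewrite lee_fin mulr_ge0 ?kern_ge0.
have E y : kern a (u - ((r - u) * y + u)) * kern a (r - ((r - u) * y + u)) =
    kern (2 * a) (u - r) * (kern a y * kern a (1 - y)).
  have -> : u - ((r - u) * y + u) = (u - r) * y by ring.
  have -> : r - ((r - u) * y + u) = (r - u) * (1 - y) by ring.
  rewrite !kern_mul -[r - u]opprB kernN mulrACA (_ : 2 * a = a + a); last by ring.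
  by rewrite kernD// subr_eq0 lt_eqF.
under eq_integral do rewrite E EFinM.
rewrite ge0_integralZl//; last 3 first.
- apply/measurable_EFinP; apply: measurable_funM; first exact: measurable_kern.
  exact: mk.
- by move=> x _; rewrite lee_fin mulr_ge0 ?kern_ge0.
- by rewrite lee_fin kern_ge0.
rewrite -(@fineK _ (\int[mu]_x _)%E); last first.
  rewrite ge0_fin_numE ?kern_conv_fin//.
  by apply: integral_ge0 => x _; rewrite lee_fin mulr_ge0 ?kern_ge0.
rewrite -/(riesz_cst a) -!EFinM; congr EFin.
have -> : kern (2 * a - 1) (u - r) = kern (2 * a) (u - r) * (r - u).
  rewrite kernD ?subr_eq0 ?lt_eqF//; congr (_ * _).
  by rewrite /kern powR_inv1 ?invrK// distrC gtr0_norm.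
by ring.
Qed.

(** The constant C is kept apart, since all the bounds below are linear in it *)
Definition windowed T C f : Prop :=
  measurable_fun setT f /\ forall x, `|f x| <= C * \1_(`[0, T]) x.

Definition potential b f x : R := \int[mu]_u (f u * kern b (u - x)).

Lemma windowed_intg T C f : windowed T C f -> intg mu f.
Proof.
move=> [mf fC]; have h : intg mu (fun x => C * \1_(`[0, T]) x).
  by apply: intgZ; exact: integrable_indic_itv.
by apply: (intg_le _ _ h).
Qed.

Lemma windowed_Rint T C f : 0 <= T -> 0 <= C -> windowed T C f ->
  \int[mu]_x `|f x| <= C * T.
Proof.
move=> T0 C0 hf; have [mf fC] := hf.
have h1 : intg mu (\1_(`[0, T]) : R -> R) by exact: integrable_indic_itv.
apply: (@le_trans _ _ (\int[mu]_x (C * \1_(`[0, T]) x))).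
  apply: le_Rintegral => //; first exact/intg_abs/(windowed_intg hf).
  exact: intgZ.
rewrite RintegralZl// ler_wpM2l// /Rintegral integral_indic// setIT.
have /= -> := @lebesgue_measure_itv R `[0, T].
by rewrite lte_fin; case: ltP => // h; rewrite oppr0 adde0.
Qed.

Lemma windowedD T C C' (k : R) f g : windowed T C f -> windowed T C' g ->
  windowed T (C + `|k| * C') (fun x => f x + k * g x).
Proof.
move=> [mf hf] [mg hg]; split; first by apply: measurable_funD => //; exact: measurable_funM.
move=> x; rewrite (le_trans (ler_normD _ _))// mulrDl lerD// normrM -mulrA.
by rewrite ler_wpM2l.
Qed.

Lemma potential_intg b T C f x : 0 <= b -> b < 1 -> 0 <= T -> windowed T C f ->
  intg mu (fun u => f u * kern b (u - x)).
Proof.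
move=> b0 b1 T0 [mf fC]; have [W _ hW] := kern_window b0 b1 T0.
have mk : measurable_fun setT (fun u : R => kern b (u - x)).
  by apply: (measurableT_comp (@measurable_kern R b)); exact: measurable_funB.
have m1 : measurable_fun setT (fun u : R => \1_(`[0, T]) u * kern b (u - x)).
  by apply: measurable_funM.
have h : intg mu (fun u => C * (\1_(`[0, T]) u * kern b (u - x))).
  apply: intgZ; apply/integrableP; split; first exact/measurable_EFinP.
  apply: (@le_lt_trans _ _ W%:E); last by rewrite ltry.
  rewrite (le_trans _ (hW x))// le_eqVlt; apply/orP; left; apply/eqP.
  by apply: eq_integral => u _ /=; rewrite ger0_norm// mulr_ge0 ?kern_ge0.
apply: (intg_le _ _ h) => [|u]; first exact: measurable_funM.
by rewrite normrM (ger0_norm (kern_ge0 _ _)) mulrA ler_wpM2r ?kern_ge0.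
Qed.

Lemma potential_bound b T : 0 <= b -> b < 1 -> 0 <= T ->
  exists2 W : R, 0 <= W & forall C f, 0 <= C -> windowed T C f ->
    forall x, `|potential b f x| <= C * W.
Proof.
move=> b0 b1 T0; have [W W0 hW] := kern_window b0 b1 T0.
exists W => // C f C0 hf x.
have w1 : windowed T 1 (\1_(`[0, T]) : R -> R).
  by split => // u; rewrite mul1r ger0_norm.
have i1 := potential_intg x b0 b1 T0 w1.
apply: (@le_trans _ _ (\int[mu]_u (C * (\1_(`[0, T]) u * kern b (u - x))))).
  apply: le_Rint_abs; [exact: potential_intg hf|exact: intgZ|move=> u].
  by rewrite normrM (ger0_norm (kern_ge0 _ _)) mulrA ler_wpM2r ?kern_ge0//; apply: hf.2.
rewrite RintegralZl// ler_wpM2l// -lee_fin fineK//.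
exact: integrable_fin_num i1.
Qed.

Lemma potentialD b T C C' (k : R) f g x : 0 <= b -> b < 1 -> 0 <= T ->
  windowed T C f -> windowed T C' g ->
  potential b (fun u => f u + k * g u) x = potential b f x + k * potential b g x.
Proof.
move=> b0 b1 T0 hf hg.
have i1 := potential_intg x b0 b1 T0 hf; have i2 := potential_intg x b0 b1 T0 hg.
rewrite /potential -RintegralZl// -RintegralD//; last exact: intgZ.
by apply: eq_Rintegral => u _; ring.
Qed.

Lemma measurable_potential b T C f : 0 <= b -> b < 1 -> 0 <= T -> 0 <= C ->
  windowed T C f -> measurable_fun setT (potential b f).
Proof.
move=> b0 b1 T0 C0 hf.
have w1 : windowed T 1 (\1_(`[0, T]) : R -> R).
  by split => // u; rewrite mul1r ger0_norm.
have pos C' g : (forall x, 0 <= g x) -> windowed T C' g ->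
    measurable_fun setT (potential b g).
  move=> g0 hg; have [mg _] := hg.
  have m2 : measurable_fun setT (fun z : R * R => g z.2 * kern b (z.2 - z.1)).
    apply: measurable_funM; first exact: (measurableT_comp mg).
    by apply: (measurableT_comp (@measurable_kern R b)); exact: measurable_funB.
  have m3 := @measurable_fun_fubini_tonelli_F _ _ _ _ R mu
    (fun z : measurableTypeR R * measurableTypeR R => (g z.2 * kern b (z.2 - z.1))%:E).
  have {}m3 : measurable_fun setT (fun x => \int[mu]_u (g u * kern b (u - x))%:E)%E.
    apply: m3; first exact/measurable_EFinP.
    by move=> z; rewrite lee_fin mulr_ge0 ?kern_ge0.
  exact: (measurableT_comp (fine_measurable measurableT) m3).
have -> : potential b f = fun x => potential b (fun u => f u + C * \1_(`[0, T]) u) x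
    - C * potential b (\1_(`[0, T])) x.
  by apply/funext => x; rewrite (potentialD C x b0 b1 T0 hf w1) addrK.
apply: measurable_funB; last first.
  by apply: measurable_funM => //; apply: (pos 1).
apply: (pos (C + `|C| * 1)); last exact: windowedD.
by move=> x; have := hf.2 x; rewrite ler_norml => /andP[h _]; rewrite addrC -lerBlDl sub0r.
Qed.

(** An increment of the kernel is bounded by a more singular kernel, which is
    still integrable when b + th < 1 *)
Lemma kern_hoelder b th x y : 0 < b -> b <= 1 -> 0 < th -> th <= 1 ->
  `|kern b x - kern b y| <=
  `|x - y| `^ th * (kern (b + th) x + kern (b + th) y).
Proof.
move=> b0 b1 th0 th1.
have k0 z : z = 0 :> R -> kern b z = 0.
  by move=> ->; rewrite /kern normr0 powR0 ?gt_eqF// invr0.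
wlog xy : x y / `|x| <= `|y| => [hw|].
  have [|/ltW h] := leP `|x| `|y|; first exact: hw.
  rewrite [`|kern b x - _|]distrC [`|x - y|]distrC [kern (b + th) x + _]addrC.
  exact: hw.
have [x0|x0] := eqVneq x 0.
  rewrite (k0 x x0) x0 !sub0r !normrN (ger0_norm (kern_ge0 _ _)).
  have [y0|y0] := eqVneq y 0.
    by rewrite (k0 y y0) mulr_ge0 ?powR_ge0// addr_ge0 ?kern_ge0.
  rewrite (kernD _ _ y0) mulrDr [X in _ + X]mulrCA.
  have -> : `|y| `^ th * kern th y = 1.
    by rewrite /kern divff// gt_eqF// powR_gt0// normr_gt0.
  by rewrite mulr1 lerDr mulr_ge0 ?powR_ge0 ?kern_ge0.
have p0 : 0 < `|x| by rewrite normr_gt0.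
have q0 : 0 < `|y| by exact: lt_le_trans p0 xy.
set p := `|x| in p0 xy *; set q := `|y| in q0 xy *.
have dq : q - p <= `|x - y|.
  by rewrite /p /q -[`|x - y|]distrC lerB_dist.
have pinv (z e : R) : 0 < z -> z^-1 `^ e = (z `^ e)^-1.
  move=> z0; apply: (@mulfI _ (z `^ e)); first by rewrite gt_eqF// powR_gt0.
  by rewrite -powRM ?invr_ge0 ?(ltW z0)// !divff ?powR1 ?gt_eqF// powR_gt0.
pose s := (q - p) / p; have s0 : 0 <= s by rewrite divr_ge0 ?subr_ge0// ltW.
have kE : kern b y = kern b x * (p / q) `^ b.
  rewrite /kern -/p -/q powRM ?invr_ge0 ?(ltW p0) ?(ltW q0)//.
  by rewrite mulKf ?gt_eqF ?powR_gt0// pinv.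
have pq1 : p / q <= 1 by rewrite ler_pdivrMr// mul1r.
have hs : 1 - (p / q) `^ b <= s `^ th.
  have h1 : 1 - (p / q) `^ b <= 1 by rewrite gerBl powR_ge0.
  have [s1|s1] := leP 1 s.
    by rewrite (le_trans h1)// -(powRr0 s) ler_powR// ltW.
  apply: (@le_trans _ _ s); last first.
    have [->|sn0] := eqVneq s 0; first exact: powR_ge0.
    by rewrite ger1_powR// (ltW s1) lt_neqAle eq_sym sn0 s0.
  have h2 : p / q <= (p / q) `^ b.
    by rewrite ger1_powR// ?pq1 ?divr_gt0.
  have h3 : 1 - p / q <= s.
    rewrite /s mulrBl divff ?gt_eqF//.
    rewrite lerBlDr -subr_ge0.
    have -> : q / p - 1 + p / q - 1 = (q - p) ^+ 2 / (p * q).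
      by field; rewrite !gt_eqF.
    by rewrite divr_ge0 ?sqr_ge0// mulr_ge0// ltW.
  by lra.
rewrite kE -{1}[kern b x]mulr1 -mulrBr normrM (ger0_norm (kern_ge0 _ _)).
rewrite ger0_norm; last by rewrite subr_ge0 -(powRr0 (p / q)) ger_powR ?divr_gt0//= ltW.
apply: (@le_trans _ _ (kern b x * s `^ th)); first by rewrite ler_wpM2l ?kern_ge0.
have -> : kern b x * s `^ th = (q - p) `^ th * kern (b + th) x.
  rewrite /s powRM ?invr_ge0 ?subr_ge0 ?(ltW p0)// pinv// kernD//.
  by rewrite [kern th x]/kern -/p; ring.
apply: ler_pM; rewrite ?powR_ge0 ?kern_ge0//; last by rewrite lerDl kern_ge0.
by rewrite ge0_ler_powR ?nnegrE ?(ltW th0) ?subr_ge0.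
Qed.

Lemma potential_hoelder b th T : 0 < b -> 0 < th -> b + th < 1 -> 0 <= T ->
  exists2 W : R, 0 <= W & forall C f, 0 <= C -> windowed T C f ->
    forall r t, `|potential b f r - potential b f t| <= C * W * `|r - t| `^ th.
Proof.
move=> b0 th0 bth T0.
have [|W W0 hW] := @potential_bound (b + th) T _ bth T0; first by rewrite ltW// addr_gt0.
exists (2 * W); first by rewrite mulr_ge0.
move=> C f C0 hf r t; have [mf fC] := hf.
have b1 : b < 1 by lra.
have bth0 : 0 <= b + th by lra.
have ha : windowed T C (fun x => `|f x|).
  by split => [|x]; [exact: measurableT_comp|rewrite normr_id].
have ir := potential_intg r (ltW b0) b1 T0 hf.
have it := potential_intg t (ltW b0) b1 T0 hf.
have jr := potential_intg r bth0 bth T0 ha.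
have jt := potential_intg t bth0 bth T0 ha.
rewrite /potential -RintegralB//.
apply: (@le_trans _ _ (\int[mu]_u (`|r - t| `^ th *
    (`|f u| * kern (b + th) (u - r) + `|f u| * kern (b + th) (u - t))))).
  apply: le_Rint_abs; [exact: intgB|by apply: intgZ; exact: intgD|move=> u].
  rewrite -mulrBr normrM -mulrDr mulrCA ler_wpM2l//.
  have := @kern_hoelder b th (u - r) (u - t) b0 (ltW b1) th0.
  have -> : u - r - (u - t) = - (r - t) by ring.
  by rewrite normrN; apply; lra.
rewrite RintegralZl//; last exact: intgD.
rewrite mulrC ler_wpM2r ?powR_ge0// RintegralD//.
have := hW C _ C0 ha r; have := hW C _ C0 ha t.
move=> /(le_trans (ler_norm _)) h1 /(le_trans (ler_norm _)) h2.
apply: (le_trans (lerD h2 h1)).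
by rewrite le_eqVlt; apply/orP; left; apply/eqP; ring.
Qed.

(** The potential of a function with small mass is small, uniformly in space:
    outside of the ball of radius h the kernel is at most h^{-b}, inside it is
    at most h^th times the more singular kernel of exponent b + th *)
Lemma potential_short b th T : 0 < b -> 0 < th -> b + th < 1 -> 0 <= T ->
  exists2 W : R, 0 <= W & forall C f h, 0 <= C -> windowed T C f ->
    0 < h -> h <= T -> \int[mu]_u `|f u| <= C * h ->
    forall x, `|potential b f x| <= C * W * h `^ th.
Proof.
move=> b0 th0 bth T0; have b1 : b < 1 by lra.
have bt0 : 0 <= b + th by lra.
have [W W0 hW] := potential_bound bt0 bth T0.
exists (T `^ (1 - b - th) + W); first by rewrite addr_ge0// powR_ge0.
move=> C f h C0 hf h0 hT fh x.
have hfa : windowed T C (fun u => `|f u|).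
  by split => [|u]; [apply: measurableT_comp => //; exact: hf.1|rewrite normr_id; exact: hf.2].
have ia := potential_intg x bt0 bth T0 hfa.
have i0 := intg_abs (windowed_intg hf).
have split_kern u : `|f u * kern b (u - x)| <=
    h `^ (- b) * `|f u| + h `^ th * (`|f u| * kern (b + th) (u - x)).
  rewrite normrM (ger0_norm (kern_ge0 _ _)) mulrCA [_ `^ (- b) * _]mulrC -mulrDr ler_wpM2l//.
  have [->|ux] := eqVneq (u - x) 0.
    by rewrite /kern normr0 powR0 ?gt_eqF// invr0 addr_ge0// ?mulr_ge0 ?invr_ge0 ?powR_ge0.
  have y0 : 0 < `|u - x| by rewrite normr_gt0.
  have [hy|yh] := leP h `|u - x|.
    apply: ler_wpDr; first by rewrite mulr_ge0 ?powR_ge0 ?kern_ge0.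
    rewrite powRN lef_pV2 ?posrE ?powR_gt0//.
    by apply: ge0_ler_powR => //; rewrite ?nnegrE ltW.
  apply: ler_wpDl; first exact: powR_ge0.
  rewrite kernD// mulrCA ler_peMr ?kern_ge0// /kern ler_pdivlMr ?powR_gt0// mul1r.
  by apply: ge0_ler_powR; rewrite ?nnegrE ltW.
have ib := intgZ (h `^ (- b)) i0; have ic := intgZ (h `^ th) ia.
have := le_Rint_abs (potential_intg x (ltW b0) b1 T0 hf) (intgD ib ic) split_kern.
move=> /le_trans; apply.
rewrite RintegralD// RintegralZl// (RintegralZl _ measurableT ia).
have h1 := le_trans (ler_norm _) (hW C _ C0 hfa x).
apply: (le_trans (lerD (ler_wpM2l (powR_ge0 _ _) fh) (ler_wpM2l (powR_ge0 _ _) h1))).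
have -> : C * (T `^ (1 - b - th) + W) * h `^ th =
  C * (T `^ (1 - b - th) * h `^ th) + h `^ th * (C * W) by ring.
rewrite lerD2r mulrCA ler_wpM2l//.
have -> : h `^ (- b) * h = h `^ (1 - b - th) * h `^ th.
  rewrite -{2}(powRr1 (ltW h0)) -!powRD ?(gt_eqF h0) ?implybT//.
  by congr (_ `^ _); ring.
rewrite ler_wpM2r ?powR_ge0//.
by apply: ge0_ler_powR; rewrite ?nnegrE ?(ltW h0)//; lra.
Qed.

End riesz_potential.

(** * The fractional operator *)

Section riesz_composition.
Context {R : realType}.
Local Notation mu := (@lebesgue_measure R).
Implicit Types (x y u r t : R) (f g : R -> R).
Variables (a T : R).
Hypotheses (ah : 2^-1 < a) (a1 : a < 1) (T0 : 0 <= T).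

Let a0 : 0 <= a. Proof. by move: ah; lra. Qed.
Let c := 2 * a - 1.
Let c0 : 0 < c. Proof. by move: ah; rewrite /c; lra. Qed.
Let c1 : c < 1. Proof. by move: a1; rewrite /c; lra. Qed.

Let measurable_pair_kern (z : R) (f : R -> R) : measurable_fun setT f ->
  measurable_fun setT (fun p : R * R => f p.2 * kern a (p.2 - p.1) * kern a (z - p.1)).
Proof.
move=> mf; apply: measurable_funM; first apply: measurable_funM.
- exact: (measurableT_comp mf).
- by apply: (measurableT_comp (@measurable_kern R a)); exact: measurable_funB.
- apply: (measurableT_comp (@measurable_kern R a)).
  by apply: measurable_funB => //; exact: measurable_fst.
Qed.

(** Fubini's theorem and the composition rule of the kernels, which fails only
    at the point u = r *)
Lemma potential_comp (C : R) f r : windowed T C f ->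
  intg mu (fun x => potential a f x * kern a (r - x)) /\
  \int[mu]_x (potential a f x * kern a (r - x)) = riesz_cst a * potential c f r.
Proof.
move=> hf; have [mf fC] := hf.
pose F (p : measurableTypeR R * measurableTypeR R) : \bar R :=
  (f p.2 * kern a (p.2 - p.1) * kern a (r - p.1))%:E.
have mF : measurable_fun setT F.
  by apply/measurable_EFinP; exact: measurable_pair_kern.
have hc : intg mu (fun u => riesz_cst a * (f u * kern c (u - r))).
  by apply: intgZ; exact: (potential_intg _ (ltW c0) c1 T0 hf).
have ae_r (f1 f2 : R -> \bar R) : (forall u, u != r -> f1 u = f2 u) -> ae_eq mu setT f1 f2.
  move=> h; exists [set r]; split => //; first exact: lebesgue_measure_set1.
  move=> u /= nu; apply: contrapT => /eqP ur; apply: nu => _; exact: h.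
have mkr : measurable_fun setT (fun x : R => kern a (r - x)).
  by apply: (measurableT_comp (@measurable_kern R a)); exact: measurable_funB.
have mkk u : measurable_fun setT (fun x : R => kern a (u - x) * kern a (r - x)).
  apply: measurable_funM => //.
  by apply: (measurableT_comp (@measurable_kern R a)); exact: measurable_funB.
have inner u : u != r -> (\int[mu]_x `|F (x, u)| = `|(riesz_cst a * (f u * kern c (u - r)))%:E|)%E.
  move=> ur; rewrite /F/=.
  have E x : `|f u * kern a (u - x) * kern a (r - x)| = `|f u| * (kern a (u - x) * kern a (r - x)).
    by rewrite -mulrA normrM; congr (_ * _); rewrite ger0_norm// mulr_ge0 ?kern_ge0.
  under eq_integral do rewrite E EFinM.
  rewrite ge0_integralZl//; last 2 first.
  - by apply/measurable_EFinP; exact: mkk.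
  - by move=> x _; rewrite lee_fin mulr_ge0 ?kern_ge0.
  rewrite kern_comp// -EFinM; congr EFin.
  rewrite !normrM (ger0_norm (riesz_cst_ge0 a)) (ger0_norm (kern_ge0 _ _)).
  by rewrite mulrCA.
have inner' u : u != r -> (\int[mu]_x F (x, u) = (riesz_cst a * (f u * kern c (u - r)))%:E)%E.
  move=> ur; rewrite /F/=.
  have ik : mu.-integrable setT (fun x => (kern a (u - x) * kern a (r - x))%:E).
    apply/integrableP; split; first by apply/measurable_EFinP; exact: mkk.
    rewrite (_ : (\int[mu]_x _)%E = (\int[mu]_x (kern a (u - x) * kern a (r - x))%:E)%E).
      by rewrite kern_comp// ltry.
    by apply: eq_integral => x _ /=; rewrite ger0_norm// mulr_ge0 ?kern_ge0.
  under eq_integral do rewrite -mulrA EFinM.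
  by rewrite integralZl// kern_comp// -EFinM mulrCA.
have iF : (mu \x mu)%E.-integrable setT F.
  have [_ h] := @integrable21ltyP _ _ _ _ R mu mu F mF; apply: h.
  rewrite (@ae_eq_integral _ _ _ mu setT (fun u => `|(riesz_cst a * (f u * kern c (u - r)))%:E|%E)).
  - by have /integrableP[] := hc.
  - by [].
  - have := @measurable_fun_fubini_tonelli_G _ _ _ _ R mu (abse \o F); apply => [|z]; last exact: abse_ge0.
    exact: (measurableT_comp (@abse_measurable R setT) mF).
  - by apply: measurableT_comp => //; exact: measurable_int hc.
  - exact: ae_r.
have innerx x : (\int[mu]_u F (x, u) = (potential a f x * kern a (r - x))%:E)%E.
  rewrite /F/=; have ip := potential_intg x a0 a1 T0 hf.
  under eq_integral do rewrite EFinM.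
  by rewrite integralZr// EFinM fineK//; exact: integrable_fin_num.
have i1 : intg mu (fun x => potential a f x * kern a (r - x)).
  have := integrable_fubini_F iF.
  by rewrite /fubini_F; under eq_fun do rewrite innerx.
split => //; rewrite /Rintegral.
under eq_integral do rewrite -innerx.
rewrite Fubini// (@ae_eq_integral _ _ _ mu setT (fun u => (riesz_cst a * (f u * kern c (u - r)))%:E)).
- have := RintegralZl (riesz_cst a) measurableT (potential_intg r (ltW c0) c1 T0 hf).
  by rewrite /Rintegral => ->.
- by [].
- by have := measurable_fubini_G iF.
- exact: measurable_int hc.
- exact: ae_r.
Qed.

Lemma potential_inner (C C' : R) f g : 0 <= C -> 0 <= C' ->
  windowed T C f -> windowed T C' g ->
  intg mu (fun x => potential a f x * potential a g x) /\
  \int[mu]_x (potential a f x * potential a g x) =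
  riesz_cst a * \int[mu]_r (g r * potential c f r).
Proof.
move=> C0 C'0 hf hg; have [mf fC] := hf; have [mg gC] := hg.
have mpf := measurable_potential a0 a1 T0 C0 hf.
have [W W0 hW] := potential_bound (ltW c0) c1 T0.
have hfa : windowed T C (fun x => `|f x|).
  by split => [|x]; [exact: measurableT_comp|rewrite normr_id].
pose G (p : measurableTypeR R * measurableTypeR R) : \bar R :=
  (potential a f p.1 * (g p.2 * kern a (p.2 - p.1)))%:E.
have mG : measurable_fun setT G.
  apply/measurable_EFinP; apply: measurable_funM; first exact: (measurableT_comp mpf).
  apply: measurable_funM; first exact: (measurableT_comp mg).
  by apply: (measurableT_comp (@measurable_kern R a)); exact: measurable_funB.
have pfa x : `|potential a f x| <= potential a (fun u => `|f u|) x.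
  apply: le_Rint_abs.
  - exact: (potential_intg _ a0 a1 T0 hf).
  - exact: (potential_intg _ a0 a1 T0 hfa).
  - by move=> u; rewrite normrM (ger0_norm (kern_ge0 _ _)).
have iG : (mu \x mu)%E.-integrable setT G.
  have [_ h] := @integrable21ltyP _ _ _ _ R mu mu G mG; apply: h.
  pose K := riesz_cst a * (C * W).
  have hK : intg mu (fun r => K * `|g r|) by apply: intgZ; exact/intg_abs/(windowed_intg hg).
  have K0 : 0 <= K by rewrite mulr_ge0 ?riesz_cst_ge0// mulr_ge0.
  apply: (@le_lt_trans _ _ (\int[mu]_r (K * `|g r|)%:E)%E); last first.
    have /integrableP[_] := hK; apply: le_lt_trans.
    rewrite le_eqVlt; apply/orP; left; apply/eqP; apply: eq_integral => r _ /=.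
    by rewrite normrM normr_id (ger0_norm K0).
  apply: ge0_le_integral => //.
  - by move=> r _; exact: integral_ge0.
  - have := @measurable_fun_fubini_tonelli_G _ _ _ _ R mu (abse \o G); apply => [|z]; last exact: abse_ge0.
    exact: (measurableT_comp (@abse_measurable R setT) mG).
  - exact: measurable_int hK.
  move=> r _; rewrite /G/=.
  have [i1 e1] := potential_comp r hfa.
  have mkr : measurable_fun setT (fun x : R => kern a (r - x)).
    by apply: (measurableT_comp (@measurable_kern R a)); exact: measurable_funB.
  have mpfa := measurable_potential a0 a1 T0 C0 hfa.
  have m1 : measurable_fun setT (fun x : R => potential a f x * (g r * kern a (r - x))).
    by apply: measurable_funM => //; exact: measurable_funM.
  have m1a : measurable_fun setT (fun x : R => `|potential a f x * (g r * kern a (r - x))|).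
    exact: measurableT_comp.
  have m2 : measurable_fun setT (fun x : R => `|g r| * (potential a (fun u => `|f u|) x * kern a (r - x))).
    by apply: measurable_funM => //; exact: measurable_funM.
  apply: (@le_trans _ _ (\int[mu]_x (`|g r| * (potential a (fun u => `|f u|) x * kern a (r - x)))%:E)%E).
    apply: ge0_le_integral => //.
    - by apply/measurable_EFinP; exact: m1a.
    - by apply/measurable_EFinP; exact: m2.
    move=> x _; rewrite lee_fin !normrM (ger0_norm (kern_ge0 _ _)) mulrCA.
    by rewrite ler_wpM2l// ler_wpM2r ?kern_ge0.
  under eq_integral do rewrite EFinM.
  rewrite integralZl// -(fineK (integrable_fin_num measurableT i1)).
  rewrite -/(Rintegral mu setT (fun x => potential a (fun u => `|f u|) x * kern a (r - x))) e1.
  rewrite -EFinM lee_fin [X in _ <= X]mulrC ler_wpM2l// /K ler_wpM2l ?riesz_cst_ge0//.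
  by rewrite (le_trans (ler_norm _))// hW.
have innerx x : (\int[mu]_r G (x, r) = (potential a f x * potential a g x)%:E)%E.
  rewrite /G/=; have ip := potential_intg x a0 a1 T0 hg.
  under eq_integral do rewrite EFinM.
  rewrite integralZl// EFinM; congr (_ * _)%E.
  by rewrite /potential /Rintegral fineK//; exact: integrable_fin_num ip.
have innerr r : (\int[mu]_x G (x, r) = (riesz_cst a * (g r * potential c f r))%:E)%E.
  rewrite /G/=; have [i1 e1] := potential_comp r hf.
  under eq_integral do rewrite mulrCA EFinM.
  rewrite integralZl// -(fineK (integrable_fin_num measurableT i1)).
  rewrite -/(Rintegral mu setT (fun x => potential a f x * kern a (r - x))) e1.
  by rewrite -EFinM mulrCA.
have mpc := measurable_potential (ltW c0) c1 T0 C0 hf.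
have igp : intg mu (fun r => g r * potential c f r).
  have h : intg mu (fun r => (C * W) * `|g r|) by apply: intgZ; exact/intg_abs/(windowed_intg hg).
  apply: (intg_le _ _ h) => [|r]; first exact: measurable_funM.
  by rewrite normrM mulrC ler_wpM2r// hW.
split.
  have := integrable_fubini_F iG.
  by rewrite /fubini_F; under eq_fun do rewrite innerx.
have E3 := RintegralZl (riesz_cst a) measurableT igp.
rewrite -[RHS]E3 /Rintegral.
under eq_integral do rewrite -innerx.
rewrite Fubini//; congr fine.
by apply: eq_integral => r _; rewrite innerr.
Qed.

End riesz_composition.

(** The operator M of fractional calculus is a Riesz potential, so its
    covariances are integrals against the kernel |u - r|^{2H - 2} *)
Section fractional_operator_inner.
Context {R : realType}.
Local Notation mu := (@lebesgue_measure R).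
Variables (H T : R).
Hypotheses (hH : 2^-1 < H < 1) (T0 : 0 <= T).

Let a := 3 / 2 - H.
Let ah : 2^-1 < a. Proof. by move: hH => /andP[]; rewrite /a; lra. Qed.
Let a1 : a < 1. Proof. by move: hH => /andP[]; rewrite /a; lra. Qed.

Lemma MopE C f : windowed T C f -> Mop H f = fun x => C_ H * potential a f x.
Proof.
move=> hf; apply/funext => x.
have ip : intg mu (fun u => f u * kern a (u - x)).
  by apply: (potential_intg x _ a1 T0 hf); move: ah; lra.
transitivity (C_ H * \int[mu]_y (f (y + x) * kern a (y + x - x))).
  apply: (congr1 (fun z => C_ H * z)); apply: eq_Rintegral => y _.
  by rewrite addrK addrC.
by rewrite (Rintegral_shift x ip).
Qed.

Lemma MopD C C' (k : R) f g : windowed T C f -> windowed T C' g ->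
  Mop H (fun x => f x + k * g x) = fun x => Mop H f x + k * Mop H g x.
Proof.
move=> hf hg; rewrite (MopE (windowedD k hf hg)) (MopE hf) (MopE hg).
apply/funext => x; rewrite (potentialD k x _ a1 T0 hf hg); last by move: ah; lra.
by ring.
Qed.

(** M is symmetric and M M = c I, where I is the potential of exponent
    2 - 2 H, so that G f = c I f *)
Lemma Mop_inner : exists (G : (R -> R) -> R -> R) (W th : R),
  [/\ 0 <= W /\ 0 < th,
   forall C C' f g, 0 <= C -> 0 <= C' -> windowed T C f -> windowed T C' g ->
     intg mu (fun r => g r * G f r) /\
     \int[mu]_x (Mop H f x * Mop H g x) = \int[mu]_r (g r * G f r),
   forall C f, 0 <= C -> windowed T C f -> forall r, `|G f r| <= C * W,
   forall C f, 0 <= C -> windowed T C f -> forall r t,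
     `|G f r - G f t| <= C * W * `|r - t| `^ th
   & forall C f h, 0 <= C -> windowed T C f -> 0 < h -> h <= T ->
     \int[mu]_u `|f u| <= C * h -> forall r, `|G f r| <= C * W * h `^ th].
Proof.
pose c := 2 * a - 1.
have c0 : 0 < c by move: ah; rewrite /c; lra.
have c1 : c < 1 by move: a1; rewrite /c; lra.
pose th := (1 - c) / 2; have th0 : 0 < th by rewrite /th; lra.
have [W W0 hW] := potential_bound (ltW c0) c1 T0.
have [|W' W'0 hW'] := @potential_hoelder R c th T c0 th0 _ T0; first by rewrite /th; lra.
have [|W'' W''0 hW''] := @potential_short R c th T c0 th0 _ T0; first by rewrite /th; lra.
pose k := C_ H ^+ 2 * riesz_cst a.
have k0 : 0 <= k by rewrite mulr_ge0 ?sqr_ge0 ?riesz_cst_ge0.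
exists (fun f r => k * potential c f r), (k * (W + W' + W'')), th; split.
- by rewrite mulr_ge0 ?addr_ge0.
- move=> C C' f g C0 C'0 hf hg; have [mg gC] := hg.
  have mp := measurable_potential (ltW c0) c1 T0 C0 hf.
  have i0 : intg mu (fun r => g r * potential c f r).
    have h : intg mu (fun r => (C * W) * `|g r|) by apply: intgZ; exact/intg_abs/(windowed_intg hg).
    apply: (intg_le _ _ h) => [|r]; first exact: measurable_funM.
    by rewrite normrM mulrC ler_wpM2r// hW.
  have e0 : (fun r => g r * (k * potential c f r)) = (fun r => k * (g r * potential c f r)).
    by apply/funext => r; rewrite mulrCA.
  split; first by rewrite e0; exact: (intgZ k i0).
  have [ipp epp] := potential_inner ah a1 T0 C0 C'0 hf hg.
  have E1 := RintegralZl k measurableT i0.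
  have E2 := RintegralZl (C_ H ^+ 2) measurableT ipp.
  have E3 : C_ H ^+ 2 * \int[mu]_x (potential a f x * potential a g x) =
      k * \int[mu]_r (g r * potential c f r).
    by rewrite /k -mulrA; apply: (congr1 (fun z => C_ H ^+ 2 * z)); exact: epp.
  rewrite (MopE hf) (MopE hg) e0.
  apply: (etrans _ (esym E1)); apply: (etrans _ E3); apply: (etrans _ E2).
  by apply: eq_Rintegral => x _; ring.
- move=> C f C0 hf r; rewrite normrM (ger0_norm k0) mulrCA ler_wpM2l//.
  by rewrite (le_trans (hW C f C0 hf r))// ler_wpM2l// -addrA lerDl addr_ge0.
- move=> C f C0 hf r t; rewrite -mulrBr normrM (ger0_norm k0).
  have -> : C * (k * (W + W' + W'')) * `|r - t| `^ th =
    k * (C * (W + W' + W'') * `|r - t| `^ th) by ring.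
  rewrite ler_wpM2l// (le_trans (hW' C f C0 hf r t))// ler_wpM2r ?powR_ge0//.
  by rewrite ler_wpM2l// addrAC lerDr addr_ge0.
- move=> C f h C0 hf h0 hT fh r; rewrite normrM (ger0_norm k0).
  have -> : C * (k * (W + W' + W'')) * h `^ th =
    k * (C * (W + W' + W'') * h `^ th) by ring.
  rewrite ler_wpM2l// (le_trans (hW'' C f h C0 hf h0 hT fh r))// ler_wpM2r ?powR_ge0//.
  by rewrite ler_wpM2l// lerDr addr_ge0.
Qed.

End fractional_operator_inner.

(** * Integrals against fractional Brownian motion *)

Section continuity_on_segment.
Context {R : realType} (V : normedModType R).
Implicit Types (b : R -> V) (T : R).

Definition continuous_on T b : Prop := forall t, 0 <= t <= T ->
  forall eta : R, 0 < eta -> exists2 del : R, 0 < del &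
    forall s, 0 <= s <= T -> `|s - t| < del -> `|b s - b t| < eta.

Lemma within_continuous_on T b :
  {within `[0, T], continuous b} <-> continuous_on T b.
Proof.
rewrite subspace_continuousP; split=> h t.
  move=> tT eta eta0; have : `[0, T]%classic t by rewrite /= in_itv.
  move=> /h /cvgrPdist_lt /(_ _ eta0); rewrite near_withinE.
  move=> /nbhs_ballP[del /= del0 hd]; exists del => // s sT st.
  rewrite distrC; apply: hd; last by rewrite /= in_itv.
  by rewrite /ball/= distrC.
rewrite /= in_itv/= => tT; apply/cvgrPdist_lt => eta eta0.
have [del del0 hd] := h t tT eta eta0.
rewrite near_withinE; apply/nbhs_ballP; exists del => //= s.
rewrite /ball/= => st; rewrite in_itv/= => sT.
by rewrite distrC; apply: hd => //; rewrite distrC.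
Qed.

(** Heine's theorem *)
Lemma continuous_on_unif T b : continuous_on T b ->
  forall eta : R, 0 < eta -> exists2 del : R, 0 < del &
    forall s t, 0 <= s <= T -> 0 <= t <= T -> `|s - t| <= del -> `|b s - b t| <= eta.
Proof.
move=> hb eta eta0.
have /compact_near_coveringP cov := @segment_compact R 0 T.
pose Q (del : R) (u : R) := 0 <= u <= T -> forall s, 0 <= s <= T ->
  `|s - u| < del -> `|b s - b u| <= eta.
have : \forall del \near 0^'+, `[0, T]%classic `<=` Q del.
  apply: cov => t /=; rewrite in_itv/= => tT.
  have eta20 : 0 < eta / 2 by rewrite divr_gt0.
  have [d d0 hd] := hb t tT _ eta20.
  exists (ball t (d / 2), [set x | 0 < x < d / 2]) => /=.
    split; first by apply: nbhsx_ballx; rewrite divr_gt0.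
    near=> x; rewrite /=; apply/andP; split; near: x.
      exact: nbhs_right_gt.
    by apply: nbhs_right_lt; rewrite divr_gt0.
  move=> [u x]/= [tu /andP[x0 xd]] uT s sT su; move: tu; rewrite /ball/= => tu.
  have -> : b s - b u = (b s - b t) - (b u - b t) by rewrite opprB addrA subrK.
  rewrite (le_trans (ler_normB _ _))// [leRHS](splitr eta) lerD// ltW// hd//.
    have -> : s - t = (s - u) + (u - t) by ring.
    rewrite (le_lt_trans (ler_normD _ _))// (splitr d) ltrD//.
      exact: lt_trans xd.
    by rewrite distrC.
  by rewrite distrC (lt_trans tu)// ltr_pdivrMr// ltr_pMr// ltr1n.
move=> /(filterI (nbhs_right_gt 0)) /filter_ex [d [/= d0 hd]].
exists (d / 2); first by rewrite divr_gt0.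
move=> s t sT tT st; apply: (hd t) => //.
by rewrite (le_lt_trans st)// ltr_pdivrMr// ltr_pMr// ltr1n.
Unshelve. all: by end_near. Qed.

End continuity_on_segment.

Section fbm_integrals.
Context {R : realType} d (Omega : measurableType d) (P : probability Omega R).
Variables (B BH : R -> {RV P >-> R}) (H T : R).
Hypotheses (hH : 2^-1 < H < 1) (T0 : 0 < T).
Hypotheses (hB : is_brownian_motion B) (hBH : is_fbm H B BH).
Local Notation leb := (@lebesgue_measure R).

(** f is bounded and supported in [0, T], so that M f is a Riesz potential and
    depends linearly on f *)
Definition fbm_integral (f : R -> R) (I : Omega -> R) : Prop :=
  (exists2 C, 0 <= C & windowed T C f) /\ wiener B (Mop H f) I.

Lemma fbm_integral_sqint f I : fbm_integral f I -> sqint P I.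
Proof. by move=> [_ []]. Qed.

Lemma fbm_integralD (k : R) f g I J : fbm_integral f I -> fbm_integral g J ->
  fbm_integral (fun u => f u + k * g u) (fun w => I w + k * J w).
Proof.
move=> [[C C0 hf] hI] [[C' C'0 hg] hJ]; split.
  exists (C + `|k| * C'); first by rewrite addr_ge0// mulr_ge0.
  exact: windowedD.
by rewrite (MopD hH (ltW T0) k hf hg); exact: wienerD.
Qed.

Lemma fbm_integral0 : fbm_integral (fun=> 0) (fun=> 0).
Proof.
split; first by exists 0 => //; split => // x; rewrite normr0 mul0r.
have w0 : windowed T 0 (fun=> 0 : R) by split => // x; rewrite normr0 mul0r.
have -> : Mop H (fun=> 0) = (fun=> 0 : R).
  apply/funext => x; rewrite (MopE hH (ltW T0) w0) /potential.
  under eq_Rintegral do rewrite mul0r.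
  by rewrite Rintegral_cst// mul0r mulr0.
exact: wiener0.
Qed.

Lemma fbm_integralB f g I J : fbm_integral f I -> fbm_integral g J ->
  fbm_integral (fun u => f u - g u) (fun w => I w - J w).
Proof.
move=> hf hg; have := fbm_integralD (-1) hf hg.
under eq_fun do rewrite mulN1r.
by under [X in fbm_integral _ X]eq_fun do rewrite mulN1r.
Qed.

Lemma windowed_indic t : t <= T -> windowed T 1 (\1_(`[0, t]) : R -> R).
Proof.
move=> tT; split => [|u]; first exact: measurable_indic.
rewrite mul1r ger0_norm// !indicE !mem_setE !in_itv/=.
by case: (leP 0 u) => //= _; case: (leP u t) => // ut; rewrite (le_trans ut tT).
Qed.

Lemma fbm_integral_indic t : 0 <= t <= T -> fbm_integral (\1_(`[0, t])) (BH t).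
Proof.
move=> /andP[t0 tT]; split; first by exists 1 => //; exact: windowed_indic.
exact: (wiener_def hB (fbm_def hBH t0)).
Qed.

Lemma fbm_integral_def f (t : R) (I : {RV P >-> R}) (C : R) : 0 <= C ->
  windowed T C (fun u => f u * \1_(`[0, t]) u) -> is_fbm_integral H B f t I ->
  fbm_integral (fun u => f u * \1_(`[0, t]) u) I.
Proof. by move=> C0 hf hI; split; [exists C|exact: wiener_def]. Qed.

(** comb s is the integral of the step function comb_fun s *)
Definition comb (s : seq (R * R)) (w : Omega) : R := \sum_(p <- s) p.1 * BH p.2 w.

Definition comb_fun (s : seq (R * R)) (u : R) : R :=
  \sum_(p <- s) p.1 * \1_(`[0, p.2]) u.

Definition times_in (s : seq (R * R)) : Prop := forall p, p \in s -> 0 <= p.2 <= T.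

Lemma fbm_integral_comb s : times_in s -> fbm_integral (comb_fun s) (comb s).
Proof.
rewrite /comb_fun /comb; elim: s => [|p s ih] hs.
  under eq_fun do rewrite big_nil.
  by under [X in fbm_integral _ X]eq_fun do rewrite big_nil; exact: fbm_integral0.
under eq_fun do rewrite big_cons addrC.
under [X in fbm_integral _ X]eq_fun do rewrite big_cons addrC.
apply: fbm_integralD; first by apply: ih => q qs; apply: hs; rewrite inE qs orbT.
by apply: fbm_integral_indic; apply: hs; rewrite mem_head.
Qed.

(** L^2-limits of linear combinations of the values of the process: their
    independence of Z follows from that of the process, whereas the dependence
    between Z and the driving Brownian motion is arbitrary *)
Definition bh_limit (I : Omega -> R) : Prop := sqint P I /\
  forall e, 0 < e -> exists s, times_in s /\ nrm2 P (fun w => comb s w - I w) <= e.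

Lemma bh_limitD (k : R) I J : bh_limit I -> bh_limit J ->
  bh_limit (fun w => I w + k * J w).
Proof.
move=> [sI hI] [sJ hJ]; split; first by apply: sqintD => //; exact: sqintZ.
move=> e e0; have c0 : 0 < 1 + `|k| by rewrite ltr_pwDl.
have e1 : 0 < e / (1 + `|k|) by rewrite divr_gt0.
have [s [hs s1]] := hI _ e1; have [s' [hs' s1']] := hJ _ e1.
pose sc := [seq (k * p.1, p.2) | p <- s'].
exists (s ++ sc); split.
  by move=> p; rewrite mem_cat => /orP[/hs//|/mapP[q /hs' + ->]].
have combE w : comb (s ++ sc) w = comb s w + k * comb s' w.
  rewrite /comb big_cat/= big_map mulr_sumr; congr (_ + _).
  by apply: eq_bigr => p _; rewrite mulrA.
have -> : (fun w => comb (s ++ sc) w - (I w + k * J w)) =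
    (fun w => (comb s w - I w) + k * (comb s' w - J w)).
  by apply/funext => w; rewrite combE; ring.
have sc1 := fbm_integral_sqint (fbm_integral_comb hs).
have sc2 := fbm_integral_sqint (fbm_integral_comb hs').
apply: (le_trans (nrm2D (sqintB sc1 sI) (sqintZ k (sqintB sc2 sJ)))).
rewrite nrm2Z; last exact: sqintB.
apply: (le_trans (lerD s1 (ler_wpM2l (normr_ge0 _) s1'))).
by rewrite -[X in X + _]mul1r -mulrDl mulrC divfK// gt_eqF.
Qed.

Lemma bh_limitB I J : bh_limit I -> bh_limit J -> bh_limit (fun w => I w - J w).
Proof.
move=> hI hJ; have := bh_limitD (-1) hI hJ.
by under eq_fun do rewrite mulN1r.
Qed.

(** Riemann sums: the integral of a continuous function belongs to the closed
    span of the fractional Brownian motion *)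
Lemma fbm_integral_limit (b : R -> R^o) t I : continuous_on T b -> 0 <= t <= T ->
  fbm_integral (fun u => b u * \1_(`[0, t]) u) I -> bh_limit I.
Proof.
move=> hb /andP[t0 tT] hI; split; first exact: fbm_integral_sqint hI.
move=> e e0.
have [G [W [th [[W0 _] hG hW _ _]]]] := Mop_inner hH (ltW T0).
pose eta := e / (W * T + 1).
have WT : 0 <= W * T by rewrite mulr_ge0// ltW.
have eta0 : 0 < eta by rewrite divr_gt0// ltr_wpDl.
have [del del0 hdel] := continuous_on_unif hb eta0.
have [n hn] : exists n : nat, t / n.+1%:R <= del.
  have [n] := near_infty_natSinv_lt (PosNum (divr_gt0 del0 (ltr_wpDl t0 ltr01))).
  move=> _ /(_ n (leqnn n))/= hn; exists n.
  apply: (@le_trans _ _ ((t + 1) * n.+1%:R^-1)); first by rewrite ler_wpM2r// lerDl.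
  by rewrite mulrC -ler_pdivlMr ?ltr_wpDl// ltW.
pose s (k : nat) : R := t * (k%:R / n.+1%:R).
have s0 : s 0%N = 0 by rewrite /s mul0r mulr0.
have sn : s n.+1 = t by rewrite /s divff ?mulr1.
have smono i j : (i <= j)%N -> s i <= s j.
  by move=> ij; rewrite /s ler_wpM2l// ler_wpM2r// ler_nat.
have sS k : s k.+1 - s k = t / n.+1%:R.
  by rewrite /s -mulrBr -mulrBl -natrB// subSnn mul1r.
have s_in k : (k <= n.+1)%N -> 0 <= s k <= T.
  by move=> kn; rewrite -{1}s0 smono//= (le_trans _ tT)// -sn smono.
pose ps := (b 0, 0) :: flatten [seq [:: (b (s k), s k.+1); (- b (s k), s k)] | k <- iota 0 n.+1].
have psT : times_in ps.
  move=> p; rewrite inE => /orP[/eqP->/=|]; first by rewrite lexx ltW.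
  move=> /flattenP[q /mapP[k]]; rewrite mem_iota add0n => /andP[_ kn] ->.
  by rewrite !inE => /orP[|] /eqP -> /=; apply: s_in => //; exact: ltnW.
exists ps; split => //.
have psE u : comb_fun ps u = b 0 * \1_(`[0, 0]) u +
    \sum_(0 <= k < n.+1) b (s k) * (\1_(`[0, s k.+1]) u - \1_(`[0, s k]) u).
  rewrite /comb_fun big_cons; congr (_ + _).
  rewrite big_flatten big_map /index_iota subn0; apply: eq_bigr => k _.
  by rewrite !big_cons big_nil /= addr0 mulNr mulrBr.
pose f u := comb_fun ps u - b u * \1_(`[0, t]) u.
have hf : fbm_integral f (fun w => comb ps w - I w).
  by apply: fbm_integralB => //; exact: fbm_integral_comb.
have fw : windowed T eta f.
  have [[C _ [mf _]] _] := hf; split => // u; rewrite /f psE.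
  have ind0 (x : R) : x \in `[0, x] = (0 <= x) by rewrite in_itv/= lexx andbT.
  have telE : \1_(`[0, t]) u = \1_(`[0, 0]) u +
      \sum_(0 <= k < n.+1) (\1_(`[0, s k.+1]) u - \1_(`[0, s k]) u) :> R.
    by rewrite (telescope_sumr (fun k => \1_(`[0, s k]) u : R))// sn s0 addrC subrK.
  rewrite {1}telE mulrDr mulr_sumr.
  have -> : b 0 * \1_(`[0, 0]) u + \sum_(0 <= k < n.+1)
        b (s k) * (\1_(`[0, s k.+1]) u - \1_(`[0, s k]) u) -
      (b u * \1_(`[0, 0]) u + \sum_(0 <= k < n.+1)
        b u * (\1_(`[0, s k.+1]) u - \1_(`[0, s k]) u)) =
      (b 0 - b u) * \1_(`[0, 0]) u + \sum_(0 <= k < n.+1)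
        (b (s k) - b u) * (\1_(`[0, s k.+1]) u - \1_(`[0, s k]) u).
    under [X in _ = _ + X]eq_bigr do rewrite mulrBl.
    by rewrite sumrB mulrBl; ring.
  have -> : (b 0 - b u) * \1_(`[0, 0]) u = 0.
    rewrite indicE mem_setE in_itv/=; case: (boolP (0 <= u <= 0)) => [/andP[u0 u0']|_].
      by rewrite (_ : u = 0) ?subrr ?mul0r//; apply/eqP; rewrite eq_le u0 u0'.
    by rewrite mulr0.
  rewrite add0r (le_trans (ler_norm_sum _ _ _))//.
  have i0 (x y : R) : x <= y -> 0 <= \1_(`[0, y]) u - \1_(`[0, x]) u :> R.
    move=> xy; rewrite subr_ge0 !indicE !mem_setE !in_itv/=.
    by case: (leP 0 u) => //= _; case: (leP u x) => // ux; rewrite (le_trans ux xy).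
  apply: (@le_trans _ _ (\sum_(0 <= k < n.+1) eta * (\1_(`[0, s k.+1]) u - \1_(`[0, s k]) u))).
    rewrite !big_nat; apply: ler_sum => k /andP[_ kn].
    rewrite normrM (ger0_norm (i0 _ _ (smono _ _ (leqnSn k)))).
    rewrite !indicE !mem_setE !in_itv/=.
    case: (leP 0 u) => /= u0; last by rewrite subrr !mulr0.
    have [usk|usk] := leP u (s k).
      by rewrite (le_trans usk (smono _ _ (leqnSn k))) subrr !mulr0.
    have [usk1|] := leP u (s k.+1); last by rewrite subrr !mulr0.
    rewrite subr0 !mulr1; apply: hdel; first exact/s_in/ltnW.
      by rewrite u0 (le_trans usk1)//; have /andP[] := s_in _ kn.
    rewrite distrC ger0_norm ?subr_ge0 ?(ltW usk)// (le_trans _ hn)// -(sS k).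
    by rewrite lerD2r.
  rewrite -mulr_sumr (telescope_sumr (fun k => \1_(`[0, s k]) u : R))// sn s0.
  rewrite ler_wpM2l ?(ltW eta0)// (@le_trans _ _ (\1_(`[0, t]) u))//.
    by rewrite gerBl.
  have := (windowed_indic tT).2 u; rewrite mul1r; apply: le_trans; exact: ler_norm.
have [_ wf] := hf.
have [igf ef] := hG _ _ _ _ (ltW eta0) (ltW eta0) fw fw.
rewrite -ler_sqr ?nnegrE ?nrm2_ge0 ?(ltW e0)// nrm2K.
under eq_Rintegral do rewrite expr2.
rewrite (wiener_isometry hB wf wf) ef.
apply: (@le_trans _ _ (eta ^+ 2 * (W * T))).
  apply: (le_trans (ler_norm _)).
  have igb : intg leb (fun r => (eta * W) * `|f r|).
    by apply: intgZ; exact/intg_abs/(windowed_intg fw).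
  apply: (le_trans (le_Rint_abs igf igb _)).
    by move=> r; rewrite normrM mulrC ler_wpM2r// hW// ltW.
  rewrite RintegralZl//; last exact/intg_abs/(windowed_intg fw).
  have := windowed_Rint (ltW T0) (ltW eta0) fw => hR.
  apply: (le_trans (ler_wpM2l _ hR)); first by rewrite mulr_ge0// ltW.
  by rewrite le_eqVlt; apply/orP; left; apply/eqP; ring.
rewrite /eta expr_div_n -mulrA ler_piMr ?sqr_ge0//.
rewrite mulrC ler_pdivrMr ?exprn_gt0 ?ltr_wpDl// mul1r.
by rewrite expr2; nra.
Qed.

(** The correlation inequality for functions of Z as well: the process BH is
    independent of Z, and Z is frozen. This needs xi and S to be limits of
    combinations of values of BH *)
Lemma gauss_independent (Z : {RV P >-> R}) (m : nat) (F : R -> (nat -> R) -> R)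
    (C L : R) (xi : Omega -> R) (S : nat -> Omega -> R) :
  independent_RV_process Z `[0, T] BH ->
  (forall d' (X : measurableType d') (z : X -> R) (f : nat -> X -> R),
    measurable_fun setT z -> (forall i, measurable_fun setT (f i)) ->
    measurable_fun setT (fun x => F (z x) (fun i => f i x))) ->
  (forall z x, `|F z x| <= C) -> 0 <= L ->
  (forall z x y k, 0 <= k -> (forall i, (i < m)%N -> `|x i - y i| <= k) ->
     `|F z x - F z y| <= L * k) ->
  bh_limit xi -> (forall i, bh_limit (S i)) ->
  gauss_ineq P (fun w => F (Z w)) m L xi S.
Proof.
move=> hZ mF FC L0 FL [sxi hxi] hS.
have mPhi (f : nat -> Omega -> R) : (forall i, measurable_fun setT (f i)) ->
    measurable_fun setT (fun w => F (Z w) (fun i => f i w)).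
  by move=> hf; exact: mF.
apply: (gauss_closure mPhi (fun w => FC (Z w)) L0 (fun w => FL (Z w)) sxi).
  by move=> i; have [] := hS i.
move=> e e0; have [s [hs s1]] := hxi e e0.
have hi i : exists s', times_in s' /\ nrm2 P (fun w => comb s' w - S i w) <= e.
  by have [_ /(_ e e0)] := hS i.
have [S' hS'] := choice hi.
have si := fbm_integral_sqint (fbm_integral_comb hs).
have sS' i := fbm_integral_sqint (fbm_integral_comb (hS' i).1).
exists (comb s), (fun i => comb (S' i)); split => //.
  by move=> i; have [] := hS' i.
move=> K K0 hK.
(* on the events of BH the independence of Z is known *)
pose gen := [set E | exists2 t, `[0, T]%classic t &
   exists2 A : set R, measurable A & E = BH t @^-1` A].
have mgen E : <<s gen >> E -> measurable E.
  apply: smallest_sub; first exact: sigma_algebra_measurable.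
  by move=> _ [t _ [A mA ->]]; rewrite -[_ @^-1` _]setTI; exact: measurable_funP.
have mBH t : 0 <= t <= T ->
    measurable_fun setT (fun w : g_sigma_algebraType gen => BH t w).
  move=> tT _ A mA; rewrite setTI; apply: sub_gen_smallest.
  by exists t; [rewrite /= in_itv|exists A].
have mcomb q : times_in q -> measurable_fun setT (fun w : g_sigma_algebraType gen => comb q w).
  rewrite /comb; elim: q => [|p q ih] hq.
    by under eq_fun do rewrite big_nil; exact: measurable_cst.
  under eq_fun do rewrite big_cons; apply: measurable_funD.
    by apply: measurable_funM => //; apply: mBH; apply: hq; rewrite mem_head.
  by apply: ih => r rq; apply: hq; rewrite inE rq orbT.
pose f (z : R * g_sigma_algebraType gen) : R := comb s z.2 * F z.1 (fun i => comb (S' i) z.2).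
have mf : measurable_fun setT f.
  apply: measurable_funM; first exact: (measurableT_comp (mcomb _ hs)).
  apply: mF => // i; exact: (measurableT_comp (mcomb _ (hS' i).1)).
have iF (z : Omega -> R) : measurable_fun setT z ->
    intg P (fun w => comb s w * F (z w) (fun i => comb (S' i) w)).
  move=> mz; apply: sqintM => //; apply: (@sqint_bounded _ _ _ _ _ C) => //.
  by apply: mF => // i; have [] := sS' i.
have := @freeze_le_fst _ _ _ P _ R Z (distribution P Z) gen _ mgen _ hZ f mf.
apply => //.
- exact: iF.
- move=> y; have gi : gauss_ineq P (fun=> F y) m L (comb s) (fun i => comb (S' i)).
    apply: (wiener_gauss hB (fbm_integral_comb hs).2
      (fun i => (fbm_integral_comb (hS' i).1).2) _ (FC y) L0 (FL y)).
    by move=> d' X g mg; exact: mF.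
  exact: (gi K K0 hK).
- by move=> y; apply: (iF (fun=> y)).
Qed.

End fbm_integrals.

(** * Euler's scheme for an equation with additive noise *)

Section limits_of_integrals.
Context d (T : measurableType d) (R : realType) (mu : {measure set T -> \bar R}).

Lemma Rint_dominated (f_ : nat -> T -> R) (f g : T -> R) :
  (forall n, measurable_fun setT (f_ n)) -> measurable_fun setT f -> intg mu g ->
  {ae mu, forall x, f_ n x @[n --> \oo] --> f x} ->
  {ae mu, forall x, forall n, `|f_ n x| <= g x} ->
  intg mu f /\ \int[mu]_x f_ n x @[n --> \oo] --> \int[mu]_x f x.
Proof.
move=> mf_ mf ig fl fg.
have m1 n : measurable_fun setT (fun x => (f_ n x)%:E) by exact/measurable_EFinP.
have m2 : measurable_fun setT (fun x => (f x)%:E) by exact/measurable_EFinP.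
have l1 : {ae mu, forall x, setT x -> (f_ n x)%:E @[n --> \oo] --> (f x)%:E}.
  by apply: filterS fl => x h _; apply: cvg_EFin => //; exact: nearW.
have l2 : {ae mu, forall x, forall n, setT x -> (`|(f_ n x)%:E| <= (g x)%:E)%E}.
  by apply: filterS fg => x h n _; rewrite lee_fin.
have [int _ lim] := dominated_convergence measurableT m1 m2 l1 ig l2.
split => //; apply: fine_cvg; rewrite fineK//.
exact: integrable_fin_num int.
Qed.

End limits_of_integrals.

Section increments.
Context {R : realType}.
Local Notation leb := (@lebesgue_measure R).

Lemma continuous_on_intg (T : R) (a : R -> R^o) p q : continuous_on T a ->
  0 <= p -> q <= T -> leb.-integrable `[p, q] (EFin \o a).
Proof.
move=> ca p0 qT; apply: continuous_compact_integrable; first exact: segment_compact.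
have h := (within_continuous_on T a).2 ca; apply: continuous_subspaceW h.
by move=> x /=; rewrite !in_itv/= => /andP[px xq]; rewrite (le_trans p0)// (le_trans xq).
Qed.

Lemma integral_increment (T : R) (a : R -> R^o) p q (c eta : R) : continuous_on T a ->
  0 <= p -> p <= q -> q <= T -> (forall s, p <= s <= q -> `|a s - c| <= eta) ->
  `|\int[leb]_(s in `[0, q]) a s - \int[leb]_(s in `[0, p]) a s - (q - p) * c|
   <= eta * (q - p).
Proof.
move=> ca p0 pq qT ac.
have i0q := continuous_on_intg ca (lexx 0) qT.
rewrite (Rintegral_itvB i0q) ?bnd_simp//.
have ipq := continuous_on_intg ca p0 qT.
rewrite Rintegral_itv_obnd_cbnd; last first.
  by apply: integrableS ipq => //; exact: subset_itv_oc_cc.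
have fin : fine (leb `[p, q]%classic) = q - p.
  have /= -> := @lebesgue_measure_itv R `[p, q].
  by rewrite lte_fin; case: ltP => // qp; rewrite (_ : q = p) ?subrr//; apply/eqP; rewrite eq_le qp pq.
have icst (k : R) : leb.-integrable `[p, q] (EFin \o (fun _ : R => k)).
  apply/integrableP; split; first exact/measurable_EFinP.
  under eq_integral do rewrite /=.
  rewrite integral_cst//.
  have /= -> := @lebesgue_measure_itv R `[p, q].
  by rewrite -EFinB; case: ifP => _; rewrite -?EFinM ?mule0 ltry.
have mpq : measurable (`[p, q]%classic : set (measurableTypeR R)).
  exact: measurable_itv.
have -> : (q - p) * c = \int[leb]_(s in `[p, q]) c.
  by rewrite Rintegral_cst// fin mulrC.
rewrite -(RintegralB mpq ipq (icst c)).
have -> : eta * (q - p) = \int[leb]_(s in `[p, q]) eta by rewrite Rintegral_cst// fin.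
have iB : leb.-integrable `[p, q] (EFin \o (fun s => a s - c)).
  exact: (integrableB mpq ipq (icst c)).
apply: (le_trans (le_normr_Rintegral mpq iB)).
apply: (le_Rintegral mpq); [|exact: (icst eta)|].
  have := integrable_norm iB; apply: eq_integrable => //.
by move=> s; rewrite /= in_itv/= => spq; exact: ac.
Qed.

Lemma integral_increment_abs (T : R) (a : R -> R^o) p q (c eta : R) : continuous_on T a ->
  0 <= p <= T -> 0 <= q <= T ->
  (forall s, 0 <= s <= T -> `|s - p| <= `|q - p| -> `|a s - c| <= eta) ->
  `|\int[leb]_(s in `[0, q]) a s - \int[leb]_(s in `[0, p]) a s - (q - p) * c|
   <= eta * `|q - p|.
Proof.
move=> ca /andP[p0 pT] /andP[q0 qT] hs; have [pq|qp] := leP p q.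
  rewrite (ger0_norm (x := q - p)) ?subr_ge0//.
  apply: (integral_increment ca p0 pq qT) => s /andP[ps sq]; apply: hs.
    by rewrite (le_trans p0 ps) (le_trans sq qT).
  by rewrite !ger0_norm ?subr_ge0 ?lerD2r.
rewrite (ltr0_norm (x := q - p)) ?subr_lt0// opprB -normrN.
have -> : forall x y : R, - (x - y - (q - p) * c) = y - x - (p - q) * c by move=> x y; ring.
apply: (integral_increment ca q0 (ltW qp) pT) => s /andP[qs sp]; apply: hs.
  by rewrite (le_trans q0 qs) (le_trans sp pT).
rewrite (ler0_norm (x := s - p)) ?subr_le0// (ltr0_norm (x := q - p)) ?subr_lt0//.
by rewrite !opprB lerD2l lerN2.
Qed.

End increments.

Section euler_scheme.
Context {R : realType}.

(** Euler's scheme for y' = a(s, y + g(s)) with step tau: the noise g is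
    additive, so that y + g approximates a solution driven by g *)
Fixpoint euler (tau : R) (a : nat -> R -> R) (z : R) (g : nat -> R) (k : nat) : R :=
  if k is k'.+1 then
    euler tau a z g k' + tau * a k' (euler tau a z g k' + g k')
  else z.

Variables (tau K : R) (a : nat -> R -> R) (n : nat).
Hypotheses (tau0 : 0 <= tau) (K0 : 0 <= K).
Hypothesis aL : forall k x y, (k < n)%N -> `|a k x - a k y| <= K * `|x - y|.

(** A perturbation of the noise of size e is transported with Gronwall's
    factor; adding e on the left makes the induction go through *)
Lemma euler_lipschitz z g g' (e : R) k : (k <= n)%N -> 0 <= e ->
  (forall i, (i < k)%N -> `|g i - g' i| <= e) ->
  `|euler tau a z g k - euler tau a z g' k| + e <= (1 + K * tau) ^+ k * e.
Proof.
move=> + e0; elim: k => [|k ih] kn ge; first by rewrite subrr normr0 add0r expr0 mul1r.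
have {}ih := ih (ltnW kn) (fun i ik => ge i (ltnW ik)).
rewrite /=; set E := euler tau a z g k in ih *; set E' := euler tau a z g' k in ih *.
have h : `|a k (E + g k) - a k (E' + g' k)| <= K * (`|E - E'| + e).
  rewrite (le_trans (aL _ _ kn))// ler_wpM2l//.
  have -> : E + g k - (E' + g' k) = (E - E') + (g k - g' k) by ring.
  by rewrite (le_trans (ler_normD _ _))// lerD2l ge.
have -> : E + tau * a k (E + g k) - (E' + tau * a k (E' + g' k)) =
   (E - E') + tau * (a k (E + g k) - a k (E' + g' k)) by ring.
have kt : 0 <= K * tau by rewrite mulr_ge0.
apply: (@le_trans _ _ ((1 + K * tau) * (`|E - E'| + e))); last first.
  by rewrite exprS -mulrA ler_wpM2l// addr_ge0.
have := ler_normD (E - E') (tau * (a k (E + g k) - a k (E' + g' k))).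
rewrite normrM (ger0_norm tau0).
by have := ler_wpM2l tau0 h; lra.
Qed.

(** Consistency of the scheme, I being the integral of the drift along the
    solution x, and discrete Gronwall *)
Lemma euler_error z g (x : nat -> R) (I : nat -> R) (eta : R) k : (k <= n)%N ->
  0 <= eta -> I 0%N = 0 -> (forall i, (i <= k)%N -> x i = z + I i + g i) ->
  (forall i, (i < k)%N -> `|I i.+1 - I i - tau * a i (x i)| <= eta * tau) ->
  `|euler tau a z g k + g k - x k| <= eta * (tau *+ k) * (1 + K * tau) ^+ k.
Proof.
move=> + eta0 I0; elim: k => [|k ih] kn hx hI.
  by rewrite /= hx// I0 addr0 subrr normr0 mulr0n mulr0 mul0r.
have {}ih := ih (ltnW kn) (fun i ik => hx i (leqW ik)) (fun i ik => hI i (leqW ik)).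
rewrite /=; set E := euler tau a z g k in ih *.
have kt : 0 <= K * tau by rewrite mulr_ge0.
have h1 := aL (E + g k) (x k) kn.
have h2 := hI k (ltnSn k).
have e1 : E + tau * a k (E + g k) + g k.+1 - x k.+1 =
   (E + g k - x k) + tau * (a k (E + g k) - a k (x k)) - (I k.+1 - I k - tau * a k (x k)).
  by rewrite (hx k)// (hx k.+1)//; ring.
rewrite e1 (le_trans (ler_normB _ _))//.
apply: (le_trans (lerD (ler_normD _ _) h2)).
rewrite normrM (ger0_norm tau0).
have {}h1 := le_trans h1 (ler_wpM2l K0 ih).
have {}h1 := ler_wpM2l tau0 h1.
apply: (le_trans (lerD (lerD ih h1) (lexx _))).
rewrite exprS mulrSr.
set w := (1 + K * tau) ^+ k; have w1 : 1 <= w by rewrite exprn_ege1// lerDl.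
have : eta * tau <= eta * tau * ((1 + K * tau) * w).
  rewrite ler_peMr ?mulr_ge0// -[X in X <= _]mulr1 ler_pM// lerDl//.
by lra.
Qed.

Lemma growth_exp k : (1 + K * tau) ^+ k <= expR (K * (tau *+ k)).
Proof.
rewrite -[tau *+ k]mulr_natl mulrCA expRM_natl lerXn2r ?nnegrE ?expR_ge0//.
  by rewrite addr_ge0// mulr_ge0.
exact: expR_ge1Dx.
Qed.

End euler_scheme.

(** * Correlations of the solution with the noise *)

Section equation_with_additive_noise.
Context {R : realType} d (Omega : measurableType d) (P : probability Omega R).
Variables (B BH : R -> {RV P >-> R}) (H T : R).
Hypotheses (hH : 2^-1 < H < 1) (T0 : 0 < T).
Hypotheses (hB : is_brownian_motion B) (hBH : is_fbm H B BH).
Variables (Z : {RV P >-> R}) (K : R) (al : R -> R -> R).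
Variables (G : R -> Omega -> R) (X : R -> {RV P >-> R}).
Hypotheses (hZ : independent_RV_process Z `[0, T] BH) (K0 : 0 <= K).
Hypothesis mal : forall s, 0 <= s <= T -> measurable_fun setT (al s).
Hypothesis alL : forall s x y, 0 <= s <= T -> `|al s x - al s y| <= K * `|x - y|.
Hypothesis hG : forall s, 0 <= s <= T -> bh_limit BH T (G s).
Hypothesis hXc : {ae P, forall w, continuous_on T (fun s => al s (X s w) : R^o)}.
Hypothesis hX : forall s, 0 <= s <= T -> {ae P, forall w,
  X s w = Z w + \int[lebesgue_measure]_(r in `[0, s]) al r (X r w) + G s w}.

(** The solution is a Lipschitz function of the path of the noise, and Euler's
    scheme approximates it by Lipschitz functions of finitely many values *)
Lemma solution_gauss (t : R) (psi : R -> R) (M : R) (xi : Omega -> R) (kap : R) :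
  0 <= t <= T -> measurable_fun setT psi -> (forall x, `|psi x| <= M) ->
  (forall x y, `|psi x - psi y| <= M * `|x - y|) -> bh_limit BH T xi -> 0 <= kap ->
  (forall s, 0 <= s <= T -> `|\int[P]_w (xi w * G s w)| <= kap) ->
  `|\int[P]_w (xi w * psi (X t w))| <= M * expR (K * t) * kap.
Proof.
move=> /andP[t0 tT] mpsi psiM psiL hxi kap0 hkap.
have M0 : 0 <= M by exact: le_trans (psiM 0).
pose s (n k : nat) : R := t * (k%:R / n.+1%:R).
have s0 n : s n 0%N = 0 by rewrite /s mul0r mulr0.
have sn n : s n n.+1 = t by rewrite /s divff ?mulr1.
have smono n i j : (i <= j)%N -> s n i <= s n j.
  by move=> ij; rewrite /s ler_wpM2l// ler_wpM2r// ler_nat.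
have sS n k : s n k.+1 - s n k = t / n.+1%:R.
  by rewrite /s -mulrBr -mulrBl -natrB// subSnn mul1r.
have s_in n k : (k <= n.+1)%N -> 0 <= s n k <= T.
  by move=> kn; rewrite -{1}(s0 n) smono//= (le_trans _ tT)// -(sn n) smono.
pose tau n := t / n.+1%:R : R.
have tau0 n : 0 <= tau n by rewrite divr_ge0.
have taun n : tau n *+ n.+1 = t by rewrite /tau -[LHS]mulr_natr divfK.
pose a n (k : nat) := al (s n k).
have aL n k x y : (k < n.+1)%N -> `|a n k x - a n k y| <= K * `|x - y|.
  by move=> kn; apply/alL/s_in/ltnW.
(* Euler's approximation of psi (X t) with n + 1 steps, as a function of Z and
   of the values of the noise on the grid *)
pose F n z (g : nat -> R) : R := psi (euler (tau n) (a n) z g n.+1 + g n.+1).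
pose S n i := G (s n (minn i n.+1)).
have mF n d' (U : measurableType d') (z : U -> R) (f : nat -> U -> R) :
    measurable_fun setT z -> (forall i, measurable_fun setT (f i)) ->
    measurable_fun setT (fun x => F n (z x) (fun i => f i x)).
  move=> mz mf; apply: (measurableT_comp mpsi); apply: measurable_funD => //.
  have : (n.+1 <= n.+1)%N by [].
  elim: {1 3}n.+1 => [//|k ih kn] /=; apply: measurable_funD; first exact/ih/ltnW.
  apply: measurable_funM => //; apply: (measurableT_comp (mal (s_in n k (ltnW kn)))).
  by apply: measurable_funD => //; exact/ih/ltnW.
have FL n z x y k : 0 <= k -> (forall i, (i < n.+2)%N -> `|x i - y i| <= k) ->
    `|F n z x - F n z y| <= M * expR (K * t) * k.
  move=> k0 hxy; rewrite (le_trans (psiL _ _))// -mulrA ler_wpM2l//.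
  have := @euler_lipschitz _ (tau n) K (a n) n.+1 (tau0 n) K0 (aL n) z x y k n.+1 (leqnn _) k0
    (fun i ik => hxy i (ltnW ik)).
  have := growth_exp (tau0 n) K0 n.+1; rewrite taun => g1 g2.
  have g3 := le_trans g2 (ler_wpM2r k0 g1).
  set E := euler _ _ _ _ _ in g2 g3 *; set E' := euler _ _ _ _ _ in g2 g3 *.
  have -> : E + x n.+1 - (E' + y n.+1) = (E - E') + (x n.+1 - y n.+1) by ring.
  rewrite (le_trans (ler_normD _ _))// (le_trans _ g3)// lerD2l.
  exact: hxy.
have hS n i : bh_limit BH T (S n i) by apply: hG; apply: s_in; exact: geq_minr.
have ineq n : `|\int[P]_w (xi w * F n (Z w) (fun i => S n i w))| <= M * expR (K * t) * kap.
  have FC z g : `|F n z g| <= M by exact: psiM.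
  have L0 : 0 <= M * expR (K * t) by rewrite mulr_ge0// expR_ge0.
  apply: (gauss_independent hH T0 hB hBH hZ (mF n) FC L0 (FL n) hxi (hS n) kap0).
  by move=> i _; apply/hkap/s_in; exact: geq_minr.
have good : {ae P, forall w, continuous_on T (fun s => al s (X s w) : R^o) /\
    forall n k, (k <= n.+1)%N -> X (s n k) w =
      Z w + \int[lebesgue_measure]_(r in `[0, s n k]) al r (X r w) + G (s n k) w}.
  apply: filterS2 hXc _; first by move=> w h1 h2; split; [exact: h1|exact: h2].
  apply: ae_foralln => n; apply: ae_foralln => k.
  have [kn|nk] := leqP k n.+1; last by apply: aeW.
  by have := hX (s_in n k kn); apply: filterS => w.
have [sxi _] := hxi; have mxi := sxi.1.
have mX : measurable_fun setT (X t) by [].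
have mfn n : measurable_fun setT (fun w => xi w * F n (Z w) (fun i => S n i w)).
  by apply: measurable_funM => //; apply: mF => // i; have [[]] := hS n i.
have mf : measurable_fun setT (fun w => xi w * psi (X t w)).
  by apply: measurable_funM => //; exact: (measurableT_comp mpsi).
have ig : intg P (fun w => M * `|xi w|) by exact/intgZ/intg_abs/sqint_intg.
have lim : {ae P, forall w, xi w * F n (Z w) (fun i => S n i w) @[n --> \oo] -->
    xi w * psi (X t w)}.
  move: good; apply: filterS => w [cw hw].
  apply: cvgMr; apply/cvgrPdist_le => e e0.
  pose Q := M * (t * expR (K * t)).
  have Q0 : 0 <= Q by rewrite !mulr_ge0 ?expR_ge0.
  have eta0 : 0 < e / (Q + 1) by rewrite divr_gt0// ltr_wpDl.
  have [del del0 hdel] := continuous_on_unif cw eta0.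
  have t1 : 0 < t + 1 by rewrite ltr_wpDl.
  near=> n.
  have hn : tau n <= del.
    apply: (@le_trans _ _ ((t + 1) * n.+1%:R^-1)); first by rewrite ler_wpM2r// lerDl.
    rewrite mulrC -ler_pdivlMr// ltW//; near: n.
    exact: (near_infty_natSinv_lt (PosNum (divr_gt0 del0 t1))).
  have := @euler_error _ (tau n) K (a n) n.+1 (tau0 n) K0 (aL n) (Z w) (fun i => S n i w)
    (fun i => X (s n i) w)
    (fun i => \int[lebesgue_measure]_(r in `[0, s n i]) al r (X r w)) (e / (Q + 1)) n.+1
    (leqnn _) (ltW eta0).
  have -> : `[0, s n 0%N]%classic = [set 0] by rewrite s0 set_itv1.
  rewrite Rintegral_set1 => /(_ erefl).
  have h1 i : (i <= n.+1)%N -> X (s n i) w = Z w +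
      \int[lebesgue_measure]_(r in `[0, s n i]) al r (X r w) + S n i w.
    by move=> i_n; rewrite /S (minn_idPl i_n); exact: hw.
  have h2 i : (i < n.+1)%N ->
      `|\int[lebesgue_measure]_(r in `[0, s n i.+1]) al r (X r w) -
        \int[lebesgue_measure]_(r in `[0, s n i]) al r (X r w) -
        tau n * a n i (X (s n i) w)| <= e / (Q + 1) * tau n.
    move=> i_n; rewrite -[tau n](sS n i).
    have /andP[si0 siT] := s_in n i (ltnW i_n).
    have /andP[_ si1T] := s_in n i.+1 i_n.
    apply: (integral_increment cw si0 (smono _ _ _ (leqnSn i)) si1T).
    move=> r /andP[r1 r2]; apply: hdel.
    - by rewrite (le_trans si0)// (le_trans r2).
    - by rewrite si0.
    - by rewrite ger0_norm ?subr_ge0// (le_trans _ hn)// -[tau n](sS n i) lerD2r.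
  move=> /(_ h1 h2); have := growth_exp (tau0 n) K0 n.+1; rewrite taun sn => g1 g2.
  rewrite distrC (le_trans (psiL _ _))//.
  have g3 : `|euler (tau n) (a n) (Z w) (fun i => S n i w) n.+1 + S n n.+1 w - X t w| <=
      e / (Q + 1) * t * expR (K * t).
    by rewrite (le_trans g2)// ler_wpM2l// mulr_ge0// ltW.
  apply: (le_trans (ler_wpM2l M0 g3)).
  have -> : M * (e / (Q + 1) * t * expR (K * t)) = e * (Q / (Q + 1)) by rewrite /Q; ring.
  by rewrite ler_piMr ?(ltW e0)// ler_pdivrMr ?mul1r ?lerDl// ltr_wpDl.
have dom : {ae P, forall w, forall n, `|xi w * F n (Z w) (fun i => S n i w)| <= M * `|xi w|}.
  by apply: aeW => w n; rewrite normrM mulrC ler_wpM2r// psiM.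
have cvgI := (Rint_dominated mfn mf ig lim dom).2.
apply/ler_addgt0Pr => e e0; move/cvgrPdist_le : cvgI => /(_ e e0) [n _ /(_ n (leqnn n)) /= h].
have := ineq n; move: h; set x := Rintegral _ _ _; set y := Rintegral _ _ _ => h hy.
have := ler_normD (x - y) y; rewrite subrK => h3.
by rewrite (le_trans h3)// addrC lerD.
Unshelve. all: by end_near. Qed.

End equation_with_additive_noise.

(** * Integrals against charges and the norm of measures *)

Section integrals_against_charges.
Context {R : realType}.
Implicit Types (m n : {charge set R -> \bar R}) (f : R -> R).
Implicit Types (p q : {measure set R -> \bar R}).

Lemma intg_finite_bounded p f (C : R) : fin_num_fun p -> measurable_fun setT f ->
  (forall x, `|f x| <= C) -> intg p f.
Proof.
move=> fp mf fC; have h : intg p (fun _ : R => C).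
  apply/integrableP; split; first exact/measurable_EFinP.
  by rewrite integral_cst// lte_mul_pinfty// ltey_eq fp.
exact: (intg_le mf fC h).
Qed.

Lemma fin_num_measure_add p q : fin_num_fun p -> fin_num_fun q ->
  fin_num_fun (measure_add p q).
Proof. by move=> fp fq A mA; rewrite measure_addE fin_numD fp// fq. Qed.

Lemma Rint_measure_add p q f (C : R) : fin_num_fun p -> fin_num_fun q ->
  measurable_fun setT f -> (forall x, `|f x| <= C) ->
  \int[measure_add p q]_x f x = \int[p]_x f x + \int[q]_x f x.
Proof.
move=> fp fq mf fC.
have ip := intg_finite_bounded fp mf fC; have iq := intg_finite_bounded fq mf fC.
rewrite /Rintegral (integral_measure_add measurableT ip iq).
by rewrite fineD//; exact: integrable_fin_num.
Qed.

Lemma Rint_mscale (k : {nonneg R}) p f (C : R) : fin_num_fun p ->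
  measurable_fun setT f -> (forall x, `|f x| <= C) ->
  \int[mscale k p]_x f x = k%:num * \int[p]_x f x.
Proof.
move=> fp mf fC; pose g x := f x + C.
have C0 : 0 <= C by exact: le_trans (fC 0).
have mg : measurable_fun setT g by exact: measurable_funD.
have g0 x : 0 <= g x by have := fC x; rewrite ler_norml /g => /andP[h _]; lra.
have fk : fin_num_fun (mscale k p) by move=> A mA; rewrite /mscale fin_numM// fp.
have gC x : `|g x| <= C + C.
  by rewrite (le_trans (ler_normD _ _))// (ger0_norm C0) lerD2r.
have cC (x : R) : `|C| <= C by rewrite ger0_norm.
have scale (h : R -> R) (D : R) : measurable_fun setT h -> (forall x, 0 <= h x) ->
    (forall x, `|h x| <= D) -> \int[mscale k p]_x h x = k%:num * \int[p]_x h x.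
  move=> mh h0 hD; have ih := intg_finite_bounded fp mh hD; rewrite /Rintegral ge0_integral_mscale//.
  - by rewrite fineM//; exact: integrable_fin_num.
  - exact/measurable_EFinP.
  - by move=> x _; rewrite lee_fin.
have E q : fin_num_fun q -> \int[q]_x f x = \int[q]_x g x - \int[q]_x C.
  move=> fq; rewrite -RintegralB//.
  - by apply: eq_Rintegral => x _; rewrite addrK.
  - exact: intg_finite_bounded gC.
  - exact: intg_finite_bounded cC.
by rewrite !E// (scale _ _ mg g0 gC) (scale (fun=> C) _ _ _ cC)// mulrBr.
Qed.

Lemma charge_integral_jordan m : exists p q : {measure set R -> \bar R},
  [/\ fin_num_fun p, fin_num_fun q,
   forall A, measurable A -> (m A = p A - q A)%E &
   forall f, charge_integral m f = \int[p]_x f x - \int[q]_x f x].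
Proof.
pose nuPN := projT2 (cid (projT2 (cid (Hahn_decomposition m)))).
exists (jordan_pos nuPN), (jordan_neg nuPN); split => //.
by move=> A mA /=; rewrite (jordan_decomp nuPN mA) /cadd/= cscaleN1.
Qed.

(** All decompositions of a charge as a difference of finite measures give the
    same integrals: if p - q = p' - q' then p + q' = p' + q *)
Lemma charge_integral_sub m p q f (C : R) : fin_num_fun p -> fin_num_fun q ->
  (forall A, measurable A -> (m A = p A - q A)%E) ->
  measurable_fun setT f -> (forall x, `|f x| <= C) ->
  charge_integral m f = \int[p]_x f x - \int[q]_x f x.
Proof.
move=> fp fq mpq mf fC; have [p' [q' [fp' fq' mpq' ->]]] := charge_integral_jordan m.
have E : \int[measure_add p q']_x f x = \int[measure_add p' q]_x f x.
  congr fine; apply: eq_measure_integral => A mA _.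
  rewrite [LHS](measure_addE p q') [RHS](measure_addE p' q).
  have := mpq A mA; rewrite mpq'//.
  rewrite -(fineK (fp _ mA)) -(fineK (fq _ mA)) -(fineK (fp' _ mA)) -(fineK (fq' _ mA)).
  by rewrite -!EFinB -!EFinD => -[h]; congr EFin; lra.
have := Rint_measure_add fp fq' mf fC; have := Rint_measure_add fp' fq mf fC.
by rewrite E => -> h; lra.
Qed.

Lemma charge_integralD m n f (C : R) : measurable_fun setT f ->
  (forall x, `|f x| <= C) ->
  charge_integral (cadd m n) f = charge_integral m f + charge_integral n f.
Proof.
move=> mf fC; have [p [q [fp fq mpq ->]]] := charge_integral_jordan m.
have [p' [q' [fp' fq' mpq' ->]]] := charge_integral_jordan n.
have fpp := fin_num_measure_add fp fp'; have fqq := fin_num_measure_add fq fq'.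
rewrite (charge_integral_sub fpp fqq _ mf fC).
  rewrite (Rint_measure_add fp fp' mf fC) (Rint_measure_add fq fq' mf fC).
  by ring.
move=> A mA.
transitivity (p A + p' A - (q A + q' A))%E; last first.
  by congr (_ - _)%E; rewrite [RHS]measure_addE.
transitivity (m A + n A)%E; first by [].
rewrite mpq// mpq'//.
rewrite -(fineK (fp _ mA)) -(fineK (fq _ mA)) -(fineK (fp' _ mA)) -(fineK (fq' _ mA)).
apply: (congr1 EFin (x := fine (p A) - fine (q A) + (fine (p' A) - fine (q' A)))
  (y := fine (p A) + fine (p' A) - (fine (q A) + fine (q' A)))).
by ring.
Qed.

Lemma charge_integralZ (k : R) m f (C : R) : measurable_fun setT f ->
  (forall x, `|f x| <= C) -> charge_integral (cscale k m) f = k * charge_integral m f.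
Proof.
move=> mf fC; have [p [q [fp fq mpq ->]]] := charge_integral_jordan m.
pose c : {nonneg R} := NngNum (normr_ge0 k).
have fcp : fin_num_fun (mscale c p) by move=> A mA; rewrite /mscale fin_numM// fp.
have fcq : fin_num_fun (mscale c q) by move=> A mA; rewrite /mscale fin_numM// fq.
have mE A : measurable A -> (cscale k m A = (k * (fine (p A) - fine (q A)))%:E)%E.
  move=> mA; rewrite /cscale/= mpq//.
  by rewrite -{1}(fineK (fp _ mA)) -{1}(fineK (fq _ mA)) -EFinB -EFinM.
have [k0|k0] := leP 0 k.
  rewrite (charge_integral_sub fcp fcq _ mf fC).
    by rewrite !(Rint_mscale _ _ mf fC)//= ger0_norm// mulrBr.
  move=> A mA; apply: (etrans (mE A mA)).
  transitivity (`|k|%:E * p A - `|k|%:E * q A)%E; last by [].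
  rewrite ger0_norm// -(fineK (fp _ mA)) -(fineK (fq _ mA)) -!EFinM.
  apply: (congr1 EFin (y := k * fine (p A) - k * fine (q A))).
  by rewrite /=; ring.
rewrite (charge_integral_sub fcq fcp _ mf fC).
  by rewrite !(Rint_mscale _ _ mf fC)//= ltr0_norm//; ring.
move=> A mA; apply: (etrans (mE A mA)).
transitivity (`|k|%:E * q A - `|k|%:E * p A)%E; last by [].
rewrite ltr0_norm// -(fineK (fp _ mA)) -(fineK (fq _ mA)) -!EFinM.
apply: (congr1 EFin (y := (- k) * fine (q A) - (- k) * fine (p A))).
by rewrite /=; ring.
Qed.

Lemma charge_integral_law d (T : measurableType d) (P : probability T R)
  (X : {RV P >-> R}) f (C : R) : measurable_fun setT f -> (forall x, `|f x| <= C) ->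
  charge_integral (law X) f = \int[P]_w f (X w).
Proof.
move=> mf fC; pose p := distribution P X.
have fp : fin_num_fun p by move=> A mA; exact: fin_num_measure.
have f0 : fin_num_fun (@mzero _ R R) by move=> A mA.
rewrite (@charge_integral_sub _ p mzero f C fp f0 _ mf fC); last first.
  by move=> A mA; rewrite sube0.
have -> : \int[mzero]_x f x = 0 by rewrite /Rintegral integral_measure_zero.
rewrite subr0 /Rintegral integral_distribution//; first exact/measurable_EFinP.
have mX : measurable_fun setT (fun w => f (X w)) by exact: measurableT_comp.
exact: (intg_bounded P mX (fun w => fC _)).
Qed.

End integrals_against_charges.

Section norm_of_measures.
Context {R : realType} (V : completeNormedModType R).
Variable emb : {charge set R -> \bar R} -> V.
Hypothesis hV : is_M0 emb.
Local Notation leb := (@lebesgue_measure R).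

Lemma gauss_weight : intg leb (fun y : R => (1 + y ^+ 2) ^+ 2 * expR (- y ^+ 2)).
Proof.
pose s : R := Num.sqrt 2^-1.
have s0 : 0 < s by rewrite sqrtr_gt0.
have s2 : s ^+ 2 = 2^-1 by rewrite sqr_sqrtr.
have m1 : measurable_fun setT (fun y : R => (1 + y ^+ 2) ^+ 2).
  by apply: measurable_funX; apply: measurable_funD => //; exact: measurable_funX.
have pk : normal_peak s != 0 by rewrite gt_eqF// normal_peak_gt0// gt_eqF.
have h : intg (normal_prob 0 s) (fun y => (1 + y ^+ 2) ^+ 2).
  apply: (@intg_normal_exp _ 2^-1 _ 2 16 _ m1) => [|y]; first by rewrite invr_gt0.
  have e0 := expR_gt0 (`|y| / 2); have e1 := expR_ge1Dx (`|y| / 2).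
  have -> : expR (2 * `|y|) = (expR (`|y| / 2) ^+ 2) ^+ 2.
    by rewrite -exprM -expRM_natl; congr expR; field.
  rewrite ger0_norm ?sqr_ge0// -[y ^+ 2]real_normK ?num_real//.
  have y0 := normr_ge0 y.
  have -> : (16 : R) = 4 ^+ 2 by ring.
  rewrite -exprMn lerXn2r ?nnegrE ?addr_ge0 ?mulr_ge0 ?sqr_ge0//.
  by nra.
have {}h := intgZ (normal_peak s)^-1 (intg_normal_density h).
apply: eq_integrable h => // y _ /=.
rewrite normal_pdfE ?gt_eqF// /normal_fun subr0 s2; congr EFin.
rewrite mulrCA mulKf//; congr (_ * expR _).
by rewrite -mulr_natr; field.
Qed.

(** A measure is controlled by its Fourier transform, with a polynomial loss
    that the Gaussian weight absorbs *)
Lemma M0_norm_le : exists2 C0 : R, 0 <= C0 & forall m (rho : R), 0 <= rho ->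
  (forall y, `|charge_integral m (fun x => cos (x * y))| <= rho * (1 + y ^+ 2)) ->
  (forall y, `|charge_integral m (fun x => sin (x * y))| <= rho * (1 + y ^+ 2)) ->
  `|emb m| <= C0 * rho.
Proof.
pose w (y : R) := (1 + y ^+ 2) ^+ 2 * expR (- y ^+ 2).
pose W := \int[leb]_y w y.
have w0 y : 0 <= w y by rewrite mulr_ge0 ?sqr_ge0 ?expR_ge0.
have W0 : 0 <= W by apply: Rintegral_ge0.
exists (Num.sqrt (2 * W)); first exact: sqrtr_ge0.
move=> m rho rho0 hc hs.
rewrite -ler_sqr ?nnegrE ?mulr_ge0 ?sqrtr_ge0// exprMn sqr_sqrtr ?mulr_ge0//.
rewrite -lee_fin (M0_emb_norm hV) /M0_sqnorm.
have iw := intgZ (2 * rho ^+ 2) gauss_weight.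
have -> : ((2 * W * rho ^+ 2)%:E = \int[leb]_y (2 * rho ^+ 2 * w y)%:E)%E.
  rewrite -[RHS]fineK; last exact: integrable_fin_num iw.
  congr EFin; rewrite mulrAC; apply: esym; exact: (RintegralZl _ measurableT gauss_weight).
have nn (z : complex.complex R) (y : R) :
    (0 <= (complex.ComplexField.Normc.normc z ^+ 2 * expR (- y ^+ 2))%:E)%E.
  by rewrite lee_fin mulr_ge0 ?sqr_ge0 ?expR_ge0.
rewrite ge0_integralTE//.
rewrite ge0_integralTE; last first.
  by move=> y; rewrite lee_fin (mulr_ge0 _ (w0 y))// mulr_ge0 ?sqr_ge0.
apply: ereal_sup_le => _ [h hh <-]; rewrite /=; exists h => // y; apply: (le_trans (hh y)).
rewrite lee_fin /w mulrA ler_wpM2r ?expR_ge0// /charge_fourier /=.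
rewrite sqr_sqrtr ?addr_ge0 ?sqr_ge0// sqrrN.
have q0 : 0 <= rho * (1 + y ^+ 2) by rewrite mulr_ge0// addr_ge0 ?sqr_ge0.
have sq (a : R) : `|a| <= rho * (1 + y ^+ 2) -> a ^+ 2 <= (rho * (1 + y ^+ 2)) ^+ 2.
  by move=> ha; rewrite -(real_normK (num_real a)) lerXn2r ?nnegrE.
have := lerD (sq _ (hc y)) (sq _ (hs y)).
by rewrite exprMn; lra.
Qed.

End norm_of_measures.

(** * Increments of the noise *)

Section noise.
Context {R : realType} d (Omega : measurableType d) (P : probability Omega R).
Variables (B : R -> {RV P >-> R}) (H T : R).
Hypotheses (hH : 2^-1 < H < 1) (T0 : 0 < T) (hB : is_brownian_motion B).
Variables (b : R -> R^o) (Cb : R) (G : R -> Omega -> R).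
Hypotheses (cb : continuous_on T b) (bC : forall t, 0 <= t <= T -> `|b t| <= Cb).
Hypothesis hG : forall t, 0 <= t <= T -> fbm_integral B H T (fun u => b u * \1_(`[0, t]) u) (G t).
Local Notation leb := (@lebesgue_measure R).

Let Cb0 : 0 <= Cb.
Proof. by apply: (le_trans (normr_ge0 (b 0)) (bC _)); rewrite lexx ltW. Qed.

Let ind_incr p q (u : R) : R := \1_(`[0, q]) u - \1_(`[0, p]) u.

Let ind_incr_ge0 p q u : p <= q -> 0 <= ind_incr p q u.
Proof.
move=> pq; rewrite subr_ge0 !indicE !mem_setE !in_itv/=.
by case: (leP 0 u) => //= _; case: (leP u p) => // up; rewrite (le_trans up pq).
Qed.

Let ind_incr_supp p q u : p <= q -> ~~ (p <= u <= q) -> ind_incr p q u = 0.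
Proof.
move=> pq; rewrite /ind_incr !indicE !mem_setE !in_itv/=.
case: (leP 0 u) => /= u0; last by rewrite subrr.
have [pu|up] := leP p u => /=; first by rewrite -ltNge => qu; rewrite !lt_geF ?subrr// (le_lt_trans pq).
by move=> _; rewrite (ltW up) (le_trans (ltW up) pq) subrr.
Qed.

Let ind_incr_intg p q : intg leb (ind_incr p q).
Proof. by apply: intgB; exact: integrable_indic_itv. Qed.

Let ind_incr_Rint p q : 0 <= p -> p <= q -> \int[leb]_u ind_incr p q u = q - p.
Proof.
move=> p0 pq; rewrite RintegralB//; [|exact: integrable_indic_itv|exact: integrable_indic_itv].
have E t : 0 <= t -> \int[leb]_u \1_(`[0, t]) u = t.
  move=> t0; rewrite /Rintegral integral_indic// setIT.
  have /= -> := @lebesgue_measure_itv R `[0, t].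
  by rewrite lte_fin; case: ltP => /= h; rewrite ?oppr0 ?addr0//; apply/eqP; rewrite eq_le h t0.
by rewrite !E// (le_trans p0).
Qed.

Let f p q (u : R) : R := b u * \1_(`[0, q]) u - b u * \1_(`[0, p]) u.

Let fE p q u : f p q u = b u * ind_incr p q u.
Proof. by rewrite /f mulrBr. Qed.

Let f_le p q u : 0 <= p -> p <= q -> q <= T -> `|f p q u| <= Cb * ind_incr p q u.
Proof.
move=> p0 pq qT; rewrite fE normrM (ger0_norm (ind_incr_ge0 u pq)).
have [/andP[pu uq]|h] := boolP (p <= u <= q).
  by rewrite ler_wpM2r ?ind_incr_ge0// bC// (le_trans p0)//= (le_trans uq).
by rewrite (ind_incr_supp pq h) !mulr0.
Qed.

Let g_windowed t : 0 <= t <= T -> windowed T Cb (fun u => b u * \1_(`[0, t]) u).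
Proof.
move=> tT; have [[C _ [mg _]] _] := hG tT; split => // u.
rewrite normrM !indicE !mem_setE !in_itv/=; case: (boolP (0 <= u <= t)) => [/andP[u0 ut]|_].
  have /andP[_ tT'] := tT; have uT : 0 <= u <= T by rewrite u0 (le_trans ut).
  by rewrite uT normr1 !mulr1 bC.
by rewrite normr0 mulr0 mulr_ge0// ler0n.
Qed.

Let f_windowed p q : 0 <= p -> p <= q -> q <= T -> windowed T Cb (f p q).
Proof.
move=> p0 pq qT.
have [mq _] := g_windowed (introT andP (conj (le_trans p0 pq) qT)).
have [mp _] := g_windowed (introT andP (conj p0 (le_trans pq qT))).
split; first exact: measurable_funB.
move=> u; apply: (le_trans (f_le u p0 pq qT)); rewrite ler_wpM2l//.
have := (windowed_indic qT).2 u; rewrite mul1r; apply: le_trans.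
rewrite ger0_norm; last by rewrite indicE ler0n.
by rewrite gerBl indicE ler0n.
Qed.

Let f_small p q : 0 <= p -> p <= q -> q <= T -> \int[leb]_u `|f p q u| <= Cb * (q - p).
Proof.
move=> p0 pq qT; rewrite -(ind_incr_Rint p0 pq) -RintegralZl//.
have fw := windowed_intg (f_windowed p0 pq qT).
apply: le_Rintegral => //; [exact: intg_abs|exact: intgZ|].
by move=> u _; exact: f_le.
Qed.

Let f_wiener p q : 0 <= p -> p <= q -> q <= T ->
  wiener B (Mop H (f p q)) (fun w => G q w - G p w).
Proof.
move=> p0 pq qT; have q0 := le_trans p0 pq; have pT := le_trans pq qT.
have hq : 0 <= q <= T by rewrite q0.
have hp : 0 <= p <= T by rewrite p0.
exact: (fbm_integralB hH T0 hB (hG hq) (hG hp)).2.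
Qed.

(** The integral of b over ]p, q] has covariance int_p^q b(u) k_s(u) du with
    G_s, where k_s, the image of b 1_[0,s] under the operator of Mop_inner, is
    bounded and Hoelder continuous uniformly in s. For the variance, k_s is
    replaced with the image of a function supported in ]p, q], which is small *)
Lemma noise_increments_le : exists (C th : R) (k : R -> R -> R), [/\ 0 <= C, 0 < th,
  forall s p q, 0 <= s <= T -> 0 <= p -> p <= q -> q <= T ->
    `|\int[P]_w (G s w * (G q w - G p w))| <= C * (q - p),
  forall p q, 0 <= p -> p <= q -> q <= T ->
    \int[P]_w ((G q w - G p w) ^+ 2) <= C * (q - p) * (q - p) `^ th
  & forall eta : R, 0 < eta -> exists2 del : R, 0 < del &
    forall s p q t, 0 <= s <= T -> 0 <= p -> p <= t -> t <= q -> q <= T -> q - p <= del ->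
      `|\int[P]_w (G s w * (G q w - G p w)) - (q - p) * k s t| <= eta * (q - p)].
Proof.
have [Gop [W [th [[W0 th0] hin hW hHol hshort]]]] := Mop_inner hH (ltW T0).
pose k s := Gop (fun u => b u * \1_(`[0, s]) u).
have inner s p q : 0 <= s <= T -> 0 <= p -> p <= q -> q <= T ->
    intg leb (fun r => f p q r * k s r) /\
    \int[P]_w (G s w * (G q w - G p w)) = \int[leb]_r (f p q r * k s r).
  move=> sT p0 pq qT; have [i e] := hin _ _ _ _ Cb0 Cb0 (g_windowed sT) (f_windowed p0 pq qT).
  by split => //; rewrite (wiener_isometry hB (hG sT).2 (f_wiener p0 pq qT)).
have kC s r : 0 <= s <= T -> `|k s r| <= Cb * W.
  by move=> sT; apply: hW => //; exact: g_windowed.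
have CW0 : 0 <= Cb * W by rewrite mulr_ge0.
have small p q D (g : R -> R) : 0 <= p -> p <= q -> q <= T -> 0 <= D -> (forall r, `|g r| <= D) ->
    intg leb (fun r => f p q r * g r) -> `|\int[leb]_r (f p q r * g r)| <= D * (Cb * (q - p)).
  move=> p0 pq qT D0 gD i; have ia := intg_abs (windowed_intg (f_windowed p0 pq qT)).
  have h r : `|f p q r * g r| <= D * `|f p q r| by rewrite normrM mulrC ler_wpM2r.
  apply: (le_trans (le_Rint_abs i (intgZ D ia) h)).
  by rewrite RintegralZl// ler_wpM2l// f_small.
exists (Cb * W * Cb), th, (fun s t => b t * k s t); split => //.
- by rewrite mulr_ge0.
- move=> s p q sT p0 pq qT; have [i ->] := inner s p q sT p0 pq qT.
  by rewrite -mulrA; apply: small => // r; exact: kC.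
- move=> p q p0 pq qT; have [<-|pnq] := eqVneq p q.
    rewrite subrr mulr0 mul0r; under eq_Rintegral do rewrite subrr expr0n.
    by rewrite Rintegral_cst// mul0r.
  have {}pq' : 0 < q - p by rewrite subr_gt0 lt_neqAle pnq.
  have fw := f_windowed p0 pq qT.
  have [i e] := hin _ _ _ _ Cb0 Cb0 fw fw.
  under eq_Rintegral do rewrite expr2.
  have wf := f_wiener p0 pq qT.
  rewrite (wiener_isometry hB wf wf) e; apply: (le_trans (ler_norm _)).
  have D0 : 0 <= Cb * W * (q - p) `^ th by rewrite mulr_ge0 ?powR_ge0.
  apply: (le_trans (small _ _ _ _ p0 pq qT D0 _ i)); last first.
    by rewrite le_eqVlt; apply/orP; left; apply/eqP; ring.
  apply: hshort => //; last exact: f_small.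
  by rewrite (le_trans _ qT)// gerBl.
move=> eta eta0; pose e1 := eta / (Cb * W * Cb + Cb * W + 1).
have den : 0 < Cb * W * Cb + Cb * W + 1 by rewrite ltr_wpDl ?addr_ge0 ?mulr_ge0.
have e10 : 0 < e1 by rewrite divr_gt0.
have [del del0 hdel] := continuous_on_unif cb e10.
exists (Num.min del (e1 `^ th^-1)); first by rewrite lt_min del0 powR_gt0.
move=> s p q t sT p0 pt tq qT; rewrite le_min => /andP[qpd qpe].
have pq := le_trans pt tq.
have tT : 0 <= t <= T by rewrite (le_trans p0 pt) (le_trans tq qT).
have [i ->] := inner s p q sT p0 pq qT.
have i2 := intgZ (b t * k s t : R) (ind_incr_intg p q).
have i0 := ind_incr_intg p q.
rewrite -(ind_incr_Rint p0 pq) [_ * (b t * _)]mulrC.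
rewrite -(RintegralZl (b t * k s t) measurableT i0) -(RintegralZl eta measurableT i0).
rewrite -(RintegralB measurableT i i2).
apply: le_Rint_abs; [exact: intgB|exact: intgZ|move=> u].
rewrite fE (_ : _ - _ = (b u * k s u - b t * k s t) * ind_incr p q u); last by ring.
rewrite normrM (ger0_norm (ind_incr_ge0 u pq)).
have [/andP[pu uq]|h] := boolP (p <= u <= q); last by rewrite (ind_incr_supp pq h) !mulr0.
rewrite ler_wpM2r ?ind_incr_ge0//.
have uT : 0 <= u <= T by rewrite (le_trans p0 pu) (le_trans uq qT).
have utd : `|u - t| <= q - p by rewrite ler_distl; apply/andP; split; lra.
have but := hdel u t uT tT (le_trans utd qpd).
have kut := hHol _ _ Cb0 (g_windowed sT) u t.
have pw : `|u - t| `^ th <= e1.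
  apply: (@le_trans _ _ ((e1 `^ th^-1) `^ th)).
    apply: ge0_ler_powR; rewrite ?nnegrE ?powR_ge0 ?(ltW th0)//.
    exact: le_trans utd qpe.
  by rewrite -powRrM mulVf ?gt_eqF// powRr1// ltW.
have -> : b u * k s u - b t * k s t = b u * (k s u - k s t) + (b u - b t) * k s t by ring.
apply: (le_trans (ler_normD _ _)); rewrite !normrM.
have h1 : `|b u| * `|k s u - k s t| <= Cb * (Cb * W * e1).
  by apply: ler_pM => //; [exact: bC|apply: (le_trans kut); rewrite ler_wpM2l].
have h2 : `|b u - b t| * `|k s t| <= e1 * (Cb * W).
  by apply: ler_pM => //; exact: kC.
apply: (le_trans (lerD h1 h2)).
have -> : Cb * (Cb * W * e1) + e1 * (Cb * W) = eta * ((Cb * W * Cb + Cb * W) / (Cb * W * Cb + Cb * W + 1)).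
  by rewrite /e1; ring.
by rewrite ler_piMr ?(ltW eta0)// ler_pdivrMr// mul1r lerDl.
Qed.

(** The features of the noise that make the law differentiable, although the
    noise itself is not *)
Lemma noise_increments : exists (C th : R) (k : R -> R -> R), [/\ 0 <= C, 0 < th,
  forall s p q, 0 <= s <= T -> 0 <= p <= T -> 0 <= q <= T ->
    `|\int[P]_w (G s w * (G q w - G p w))| <= C * `|q - p|,
  forall p q, 0 <= p <= T -> 0 <= q <= T ->
    \int[P]_w ((G q w - G p w) ^+ 2) <= C * `|q - p| * `|q - p| `^ th
  & forall eta : R, 0 < eta -> exists2 del : R, 0 < del &
    forall s p q, 0 <= s <= T -> 0 <= p <= T -> 0 <= q <= T -> `|q - p| <= del ->
      `|\int[P]_w (G s w * (G q w - G p w)) - (q - p) * k s p| <= eta * `|q - p|].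
Proof.
have [C [th [k [C0 th0 h1 h2 h3]]]] := noise_increments_le.
have sG t : 0 <= t <= T -> sqint P (G t) by move=> /hG; exact: fbm_integral_sqint.
have swap s p q : 0 <= s <= T -> 0 <= p <= T -> 0 <= q <= T ->
    \int[P]_w (G s w * (G q w - G p w)) = - \int[P]_w (G s w * (G p w - G q w)).
  move=> sT pT qT; have i := sqintM (sG s sT) (sqintB (sG p pT) (sG q qT)).
  rewrite -mulN1r -(RintegralZl _ measurableT i).
  by apply: eq_Rintegral => w _; ring.
exists C, th, k; split => //.
- move=> s p q sT pT qT; have /andP[p0 pT'] := pT; have /andP[q0 qT'] := qT.
  have [pq|qp] := leP p q; first by rewrite (ger0_norm (x := q - p)) ?subr_ge0//; exact: h1.
  rewrite swap// normrN (ltr0_norm (x := q - p)) ?subr_lt0// opprB.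
  by apply: h1 => //; exact: ltW.
- move=> p q /andP[p0 pT'] /andP[q0 qT'].
  have [pq|qp] := leP p q; first by rewrite ger0_norm ?subr_ge0//; exact: h2.
  under eq_Rintegral do rewrite -opprB sqrrN.
  rewrite (ltr0_norm (x := q - p)) ?subr_lt0// opprB.
  by apply: h2 => //; exact: ltW.
- move=> eta eta0; have [del del0 hdel] := h3 eta eta0; exists del => //.
  move=> s p q sT pT qT; have /andP[p0 pT'] := pT; have /andP[q0 qT'] := qT.
  have [pq|qp] := leP p q.
    by rewrite (ger0_norm (x := q - p)) ?subr_ge0//; exact: hdel.
  rewrite swap// (ltr0_norm (x := q - p)) ?subr_lt0// opprB => pqd.
  have := hdel s q p p sT q0 (ltW qp) (lexx _) pT' pqd.
  by rewrite -normrN opprB -opprD mulrBl mulrBl; congr (`| _ | <= _); ring.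
Qed.

End noise.

(** * Test functions *)

Section test_functions.
Context {R : realType}.
Implicit Types (phi psi : R -> R) (M : R).

(** psi is the derivative of phi, and M bounds phi and its first two derivatives *)
Definition test_fun M phi psi : Prop :=
  [/\ measurable_fun setT phi /\ measurable_fun setT psi,
      forall x, `|phi x| <= M /\ `|psi x| <= M,
      forall x y, `|phi x - phi y| <= M * `|x - y|,
      forall x y, `|psi x - psi y| <= M * `|x - y|
    & forall x z, `|phi (x + z) - phi x - psi x * z| <= M * z ^+ 2].

Lemma mean_value (f df : R -> R) : (forall x : R, is_derive x 1 f (df x)) ->
  continuous f -> forall x z, exists2 c, `|c - x| <= `|z| & f (x + z) - f x = df c * z.
Proof.
move=> hf cf x z; have cfs (A : set R) : {within A, continuous f}.
  exact: continuous_subspaceT.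
have [z0|z0] := leP 0 z.
  have xz : x <= x + z by rewrite lerDl.
  have [c] := MVT_segment xz (fun x _ => hf x) (cfs _).
  rewrite in_itv/= => /andP[c1 c2] ->; exists c; last by rewrite addrAC subrr add0r.
  by rewrite !ger0_norm ?subr_ge0// lerBlDl.
have xz : x + z <= x by rewrite gerDl ltW.
have [c] := MVT_segment xz (fun x _ => hf x) (cfs _).
rewrite in_itv/= => /andP[c1 c2] e; exists c.
  by rewrite (ltr0_norm z0) ler0_norm ?subr_le0//; lra.
by rewrite -opprB e; ring.
Qed.

Lemma derivable_test_fun phi psi dpsi :
  (forall x : R, is_derive x 1 phi (psi x)) -> (forall x : R, is_derive x 1 psi (dpsi x)) ->
  continuous phi -> continuous psi -> (forall x, `|phi x| <= 1) ->
  (forall x, `|psi x| <= 1) -> (forall x, `|dpsi x| <= 1) -> test_fun 1 phi psi.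
Proof.
move=> d1 d2 c1 c2 b0 b1 b2.
have lip (f df : R -> R) : (forall x : R, is_derive x 1 f (df x)) -> continuous f ->
    (forall x, `|df x| <= 1) -> forall x y, `|f x - f y| <= 1 * `|x - y|.
  move=> hf cf dfC x y; have [c _] := mean_value hf cf y (x - y).
  by rewrite subrKC => ->; rewrite normrM ler_wpM2r.
split => //.
- by split; apply: continuous_measurable_fun.
- exact: lip d1 c1 b1.
- exact: lip d2 c2 b2.
move=> x z; have [c cx ->] := mean_value d1 c1 x z.
rewrite -mulrBl normrM mul1r -[z ^+ 2]real_normK ?num_real// expr2 ler_wpM2r//.
by rewrite (le_trans (lip _ _ d2 c2 b2 c x))// mul1r.
Qed.

(** Each derivative costs a factor y, hence the bound 1 + y^2 *)
Lemma test_fun_scale phi psi (y : R) : test_fun 1 phi psi ->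
  test_fun (1 + y ^+ 2) (fun x => phi (x * y)) (fun x => y * psi (x * y)).
Proof.
move=> [[m1 m2] bd l1 l2 tay].
have y1 : `|y| <= 1 + y ^+ 2.
  by rewrite -[y ^+ 2]real_normK ?num_real//; have := sqr_ge0 (`|y| - 1); have := normr_ge0 y; nra.
have y2 : `|y| * `|y| <= 1 + y ^+ 2 by rewrite -expr2 real_normK ?num_real// lerDr.
have my : measurable_fun setT (fun x : R => x * y) by exact: measurable_funM.
split.
- by split; [exact: measurableT_comp|apply: measurable_funM => //; exact: measurableT_comp].
- move=> x; have [h1 h2] := bd (x * y); split; first by rewrite (le_trans h1)// lerDl sqr_ge0.
  by rewrite normrM (le_trans _ y1)// ler_piMr.
- move=> x z; rewrite (le_trans (l1 _ _))// mul1r -mulrBl normrM mulrC ler_wpM2r//.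
- move=> x z; rewrite -mulrBr normrM.
  apply: (le_trans (ler_wpM2l (normr_ge0 y) (l2 _ _))).
  by rewrite mul1r -mulrBl normrM mulrCA mulrC ler_wpM2r.
- move=> x z; have := tay (x * y) (z * y); rewrite -mulrDl.
  rewrite (_ : psi (x * y) * (z * y) = y * psi (x * y) * z); last by ring.
  move=> /le_trans; apply; rewrite mul1r exprMn mulrC ler_wpM2r ?sqr_ge0//.
  by rewrite lerDr.
Qed.

Lemma test_fun_cos (y : R) : exists psi, test_fun (1 + y ^+ 2) (fun x => cos (x * y)) psi.
Proof.
exists (fun x => y * - sin (x * y)); apply: (test_fun_scale (phi := cos) (psi := fun x => - sin x)).
apply: (@derivable_test_fun cos (fun x => - sin x) (fun x => - cos x)).
- exact: continuous_cos.
- by move=> x; apply: cvgN; exact: continuous_sin.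
- exact: cos_max.
- by move=> x; rewrite normrN sin_max.
- by move=> x; rewrite normrN cos_max.
Qed.

Lemma test_fun_sin (y : R) : exists psi, test_fun (1 + y ^+ 2) (fun x => sin (x * y)) psi.
Proof.
exists (fun x => y * cos (x * y)); apply: (test_fun_scale (phi := sin) (psi := cos)).
apply: (@derivable_test_fun sin cos (fun x => - sin x)).
- exact: continuous_sin.
- exact: continuous_cos.
- exact: sin_max.
- exact: cos_max.
- by move=> x; rewrite normrN sin_max.
Qed.

End test_functions.

Section laws.
Context {R : realType} (V : completeNormedModType R).
Variable emb : {charge set R -> \bar R} -> V.
Hypothesis hV : is_M0 emb.
Context d (Omega : measurableType d) (P : probability Omega R).
Implicit Types X Y : {RV P >-> R}.

Lemma law_intg M phi psi X : test_fun M phi psi -> intg P (fun w => phi (X w)).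
Proof.
move=> [[m1 _] bd _ _ _]; have m : measurable_fun setT (fun w => phi (X w)).
  exact: measurableT_comp.
by apply: (intg_bounded P m (fun w => (bd _).1)).
Qed.

(** Cosines and sines of frequency y are test functions with M = 1 + y^2, a
    growth that the Gaussian weight of the norm absorbs *)
Lemma M0_norm_test : exists2 C0 : R, 0 <= C0 &
  (forall X, `|emb (law X)| <= C0) /\
  forall X X' X'' (k k' rho : R), 0 <= rho ->
  (forall M phi psi, test_fun M phi psi ->
    `|k * (\int[P]_w phi (X' w) - \int[P]_w phi (X w)) -
      k' * (\int[P]_w phi (X'' w) - \int[P]_w phi (X w))| <= M * rho) ->
  `|k *: (emb (law X') - emb (law X)) - k' *: (emb (law X'') - emb (law X))| <= C0 * rho.
Proof.
have [C0 C00 hC] := M0_norm_le hV.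
have test m rho : 0 <= rho -> (forall M phi psi, test_fun M phi psi ->
    `|charge_integral m phi| <= M * rho) -> `|emb m| <= C0 * rho.
  move=> rho0 h; apply: hC => // y; rewrite mulrC.
    by have [psi ht] := test_fun_cos y; exact: h ht.
  by have [psi ht] := test_fun_sin y; exact: h ht.
exists C0 => //; split.
  move=> X; rewrite -[leRHS]mulr1; apply: test => // M phi psi ht.
  have [[m1 _] bd _ _ _] := ht; rewrite mulr1 (charge_integral_law X m1 (fun x => (bd x).1)).
  have c := intg_cst P M.
  apply: (le_trans (le_Rint_abs (law_intg X ht) c (fun w => (bd _).1))).
  by rewrite Rint_cst.
move=> X X' X'' k k' rho rho0 h.
pose inc Y : {charge set R -> \bar R} := cadd (law Y) (cscale (-1) (law X)).
have incE Y : emb (law Y) - emb (law X) = emb (inc Y).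
  by rewrite (M0_embD hV) (M0_embZ hV) scaleN1r.
rewrite !incE -scaleNr -!(M0_embZ hV) -(M0_embD hV).
apply: test => // M phi psi ht; have [[m1 _] bd _ _ _] := ht.
have b1 x := (bd x).1.
rewrite (charge_integralD _ _ m1 b1) !(charge_integralZ _ _ m1 b1) /inc.
rewrite !(charge_integralD _ _ m1 b1) !(charge_integralZ _ _ m1 b1).
rewrite !(charge_integral_law _ m1 b1) !mulN1r mulNr.
exact: h ht.
Qed.

End laws.

(** * Continuity of the law of the solution *)

(** Reduces uniform bounds near t to dominated convergence along sequences *)
Lemma sequential_bound {R : realType} (D : set R) (F : R -> R) (t e : R) :
  (forall s : nat -> R, (forall n, D (s n)) -> s n @[n --> \oo] --> t ->
    exists n, F (s n) <= e) ->
  exists2 del : R, 0 < del & forall s, D s -> `|s - t| < del -> F s <= e.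
Proof.
move=> h; apply: contrapT => hno.
have bad n : exists s, D s /\ `|s - t| < n.+1%:R^-1 /\ e < F s.
  apply: contrapT => hn; apply: hno; exists n.+1%:R^-1; first by rewrite invr_gt0.
  move=> s Ds st; rewrite leNgt; apply/negP => es; apply: hn.
  by exists s.
have [s hs] := choice bad; have [|n] := h s (fun n => (hs n).1).
  apply/cvgrPdist_lt => eta eta0; near=> n.
  rewrite distrC (lt_trans (hs n).2.1)//; near: n.
  exact: (near_infty_natSinv_lt (PosNum eta0)).
by rewrite leNgt (hs n).2.2.
Unshelve. all: by end_near. Qed.

Section continuity_of_the_law.
Context {R : realType} (V : completeNormedModType R).
Variable emb : {charge set R -> \bar R} -> V.
Hypothesis hV : is_M0 emb.
Context d (Omega : measurableType d) (P : probability Omega R).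
Variables (T : R) (X : R -> {RV P >-> R}).
Hypothesis cX : {ae P, forall w, continuous_on T (fun t => X t w : R^o)}.

Lemma continuous_on_cvg (W : normedModType R) (b : R -> W) (s : nat -> R) (t : R) :
  continuous_on T b -> 0 <= t <= T -> (forall n, 0 <= s n <= T) ->
  s n @[n --> \oo] --> t -> b (s n) @[n --> \oo] --> b t.
Proof.
move=> cb tT sT st; apply/cvgrPdist_lt => eta eta0.
have [del del0 hdel] := cb t tT eta eta0.
move/cvgrPdist_lt : st => /(_ _ del0); apply: filterS => n h.
by rewrite distrC hdel// distrC.
Qed.

(** A test function moves by at most 2 M min(1, |X_s - X_t|), whose
    expectation tends to 0 by dominated convergence *)
Lemma continuous_law : continuous_on T (fun t => emb (law (X t))).
Proof.
move=> t tT eta eta0; have [C0 C00 [_ hC]] := M0_norm_test hV P.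
pose F s := \int[P]_w Num.min `|X s w - X t w| 1.
have mF s : measurable_fun setT (fun w => Num.min `|X s w - X t w| 1).
  by apply: measurable_minr => //; apply: measurableT_comp => //; exact: measurable_funB.
have F1 s w : `|Num.min `|X s w - X t w| 1| <= 1.
  by rewrite ger0_norm ?ge_min ?lexx ?orbT// le_min normr_ge0 ler01.
have e0 : 0 < eta / (2 * C0 + 1) / 2 by rewrite !divr_gt0// ltr_wpDl// mulr_ge0.
have [s sT st|del del0 hdel] := @sequential_bound R `[0, T]%classic F t (eta / (2 * C0 + 1) / 2).
  have lim : {ae P, forall w, Num.min `|X (s n) w - X t w| 1 @[n --> \oo] --> (0 : R)}.
    apply: filterS cX => w cw.
    have := continuous_on_cvg cw tT sT st; move=> /cvgrPdist_lt hw.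
    apply/cvgrPdist_lt => e e1; have := hw _ e1; apply: filterS => n hn.
    rewrite sub0r normrN ger0_norm; last by rewrite le_min normr_ge0 ler01.
    by rewrite gt_min distrC hn.
  have dom : {ae P, forall w, forall n, `|Num.min `|X (s n) w - X t w| 1| <= 1}.
    by apply: aeW => w n; exact: F1.
  have := (Rint_dominated (fun n => mF (s n)) (measurable_cst _) (intg_cst P 1) lim dom).2.
  rewrite Rint_cst => /cvgrPdist_le /(_ _ e0) [n _ /(_ n (leqnn n))]/=.
  by rewrite sub0r normrN => /(le_trans (ler_norm _)) h; exists n.
exists del => // s sT st.
have F0 : 0 <= F s by apply: Rintegral_ge0 => w _; rewrite le_min normr_ge0 ler01.
have := hC (X t) (X s) (X s) 1 0 (2 * F s).
rewrite scale1r scale0r subr0 => hn.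
apply: (@le_lt_trans _ _ (C0 * (2 * F s))).
  apply: hn; first by rewrite mulr_ge0.
  move=> M phi psi ht; have [_ bd lip _ _] := ht.
  rewrite mul1r mul0r subr0 -(RintegralB measurableT (law_intg (X s) ht) (law_intg (X t) ht)).
  have iF : intg P (fun w => Num.min `|X s w - X t w| 1).
    exact: (intg_bounded P (mF s) (F1 s)).
  have M0 : 0 <= M by apply: le_trans (bd 0).1.
  rewrite mulrA -(RintegralZl (M * 2) measurableT iF).
  apply: le_Rint_abs; [exact/intgB/(law_intg (X t) ht)/(law_intg (X s) ht)|exact: intgZ|move=> w].
  rewrite -mulrA; have [h|h] := leP `|X s w - X t w| 1.
    by rewrite (le_trans (lip _ _))// ler_wpM2l// ler_peMl// ler1n.
  rewrite mulr1 (le_trans (ler_normB _ _))// -[X in _ <= _ * X]/(1 + 1) mulrDr mulr1.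
  by apply: lerD; [exact: (bd (X s w)).1|exact: (bd (X t w)).1].
have h := hdel s sT st.
apply: (@le_lt_trans _ _ (C0 * (2 * (eta / (2 * C0 + 1) / 2)))).
  by rewrite ler_wpM2l// ler_wpM2l.
have -> : C0 * (2 * (eta / (2 * C0 + 1) / 2)) = eta * (C0 / (2 * C0 + 1)) by field; rewrite gt_eqF// ltr_wpDl// mulr_ge0.
by rewrite gtr_pMr// ltr_pdivrMr ?mul1r; lra.
Qed.

End continuity_of_the_law.

(** * Difference quotients of the law of the solution *)

Section differentiability_of_the_law.
Context {R : realType} (V : completeNormedModType R).
Variable emb : {charge set R -> \bar R} -> V.
Hypothesis hV : is_M0 emb.
Context d (Omega : measurableType d) (P : probability Omega R).
Variables (B BH : R -> {RV P >-> R}) (H T : R).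
Hypotheses (hH : 2^-1 < H < 1) (T0 : 0 < T).
Hypotheses (hB : is_brownian_motion B) (hBH : is_fbm H B BH).
Variables (Z : {RV P >-> R}) (K Ca : R) (al : R -> R -> R) (b : R -> R^o).
Variables (G : R -> Omega -> R) (X : R -> {RV P >-> R}).
Hypotheses (hZ : independent_RV_process Z `[0, T] BH) (K0 : 0 <= K).
Hypothesis mal : forall s, 0 <= s <= T -> measurable_fun setT (al s).
Hypothesis alL : forall s x y, 0 <= s <= T -> `|al s x - al s y| <= K * `|x - y|.
Hypothesis alC : forall s x, 0 <= s <= T -> `|al s x| <= Ca.
Hypothesis cb : continuous_on T b.
Hypothesis hG : forall t, 0 <= t <= T ->
  fbm_integral B H T (fun u => b u * \1_(`[0, t]) u) (G t).
Hypothesis hXc : {ae P, forall w, continuous_on T (fun s => al s (X s w) : R^o)}.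
Hypothesis hX : forall s, 0 <= s <= T -> {ae P, forall w,
  X s w = Z w + \int[lebesgue_measure]_(r in `[0, s]) al r (X r w) + G s w}.

Let hGlim s : 0 <= s <= T -> bh_limit BH T (G s).
Proof. by move=> sT; exact: (fbm_integral_limit hH T0 hB hBH cb sT (hG sT)). Qed.

Let sG s : 0 <= s <= T -> sqint P (G s).
Proof. by move=> /hGlim[]. Qed.

Let Ca0 : 0 <= Ca.
Proof. by apply: (le_trans (normr_ge0 (al 0 0)) (alC _ _)); rewrite lexx ltW. Qed.

(** The contribution of the drift to the increment of the solution *)
Let drift t s w : R := X s w - X t w - (G s w - G t w).

Let mdrift t s : 0 <= t <= T -> 0 <= s <= T -> measurable_fun setT (drift t s).
Proof.
move=> tT sT; apply: measurable_funB; first exact: measurable_funB.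
by apply: measurable_funB; [exact: (sG sT).1|exact: (sG tT).1].
Qed.

Let driftE t s : 0 <= t <= T -> 0 <= s <= T -> {ae P, forall w, drift t s w =
  \int[lebesgue_measure]_(r in `[0, s]) al r (X r w) -
  \int[lebesgue_measure]_(r in `[0, t]) al r (X r w)}.
Proof.
move=> tT sT; have := hX sT; have := hX tT; apply: filterS2 => w et es.
by rewrite /drift et es; ring.
Qed.

Let drift_bound t s : 0 <= t <= T -> 0 <= s <= T ->
  {ae P, forall w, `|drift t s w| <= Ca * `|s - t|}.
Proof.
move=> tT sT; have := driftE tT sT; have := hXc; apply: filterS2 => w cw ->.
have := @integral_increment_abs _ T _ t s 0 Ca cw tT sT.
by rewrite mulr0 subr0; apply => r rT _; rewrite subr0 alC.
Qed.

(** The drift part of the increment is differentiable in L^1, since its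
    integrand has continuous paths *)
Let drift_rate t eta : 0 <= t <= T -> 0 < eta -> exists2 del : R, 0 < del &
  forall s, 0 <= s <= T -> s != t -> `|s - t| < del ->
    \int[P]_w `|(s - t)^-1 * drift t s w - al t (X t w)| <= eta.
Proof.
move=> tT eta0; pose F s := \int[P]_w `|(s - t)^-1 * drift t s w - al t (X t w)|.
have [s sD st|del del0 hdel] :=
    @sequential_bound R [set s | 0 <= s <= T /\ s != t] F t eta; last first.
  by exists del => // s sT sn; exact: hdel.
have sT n : 0 <= s n <= T := (sD n).1.
have h0 n : 0 < `|s n - t| by rewrite normr_gt0 subr_eq0 (sD n).2.
have mf n : measurable_fun setT (fun w => `|(s n - t)^-1 * drift t (s n) w - al t (X t w)|).
  apply: measurableT_comp => //; apply: measurable_funB.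
    by apply: measurable_funM => //; exact: mdrift.
  by apply: measurableT_comp => //; exact: mal.
have lim : {ae P, forall w,
    `|(s n - t)^-1 * drift t (s n) w - al t (X t w)| @[n --> \oo] --> (0 : R)}.
  have all : {ae P, forall w, forall n, drift t (s n) w =
      \int[lebesgue_measure]_(r in `[0, s n]) al r (X r w) -
      \int[lebesgue_measure]_(r in `[0, t]) al r (X r w)}.
    by apply/ae_foralln => n; exact: driftE.
  have := hXc; move: all; apply: filterS2 => w ew cw.
  apply/cvgrPdist_le => e e0.
  have [del del0 hdel] := cw t tT e e0.
  move/cvgrPdist_lt : st => /(_ _ del0); apply: filterS => n hn.
  rewrite sub0r normrN normr_id.
  have := @integral_increment_abs _ T _ t (s n) (al t (X t w)) e cw tT (sT n).
  rewrite -ew => hinc.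
  have {}hinc : `|drift t (s n) w - (s n - t) * al t (X t w)| <= e * `|s n - t|.
    apply: hinc => r rT rt; apply/ltW/hdel => //.
    by rewrite (le_lt_trans rt)// distrC.
  rewrite -(ler_pM2r (h0 n)) (le_trans _ hinc)// -normrM mulrBl [_ * (s n - t)]mulrC.
  by rewrite mulrA mulfV ?mul1r 1?mulrC// subr_eq0 (sD n).2.
have dom : {ae P, forall w, forall n,
    `| `|(s n - t)^-1 * drift t (s n) w - al t (X t w)| | <= Ca + Ca}.
  have all : {ae P, forall w, forall n, `|drift t (s n) w| <= Ca * `|s n - t|}.
    by apply/ae_foralln => n; exact: drift_bound.
  move: all; apply: filterS => w hw n; rewrite normr_id (le_trans (ler_normB _ _))//.
  rewrite lerD ?alC// normrM normfV mulrC ler_pdivrMr//.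
have := (Rint_dominated mf (measurable_cst _) (intg_cst P (Ca + Ca)) lim dom).2.
rewrite Rint_cst => /cvgrPdist_le /(_ _ eta0) [n _ /(_ n (leqnn n))]/=.
by rewrite sub0r normrN => /(le_trans (ler_norm _)) h; exists n.
Qed.

Variables (C th : R) (k : R -> R -> R).
Hypotheses (C0 : 0 <= C) (th0 : 0 < th).
Hypothesis covG : forall s p q, 0 <= s <= T -> 0 <= p <= T -> 0 <= q <= T ->
  `|\int[P]_w (G s w * (G q w - G p w))| <= C * `|q - p|.
Hypothesis varG : forall p q, 0 <= p <= T -> 0 <= q <= T ->
  \int[P]_w ((G q w - G p w) ^+ 2) <= C * `|q - p| * `|q - p| `^ th.
Hypothesis diffG : forall eta : R, 0 < eta -> exists2 del : R, 0 < del &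
  forall s p q, 0 <= s <= T -> 0 <= p <= T -> 0 <= q <= T -> `|q - p| <= del ->
    `|\int[P]_w (G s w * (G q w - G p w)) - (q - p) * k s p| <= eta * `|q - p|.

Let remainder h : R := 2 * (Ca ^+ 2 * h ^+ 2 + C * h * h `^ th).

Let psi_intg M phi psi t (xi : Omega -> R) : test_fun M phi psi -> intg P xi ->
  intg P (fun w => psi (X t w) * xi w).
Proof.
move=> [[_ m2] bd _ _ _] ixi; have mxi := intg_measurable ixi.
have mp : measurable_fun setT (fun w => psi (X t w)) by exact: measurableT_comp.
have h : intg P (fun w => M * `|xi w|) by exact/intgZ/intg_abs.
apply: (intg_le _ _ h) => [|w]; first exact: measurable_funM.
by rewrite normrM ler_wpM2r//; exact: (bd _).2.
Qed.

Let drift_intg t s : 0 <= t <= T -> 0 <= s <= T -> intg P (drift t s).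
Proof.
by move=> tT sT; apply: (ae_intg (mdrift tT sT) (drift_bound tT sT)); exact: intg_cst.
Qed.

Let noise_intg t s : 0 <= t <= T -> 0 <= s <= T -> intg P (fun w => G s w - G t w).
Proof. by move=> tT sT; apply/sqint_intg/sqintB; exact: sG. Qed.

(** Taylor's formula. Its quadratic term is negligible, because the noise over
    a step h has a variance of order h^(1 + th) *)
Let test_increment M phi psi t s : test_fun M phi psi -> 0 <= t <= T -> 0 <= s <= T ->
  `|\int[P]_w phi (X s w) - \int[P]_w phi (X t w) -
    (\int[P]_w (psi (X t w) * drift t s w) + \int[P]_w (psi (X t w) * (G s w - G t w)))|
  <= M * remainder `|s - t|.
Proof.
move=> ht tT sT; have [_ bd _ _ tay] := ht.
have M0 : 0 <= M by apply: le_trans (bd 0).1.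
have i1 := law_intg (X s) ht; have i2 := law_intg (X t) ht.
have i3 := psi_intg t ht (drift_intg tT sT).
have i4 := psi_intg t ht (noise_intg tT sT).
have i5 : intg P (fun w => (G s w - G t w) ^+ 2) by apply: (sqintB (sG sT) (sG tT)).2.
have md2 : measurable_fun setT (fun w => drift t s w ^+ 2).
  by apply: measurable_funX; exact: mdrift.
have bd2 : {ae P, forall w, `|drift t s w ^+ 2| <= Ca ^+ 2 * `|s - t| ^+ 2}.
  apply: filterS (drift_bound tT sT) => w h.
  by rewrite normrX -exprMn lerXn2r ?nnegrE// mulr_ge0.
have c2 := intg_cst P (Ca ^+ 2 * `|s - t| ^+ 2).
have i6 := ae_intg md2 bd2 c2.
rewrite -(RintegralB measurableT i1 i2) -(RintegralD measurableT i3 i4).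
rewrite -(RintegralB measurableT (intgB i1 i2) (intgD i3 i4)).
have ig := intgZ (M * 2) (intgD i6 i5).
have pw w : `|phi (X s w) - phi (X t w) -
    (psi (X t w) * drift t s w + psi (X t w) * (G s w - G t w))| <=
    M * 2 * (drift t s w ^+ 2 + (G s w - G t w) ^+ 2).
  have := tay (X t w) (X s w - X t w); rewrite subrKC => h.
  have -> : psi (X t w) * drift t s w + psi (X t w) * (G s w - G t w) =
     psi (X t w) * (X s w - X t w) by rewrite /drift; ring.
  rewrite (le_trans h)// -mulrA ler_wpM2l// /drift.
  set x := X s w - X t w; set g := G s w - G t w.
  by have := sqr_ge0 (x - g - g); rewrite !expr2; lra.
apply: (le_trans (le_Rint_abs (intgB (intgB i1 i2) (intgD i3 i4)) ig pw)).
rewrite (RintegralZl _ measurableT (intgD i6 i5)) (RintegralD measurableT i6 i5).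
rewrite /remainder mulrA ler_wpM2l ?mulr_ge0// lerD ?varG//.
apply: (le_trans (ler_norm _)); apply: (le_trans (ae_le_Rint_abs md2 c2 bd2)).
by rewrite Rint_cst.
Qed.

Let noise_test M phi psi t (xi : Omega -> R) kap : test_fun M phi psi -> 0 <= t <= T ->
  bh_limit BH T xi -> 0 <= kap ->
  (forall s, 0 <= s <= T -> `|\int[P]_w (xi w * G s w)| <= kap) ->
  `|\int[P]_w (psi (X t w) * xi w)| <= M * (expR (K * T) * kap).
Proof.
move=> [[_ m2] bd _ lip _] tT hxi kap0 hkap.
have M0 : 0 <= M by apply: le_trans (bd 0).1.
under eq_Rintegral do rewrite mulrC.
have := solution_gauss hH T0 hB hBH hZ K0 mal alL hGlim hXc hX tT m2
  (fun x => (bd x).2) lip hxi kap0 hkap.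
move=> /le_trans; apply; rewrite -mulrA ler_wpM2l// ler_wpM2r// ler_expR ler_wpM2l//.
by have /andP[] := tT.
Qed.

Let covG' t s s' : 0 <= t <= T -> 0 <= s <= T -> 0 <= s' <= T ->
  `|\int[P]_w ((G s w - G t w) * G s' w)| <= C * `|s - t|.
Proof.
by move=> tT sT s'T; under eq_Rintegral do rewrite mulrC; exact: covG.
Qed.

(** The noise over a step h is not of order h, but its correlation with
    psi (X t) is *)
Lemma law_lipschitz : exists2 L : R, 0 < L & forall t s, 0 <= t <= T -> 0 <= s <= T ->
  `|emb (law (X s)) - emb (law (X t))| <= L * `|s - t|.
Proof.
have [N N0 [_ hN]] := M0_norm_test hV P.
pose L := Ca + expR (K * T) * C + 2 * (Ca ^+ 2 * T + C * T `^ th).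
have L0 : 0 <= L.
  by rewrite !addr_ge0// ?mulr_ge0 ?expR_ge0// ?addr_ge0 ?mulr_ge0 ?sqr_ge0 ?powR_ge0// ltW.
exists (N * L + 1); first by rewrite ltr_wpDl// mulr_ge0.
move=> t s tT sT; have := hN (X t) (X s) (X s) 1 0 (L * `|s - t|).
rewrite scale1r scale0r subr0 => h.
apply: (@le_trans _ _ (N * (L * `|s - t|))); last by rewrite mulrA ler_wpM2r// lerDl.
apply: h; first by rewrite mulr_ge0.
move=> M phi psi ht; have [_ bd _ _ _] := ht.
have M0 : 0 <= M by apply: le_trans (bd 0).1.
rewrite mul1r mul0r subr0; have h1 := test_increment ht tT sT.
have hxi := bh_limitB hH T0 hB hBH (hGlim sT) (hGlim tT).
have h2 := noise_test ht tT hxi (mulr_ge0 C0 (normr_ge0 (s - t))) (fun s' => @covG' t s s' tT sT).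
have i3 := psi_intg t ht (drift_intg tT sT).
have ia := intg_abs (drift_intg tT sT).
have h3 : `|\int[P]_w (psi (X t w) * drift t s w)| <= M * (Ca * `|s - t|).
  have pw w : `|psi (X t w) * drift t s w| <= M * `|drift t s w|.
    by rewrite normrM ler_wpM2r//; exact: (bd _).2.
  apply: (le_trans (le_Rint_abs i3 (intgZ M ia) pw)).
  rewrite (RintegralZl M measurableT ia) ler_wpM2l// (le_trans (ler_norm _))//.
  have c1 := intg_cst P (Ca * `|s - t|).
  apply: (@le_trans _ _ (\int[P]_w (Ca * `|s - t|))); last by rewrite Rint_cst.
  apply: (ae_le_Rint_abs _ c1); first exact: (intg_measurable ia).
  by apply: filterS (drift_bound tT sT) => w; rewrite normr_id.
have hT : `|s - t| <= T.
  by move: tT sT => /andP[t0 tT] /andP[s0 sT]; rewrite ler_norml; apply/andP; split; lra.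
have h4 : remainder `|s - t| <= 2 * (Ca ^+ 2 * T + C * T `^ th) * `|s - t|.
  rewrite /remainder -[leRHS]mulrA ler_wpM2l// mulrDl lerD//.
    by rewrite [_ ^+ 2 in X in _ * X]expr2 -[leRHS]mulrA ler_wpM2l ?sqr_ge0// ler_wpM2r.
  rewrite mulrAC ler_wpM2r// ler_wpM2l//.
  by apply: ge0_ler_powR; rewrite ?nnegrE ?(ltW th0)// ltW.
set x := \int[P]_w phi (X s w) - \int[P]_w phi (X t w) in h1 *.
set y := \int[P]_w (psi (X t w) * drift t s w) in h1 h3.
set z := \int[P]_w (psi (X t w) * (G s w - G t w)) in h1 h2.
have := ler_normD (x - (y + z)) (y + z); rewrite subrK => /le_trans; apply.
have := ler_normD y z; have := ler_wpM2l M0 h4.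
by rewrite /L; move: h1 h2 h3; rewrite !mulrDl !mulrDr !mulrDl !mulrDr; lra.
Qed.

(** The noise itself has no derivative, so two difference quotients are compared
    with each other: their difference only involves xi, a combination of
    increments of the noise whose covariances with the noise are small *)
Lemma law_quotient_cauchy t eta : 0 <= t <= T -> 0 < eta ->
  exists2 del : R, 0 < del & forall s s', 0 <= s <= T -> 0 <= s' <= T ->
    s != t -> s' != t -> `|s - t| < del -> `|s' - t| < del ->
    `|(s - t)^-1 *: (emb (law (X s)) - emb (law (X t))) -
      (s' - t)^-1 *: (emb (law (X s')) - emb (law (X t)))| <= eta.
Proof.
move=> tT eta0; have [N N0 [_ hN]] := M0_norm_test hV P.
pose E := expR (K * T); have E0 : 0 <= E by exact: expR_ge0.
pose D := N * (2 + 2 + 2 * E) + 1.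
have D0 : 0 < D by rewrite ltr_wpDl// mulr_ge0// !addr_ge0// mulr_ge0.
pose e := eta / D; have e0 : 0 < e by rewrite divr_gt0.
have [d1 d10 hd1] := drift_rate tT e0.
have [d2 d20 hd2] := diffG e0.
(* the second order remainder of the test functions, divided by the step *)
have [d3 d30 hd3] : exists2 d3 : R, 0 < d3 & forall h, 0 < h -> h < d3 -> remainder h <= e * h.
  have q0 : 0 < 2 * (Ca ^+ 2 + C) + 1 by rewrite ltr_wpDl// mulr_ge0// addr_ge0// sqr_ge0.
  pose r := e / (2 * (Ca ^+ 2 + C) + 1); have r0 : 0 < r by rewrite divr_gt0.
  exists (Num.min r (r `^ th^-1)); first by rewrite lt_min r0 powR_gt0.
  move=> h h0; rewrite lt_min => /andP[hr hr'].
  have hth : h `^ th <= r.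
    apply: (@le_trans _ _ ((r `^ th^-1) `^ th)).
      by apply: ge0_ler_powR; rewrite ?nnegrE ?powR_ge0 ?(ltW th0) ?(ltW h0)// ltW.
    by rewrite -powRrM mulVf ?gt_eqF// powRr1// ltW.
  have h1 : Ca ^+ 2 * h ^+ 2 <= Ca ^+ 2 * r * h.
    by rewrite -mulrA ler_wpM2l ?sqr_ge0// [h ^+ 2]expr2 ler_wpM2r// ltW.
  have h2 : C * h * h `^ th <= C * h * r by rewrite ler_wpM2l// mulr_ge0// ltW.
  have h3 : 2 * (Ca ^+ 2 + C) * r <= e.
    rewrite /r mulrCA ler_piMr ?(ltW e0)// ler_pdivrMr// mul1r lerDl//.
  have := ler_wpM2r (ltW h0) h3; rewrite /remainder; lra.
exists (Num.min d1 (Num.min d2 d3)); first by rewrite !lt_min d10 d20.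
move=> s s' sT s'T sn s'n; rewrite !lt_min => /and3P[s1 s2 s3] /and3P[s1' s2' s3'].
apply: (@le_trans _ _ (N * ((2 + 2 + 2 * E) * e))); last first.
  rewrite mulrA /e mulrCA ler_piMr ?(ltW eta0)// ler_pdivrMr// mul1r /D lerDl//.
apply: hN; first by rewrite mulr_ge0 ?(ltW e0)// !addr_ge0// mulr_ge0.
move=> M phi psi ht; have [_ bd _ _ _] := ht.
have M0 : 0 <= M by apply: le_trans (bd 0).1.
have ia : intg P (fun w => al t (X t w)).
  have m : measurable_fun setT (fun w => al t (X t w)).
    by apply: measurableT_comp => //; exact: mal.
  by apply: (intg_bounded P m (fun w => alC _ tT)).
pose j r := \int[P]_w (psi (X t w) * (G r w - G t w)).
pose L := \int[P]_w (psi (X t w) * al t (X t w)).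
(* the quotient of a test integral, up to the contribution of the noise *)
have main r : 0 <= r <= T -> r != t -> `|r - t| < d1 -> `|r - t| < d3 ->
    `|(r - t)^-1 * (\int[P]_w phi (X r w) - \int[P]_w phi (X t w)) -
      (L + (r - t)^-1 * j r)| <= M * (2 * e).
  move=> rT rn r1 r3; have rt0 : r - t != 0 by rewrite subr_eq0.
  have art0 : 0 < `|r - t| by rewrite normr_gt0.
  have i3 := psi_intg t ht (drift_intg tT rT).
  have iq := intgB (intgZ (r - t)^-1 (drift_intg tT rT)) ia.
  have h1 : `|(r - t)^-1 * \int[P]_w (psi (X t w) * drift t r w) - L| <= M * e.
    rewrite -(RintegralZl (r - t)^-1 measurableT i3).
    rewrite -(RintegralB measurableT (intgZ (r - t)^-1 i3) (psi_intg t ht ia)).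
    have pw w : `|(r - t)^-1 * (psi (X t w) * drift t r w) - psi (X t w) * al t (X t w)| <=
        M * `|(r - t)^-1 * drift t r w - al t (X t w)|.
      rewrite mulrCA -mulrBr normrM ler_wpM2r//; exact: (bd _).2.
    apply: (le_trans (le_Rint_abs (intgB (intgZ _ i3) (psi_intg t ht ia)) (intgZ M (intg_abs iq)) pw)).
    rewrite (RintegralZl M measurableT (intg_abs iq)) ler_wpM2l//.
    exact: hd1.
  have h2 := test_increment ht tT rT; rewrite -/(j r) in h2.
  have h3 : `|(r - t)^-1 * (\int[P]_w phi (X r w) - \int[P]_w phi (X t w) -
      (\int[P]_w (psi (X t w) * drift t r w) + j r))| <= M * e.
    rewrite normrM normfV mulrC ler_pdivrMr// (le_trans h2)// -mulrA ler_wpM2l//.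
    exact: hd3.
  set x := (r - t)^-1 in h1 h3 *.
  set y := \int[P]_w (psi (X t w) * drift t r w) in h1 h3.
  set z := \int[P]_w phi (X r w) - \int[P]_w phi (X t w) in h3 *.
  have -> : x * z - (L + x * j r) = (x * (z - (y + j r))) + (x * y - L) by ring.
  by rewrite (le_trans (ler_normD _ _))// mulrCA [2 * _]mulrDl !mul1r lerD.
pose xi w := (s - t)^-1 * (G s w - G t w) - (s' - t)^-1 * (G s' w - G t w).
have hxi : bh_limit BH T xi.
  have hs := bh_limitB hH T0 hB hBH (hGlim sT) (hGlim tT).
  have hs' := bh_limitB hH T0 hB hBH (hGlim s'T) (hGlim tT).
  have h00 : bh_limit BH T (fun=> 0).
    have := bh_limitB hH T0 hB hBH (hGlim tT) (hGlim tT).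
    by under eq_fun do rewrite subrr.
  have := bh_limitD hH T0 hB hBH (- (s' - t)^-1)
    (bh_limitD hH T0 hB hBH (s - t)^-1 h00 hs) hs'.
  by congr (bh_limit _ _ _); apply/funext => w; rewrite /xi add0r mulNr.
have noise : `|(s - t)^-1 * j s - (s' - t)^-1 * j s'| <= M * (E * (2 * e)).
  have -> : (s - t)^-1 * j s - (s' - t)^-1 * j s' = \int[P]_w (psi (X t w) * xi w).
    have i1 := psi_intg t ht (noise_intg tT sT).
    have i2 := psi_intg t ht (noise_intg tT s'T).
    rewrite /j -(RintegralZl (s - t)^-1 measurableT i1) -(RintegralZl (s' - t)^-1 measurableT i2).
    rewrite -(RintegralB measurableT (intgZ _ i1) (intgZ _ i2)).
    by apply: eq_Rintegral => w _; rewrite /xi; ring.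
  apply: (noise_test ht tT hxi); first by rewrite mulr_ge0// ltW.
  move=> u uT; have cov r : 0 <= r <= T -> r != t -> `|r - t| < d2 ->
      `|(r - t)^-1 * \int[P]_w (G u w * (G r w - G t w)) - k u t| <= e.
    move=> rT rn r2; have rt0 : r - t != 0 by rewrite subr_eq0.
    have h := hd2 u t r uT tT rT (ltW r2).
    have -> : (r - t)^-1 * \int[P]_w (G u w * (G r w - G t w)) - k u t =
      (r - t)^-1 * (\int[P]_w (G u w * (G r w - G t w)) - (r - t) * k u t).
      by rewrite mulrBr mulKf.
    by rewrite normrM normfV mulrC ler_pdivrMr ?normr_gt0.
  have i1 := sqintM (sG uT) (sqintB (sG sT) (sG tT)).
  have i2 := sqintM (sG uT) (sqintB (sG s'T) (sG tT)).
  have -> : \int[P]_w (xi w * G u w) =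
      (s - t)^-1 * \int[P]_w (G u w * (G s w - G t w)) -
      (s' - t)^-1 * \int[P]_w (G u w * (G s' w - G t w)).
    rewrite -(RintegralZl (s - t)^-1 measurableT i1) -(RintegralZl (s' - t)^-1 measurableT i2).
    rewrite -(RintegralB measurableT (intgZ _ i1) (intgZ _ i2)).
    by apply: eq_Rintegral => w _; rewrite /xi; ring.
  have := cov s sT sn s2; have := cov s' s'T s'n s2'.
  by rewrite !ler_norml => /andP[? ?] /andP[? ?]; apply/andP; split; lra.
have h2 := main s sT sn s1 s3; have h3 := main s' s'T s'n s1' s3'.
set q := (s - t)^-1 * j s in noise h2; set q' := (s' - t)^-1 * j s' in noise h3.
set x := (s - t)^-1 * _ in h2 *; set x' := (s' - t)^-1 * _ in h3 *.
have -> : M * ((2 + 2 + 2 * E) * e) = M * (2 * e) + M * (2 * e) + M * (E * (2 * e)) by ring.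
by move: noise h2 h3; rewrite !ler_norml => /andP[? ?] /andP[? ?] /andP[? ?]; apply/andP; split; lra.
Qed.

End differentiability_of_the_law.

(** * From difference quotients to the derivative *)

Lemma lipschitz_absolutely_continuous {R : realType} (V : normedModType R) (a b L : R)
  (f : R -> V) : 0 < L ->
  (forall u v, a <= u <= b -> a <= v <= b -> `|f v - f u| <= L * `|v - u|) ->
  absolutely_continuous_on a b f.
Proof.
move=> L0 fL e e0; exists (e / L); first by rewrite divr_gt0.
move=> n u v uv _ small; apply: (@le_lt_trans _ _ (L * \sum_(i < n) (v i - u i))).
  rewrite mulr_sumr; apply: ler_sum => i _; have [au [uv' vb]] := uv i.
  rewrite (le_trans (fL (u i) (v i) _ _)) ?au ?vb ?(le_trans uv' vb) ?(le_trans au uv')//.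
  by rewrite ger0_norm// subr_ge0.
by rewrite mulrC -ltr_pdivlMr.
Qed.

Lemma cauchy_quotient_cvg {R : realType} (V : completeNormedModType R) (T t : R)
  (q : R -> V) : 0 < T -> 0 <= t <= T ->
  (forall eta : R, 0 < eta -> exists2 del : R, 0 < del & forall h h',
    0 <= t + h <= T -> 0 <= t + h' <= T -> h != 0 -> h' != 0 ->
    `|h| < del -> `|h'| < del -> `|q h - q h'| <= eta) ->
  exists l : V, q h @[h --> within [set h | t + h \in `[0, T]] 0^'] --> l.
Proof.
move=> T0 /andP[t0 tT] hq; pose F := within [set h : R | t + h \in `[0, T]] 0^'.
have FE (A : set R) : F A <->
    nbhs (0 : R) (fun h => h != 0 -> t + h \in `[0, T] -> A h) by [].
have nearF (del : R) (A : set R) : 0 < del ->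
    (forall h, 0 <= t + h <= T -> h != 0 -> `|h| < del -> A h) -> F A.
  move=> del0 hA; apply/FE/nbhs_ballP.
  exists del => // h hd h0 hT; apply: hA => //.
  by move: hd; rewrite /ball/= sub0r normrN.
have step (del : R) : 0 < del -> exists h, [/\ 0 <= t + h <= T, h != 0 & `|h| < del].
  move=> del0; pose m := Num.min (del / 2) (T / 2).
  have m0 : 0 < m by rewrite lt_min !divr_gt0.
  have m1 : m <= del / 2 by rewrite ge_min lexx.
  have m2 : m <= T / 2 by rewrite ge_min lexx orbT.
  have [h|h] := leP t (T / 2); [exists m|exists (- m)].
    by split; [apply/andP; split; lra|rewrite gt_eqF|rewrite gtr0_norm//; lra].
  by split; [apply/andP; split; lra|rewrite lt_eqF// oppr_lt0|rewrite normrN gtr0_norm//; lra].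
have FP : ProperFilter F.
  apply: Build_ProperFilter_ex => A /FE.
  move=> /nbhs_ballP[del /= del0 hA]; have [h [hT h0 hd]] := step del del0.
  exists h; apply: hA => //.
  by rewrite /ball/= sub0r normrN.
have : cvg (q h @[h --> F]).
  apply/cauchy_cvgP/cauchy_exP => eps eps0.
  have e2 : 0 < eps / 2 by rewrite divr_gt0.
  have [del del0 hdel] := hq _ e2; have [h [hT h0 hd]] := step del del0.
  exists (q h); apply: (nearF del) => // h' h'T h'0 h'd.
  rewrite /= -ball_normE /ball_/= (le_lt_trans (hdel h h' hT h'T h0 h'0 hd h'd))//.
  by rewrite ltr_pdivrMr// ltr_pMr// ltr1n.
by move=> ?; exists (lim (q h @[h --> F])).
Qed.

Lemma continuous_on_windowed {R : realType} (T C t : R) (b : R -> R^o) : 0 <= C ->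
  continuous_on T b -> (forall s, 0 <= s <= T -> `|b s| <= C) -> 0 <= t <= T ->
  windowed T C (fun u => b u * \1_(`[0, t]) u).
Proof.
move=> C0 cb bC /andP[t0 tT].
pose g : R -> R := (b : R -> R) \_ `[0, T].
have mb : measurable_fun (`[0, T]%classic : set R) (b : R -> R).
  apply: subspace_continuous_measurable_fun => //.
  exact/(within_continuous_on T b).
have mr : measurable_fun setT g.
  exact: (measurable_restrictT (b : R -> R) (measurable_itv `[0, T])).1 mb.
have bE u : b u * \1_(`[0, t]) u = g u * \1_(`[0, t]) u :> R.
  rewrite /g patchE !indicE !mem_setE !in_itv/=.
  case: (boolP (0 <= u <= t)) => [/andP[u0 ut]|]; last by rewrite !mulr0.
  by rewrite u0 (le_trans ut tT).
split.
  have -> : (fun u => b u * \1_(`[0, t]) u : R) = (fun u => g u * \1_(`[0, t]) u).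
    by apply/funext => u; exact: bE.
  by apply: measurable_funM => //; exact: measurable_indic.
move=> u; rewrite normrM !indicE !mem_setE !in_itv/=.
case: (boolP (0 <= u <= t)) => [/andP[u0 ut]|_]; last by rewrite normr0 mulr0 mulr_ge0 ?ler0n.
have uT : 0 <= u <= T by rewrite u0 (le_trans ut tT).
by rewrite uT normr1 !mulr1 bC.
Qed.

Theorem lemma2p17 (R : realType) (d : measure_display)
  (Omega : measurableType d) (P : probability Omega R)
  (V : completeNormedModType R) (emb : {charge set R -> \bar R} -> V)
  (hV : is_M0 emb)
  (H T : R) (hH : 2^-1 < H < 1) (hT : 0 < T)
  (B BH : R -> {RV P >-> R})
  (hB : is_brownian_motion B) (hBH : is_fbm H B BH)
  (Z : {RV P >-> R})
  (hZ2 : (Z : Omega -> R) \in Lfun P 2%:E)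
  (hZ : independent_RV_process Z `[0, T] BH)
  (alpha : R -> R -> V -> R) (beta : R -> V -> R) (K : R -> R)
  (hK0 : forall t : R, t \in `[0, T] -> 0 <= K t)
  (hK : {in `[0, T] &, {homo K : s t / s <= t}})
  (halphaL : forall (t x y : R) (m n : V), t \in `[0, T] ->
     `|alpha t x m - alpha t y n| <= K t * (`|x - y| + `|m - n|))
  (hbetaL : forall (t : R) (m n : V), t \in `[0, T] ->
     `|beta t m - beta t n| <= K t * `|m - n|)
  (hgrowth : forall t : R, t \in `[0, T] ->
     `|alpha t 0 (emb delta0)| + `|beta t (emb delta0)| <= K t)
  (halpha_bnd : forall m : V, exists C : R, forall t x : R, t \in `[0, T] ->
     `|alpha t x m| <= C)
  (hbeta_bnd : forall m : V, exists C : R, forall t : R, t \in `[0, T] ->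
     `|beta t m| <= C)
  (halpha_t : forall (x : R) (m : V),
     {within `[0, T], continuous (fun t => alpha t x m)})
  (halpha_x : forall (t : R) (m : V), t \in `[0, T] ->
     continuous (fun x => alpha t x m))
  (hbeta_t : forall m : V, {within `[0, T], continuous (fun t => beta t m)})
  (X : R -> {RV P >-> R}) (mu : R -> V)
  (hX : is_mv_solution emb T H alpha beta B Z X mu)
  (hM2 : exists C : R, forall t : R, t \in `[0, T] ->
     `|M2op H (fun s => beta s (mu s) * \1_(`[0, t]) s) t| <= C) :
  [/\ absolutely_continuous_on 0 T mu,
      forall t : R, t \in `[0, T] -> exists l : V,
        (h^-1 *: (mu (t + h) - mu t))
          @[h --> within [set h | t + h \in `[0, T]] 0^'] --> l
    & exists2 C : R, 0 < C & forall t h : R, t \in `[0, T] -> t + h \in `[0, T] ->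
        `|mu (t + h) - mu t| <= C * `|h|].
Proof.
have in_T t : (t \in `[0, T]) = (0 <= t <= T) by rewrite in_itv.
have K0 : 0 <= K T by apply: hK0; rewrite in_T lexx ltW.
have Kle t : 0 <= t <= T -> K t <= K T.
  by move=> tT; apply: hK; rewrite ?in_T ?lexx ?(ltW hT)//; case/andP: tT.
have muE t : 0 <= t <= T -> mu t = emb (law (X t)).
  by move=> tT; apply: (mv_law hX); rewrite in_T.
have cX : {ae P, forall w, continuous_on T (fun t => X t w : R^o)}.
  by apply: filterS (mv_continuous hX) => w; move/within_continuous_on.
have cmu : continuous_on T mu.
  move=> t tT eta eta0; have [del del0 h] := continuous_law hV cX tT eta0.
  by exists del => // s sT st; rewrite !muE//; exact: h.
have [N N0 [Nmu _]] := M0_norm_test hV P.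
have mu_bound t : 0 <= t <= T -> `|mu t - 0| <= N.
  by move=> tT; rewrite subr0 muE.
(* the coefficients along the flow of the laws; they are bounded because they
   are at the measure 0, and the laws have norm at most N *)
pose al s x := alpha s x (mu s); pose b s : R^o := beta s (mu s).
have alL s x y : 0 <= s <= T -> `|al s x - al s y| <= K T * `|x - y|.
  move=> sT; have := halphaL s x y (mu s) (mu s).
  rewrite in_T subrr normr0 addr0 => /(_ sT) /le_trans; apply.
  by rewrite ler_wpM2r// Kle.
have mal s : 0 <= s <= T -> measurable_fun setT (al s).
  by move=> sT; apply: continuous_measurable_fun; apply: halpha_x; rewrite in_T.
have [Ca hCa] := halpha_bnd 0.
have alC s x : 0 <= s <= T -> `|al s x| <= Ca + K T * N.
  move=> sT; rewrite -[al s x](subrK (alpha s x 0)) (le_trans (ler_normD _ _))// addrC lerD//.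
    by apply: hCa; rewrite in_T.
  have := halphaL s x x (mu s) 0; rewrite in_T subrr normr0 add0r => /(_ sT) /le_trans; apply.
  by apply: ler_pM; rewrite ?Kle ?mu_bound//; apply: hK0; rewrite in_T.
have [Cb0 hCb] := hbeta_bnd 0.
have bC s : 0 <= s <= T -> `|b s| <= Cb0 + K T * N.
  move=> sT; rewrite -[b s](subrK (beta s 0)) (le_trans (ler_normD _ _))// addrC lerD//.
    by apply: hCb; rewrite in_T.
  have := hbetaL s (mu s) 0; rewrite in_T => /(_ sT) /le_trans; apply.
  by apply: ler_pM; rewrite ?Kle ?mu_bound//; apply: hK0; rewrite in_T.
have K1 : 0 < K T + 1 by rewrite ltr_wpDl.
have cb : continuous_on T b.
  move=> t tT eta eta0; have e2 : 0 < eta / 2 by rewrite divr_gt0.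
  have [d1 d10 h1] := (within_continuous_on T (fun s => beta s (mu t) : R^o)).1
    (hbeta_t (mu t)) t tT _ e2.
  have [d2 d20 h2] := cmu t tT _ (divr_gt0 e2 K1).
  exists (Num.min d1 d2); first by rewrite lt_min d10.
  move=> s sT; rewrite lt_min => /andP[s1 s2].
  have -> : b s - b t = (beta s (mu s) - beta s (mu t)) + (beta s (mu t) - beta t (mu t)).
    by rewrite /b addrA subrK.
  rewrite (le_lt_trans (ler_normD _ _))// (splitr eta) ler_ltD//; last exact: h1.
  have := hbetaL s (mu s) (mu t); rewrite in_T => /(_ sT) /le_trans; apply.
  have := h2 s sT s2; rewrite ltr_pdivlMr// => h; rewrite (le_trans _ (ltW h))// mulrC.
  by rewrite ler_wpM2l// (le_trans (Kle s sT))// lerDl.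
have cal : {ae P, forall w, continuous_on T (fun s => al s (X s w) : R^o)}.
  apply: filterS cX => w cw t tT eta eta0; have e2 : 0 < eta / 2 by rewrite divr_gt0.
  have e4 : 0 < eta / 2 / 2 by rewrite divr_gt0.
  have [d1 d10 h1] := (within_continuous_on T (fun s => alpha s (X t w) (mu t) : R^o)).1
    (halpha_t (X t w) (mu t)) t tT _ e2.
  have [d2 d20 h2] := cmu t tT _ (divr_gt0 e4 K1).
  have [d3 d30 h3] := cw t tT _ (divr_gt0 e4 K1).
  exists (Num.min d1 (Num.min d2 d3)); first by rewrite !lt_min d10 d20.
  move=> s sT; rewrite !lt_min => /and3P[s1 s2 s3].
  have -> : al s (X s w) - al t (X t w) =
      (alpha s (X s w) (mu s) - alpha s (X t w) (mu t)) +
      (alpha s (X t w) (mu t) - alpha t (X t w) (mu t)).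
    by rewrite /al addrA subrK.
  rewrite (le_lt_trans (ler_normD _ _))// (splitr eta) ler_ltD//; last exact: h1.
  have := halphaL s (X s w) (X t w) (mu s) (mu t); rewrite in_T => /(_ sT) /le_trans; apply.
  have := h2 s sT s2; have := h3 s sT s3.
  rewrite (ltr_pdivlMr _ (eta / 2 / 2))// => g3; rewrite (ltr_pdivlMr _ (eta / 2 / 2))// => g2.
  apply: (@le_trans _ _ ((K T + 1) * (`|X s w - X t w| + `|mu s - mu t|))).
    by rewrite ler_wpM2r ?addr_ge0// (le_trans (Kle s sT))// lerDl.
  by rewrite mulrDr (splitr (eta / 2)); apply: lerD; rewrite mulrC; exact: ltW.
have Cb_ge0 : 0 <= Cb0 + K T * N.
  by apply: (le_trans (normr_ge0 (b 0)) (bC _ _)); rewrite lexx ltW.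
have bwin t := continuous_on_windowed Cb_ge0 cb bC (t := t).
have exG t : exists I : Omega -> R, 0 <= t <= T ->
    fbm_integral B H T (fun u => b u * \1_(`[0, t]) u) I /\
    {ae P, forall w, X t w = Z w +
      \int[lebesgue_measure]_(r in `[0, t]) al r (X r w) + I w}.
  have [tT|] := boolP (0 <= t <= T); last by exists (fun=> 0).
  have [|I [hI eI]] := @mv_eq _ _ _ _ _ _ _ _ _ _ _ _ _ _ hX t; first by rewrite in_T.
  exists I => _; split => //; exact: (fbm_integral_def hB Cb_ge0 (bwin t tT) hI).
have [G hG] := choice exG.
have hG1 t tT := (hG t tT).1; have hG2 t tT := (hG t tT).2.
have [C [th [k [C0 th0 covG varG diffG]]]] := noise_increments hH hT hB cb bC hG1.
have [L L0 hL] := law_lipschitz hV hH hT hB hBH hZ K0 mal alL alC cb hG1 cal hG2 C0 th0 covG varG.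
have lip u v : 0 <= u <= T -> 0 <= v <= T -> `|mu v - mu u| <= L * `|v - u|.
  by move=> uT vT; rewrite !muE//; exact: hL.
split.
- exact: lipschitz_absolutely_continuous lip.
- move=> t; rewrite in_T => tT; apply: cauchy_quotient_cvg => // eta eta0.
  have [del del0 hdel] := law_quotient_cauchy hV hH hT hB hBH hZ K0 mal alL alC cb hG1
    cal hG2 C0 th0 varG diffG tT eta0.
  exists del => // h h' hT' h'T' h0 h'0 hd h'd.
  have dE x : t + x - t = x by rewrite addrAC subrr add0r.
  have := hdel (t + h) (t + h') hT' h'T'; rewrite !dE -!muE//.
  by apply => //; rewrite -subr_eq0 dE.
- exists L => // t h; rewrite !in_T => tT thT.
  by have := lip t (t + h) tT thT; rewrite addrAC subrr add0r.
Qed.
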